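(* Let $d$ be a positive integer, let $\sigma:\mathbb C^d\to\mathbb C^d$ be an affine-linear involution, and let $U,V$ be two domains in $\mathbb C^d$. Let $\phi:U\to V$ be a $\sigma$-invariant $2$-proper map and let $\mathscr H(U)$ be a $\sigma$-invariant functional Hilbert space with reproducing kernel $\kappa:U\times U\to\mathbb C$. Assume further that $J_\sigma=-1$ and that $J_\phi$ is affine-linear. Then the linear space $$\mathscr H_\phi(V):=\{f\in\mathrm{Hol}(V): J_\phi\cdot (f\circ\phi)\in\mathscr H(U)\}$$ endowed with the norm $$\|f\|_\phi:=\|J_\phi\cdot (f\circ\phi)\|_{\mathscr H(U)}$$ is a Hilbert space. Moreover, for the linear mapping $\varGamma_\phi$ defined by $\varGamma_\phi(f)=J_\phi\cdot (f\circ\phi)$, $f\in\mathrm{Hol}(V)$, the following statements hold: (i) $\varGamma_\phi$ is a unitary from $\mathscr H_\phi(V)$ onto $\mathscr H^\sigma_-(U):=\{f\in\mathscr H(U): f=-f\circ\sigma\}$. (ii) $\mathscr H_\phi(V)$ is a reproducing kernel Hilbert space with the reproducing kernel $\kappa_\phi:V\times V\to\mathbb C$ given by $$J_\phi(z)\,\kappa_\phi(\phi(z),\phi(w))\,\overline{J_\phi(w)}=\frac12\big(\kappa(z,w)-\kappa(\sigma(z),w)\big),\qquad z,w\in U.$$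
   Context: A domain is a nonempty open connected subset of $\mathbb C^d$; $\mathrm{Hol}(U)$ is the space of complex-valued holomorphic functions on $U$. A map $\psi:\mathbb C^d\to\mathbb C^d$ is affine-linear if $\psi(z)=Az+B$ for a linear operator $A$ on $\mathbb C^d$ and $B\in\mathbb C^d$; a scalar function on $U$ is affine-linear if it has the form $z\mapsto\sum_{j=1}^d a_jz_j-b$ with $a_1,\dots,a_d,b\in\mathbb C$. $J_\psi$ denotes the Jacobian of a holomorphic map $\psi$, i.e. the determinant of its complex Jacobian matrix, and $Z(f)$ is the zero set of a function $f$. An involution is a continuous map $\sigma:\mathbb C^d\to\mathbb C^d$ with $\sigma\circ\sigma=I$. $U$ is $\sigma$-invariant if $\sigma(z)\in U$ for every $z\in U$; a map $\phi:U\to V$ is $\sigma$-invariant if $U$ is $\sigma$-invariant and $\phi\circ\sigma=\phi$. A continuous map $\phi:U\to V$ is proper if the preimage of every compact subset of $V$ is compact. A proper holomorphic map $\phi:U\to V$ has multiplicity $m$ (is $m$-proper) if $\mathrm{card}(\phi^{-1}(\{z\}))=m$ for every $z\in V\setminus\phi(Z(J_\phi))$ and $\mathrm{card}(\phi^{-1}(\{z\}))<m$ for every $z\in\phi(Z(J_\phi))$. An $m$-proper map is by definition holomorphic. A functional Hilbert space $\mathscr H(U)$ is a reproducing kernel Hilbert space consisting of complex-valued holomorphic functions on $U$; its reproducing kernel $\kappa$ satisfies $\kappa(\cdot,w)\in\mathscr H(U)$ and $\langle f,\kappa(\cdot,w)\rangle=f(w)$ for all $f\in\mathscr H(U)$,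 $w\in U$. For a $\sigma$-invariant domain $U$, $\mathscr H(U)$ is $\sigma$-invariant if for every $f\in\mathscr H(U)$ one has $f\circ\sigma\in\mathscr H(U)$, and $\langle f\circ\sigma,g\circ\sigma\rangle=\langle f,g\rangle$ for all $f,g\in\mathscr H(U)$. The subspace $\mathscr H^\sigma_-(U)$ carries the norm of $\mathscr H(U)$. *)

(* Defs.v *)
From HB Require Import structures.
From mathcomp Require Import all_boot all_order all_algebra.
From mathcomp Require Import complex.
From mathcomp Require Import all_classical all_reals all_analysis.

Set Implicit Arguments.
Unset Strict Implicit.
Unset Printing Implicit Defensive.

Import Order.TTheory GRing.Theory Num.Theory.
Import numFieldNormedType.Exports.

Local Open Scope classical_set_scope.
Local Open Scope ring_scope.

(* The type ascription makes R[i] inherit the topology and the normed-module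
   structure of an abstract numClosedFieldType. *)
Definition Cplx (R : realType) : numClosedFieldType := R[i].

Section several_variables.
Context (R : realType) (d : nat).
Local Notation C := (Cplx R).
Local Notation Cd := 'rV[C]_d.
Implicit Types (U V : set Cd) (psi sigma phi : Cd -> Cd).

Definition domain U := [/\ U !=set0, open U & connected U].

(* [differentiable] is Frechet differentiability over the field C. *)
Definition holomorphic_on (W : normedModType C) U (f : Cd -> W) :=
  forall z, U z -> differentiable f z.

(* A complex-valued function on U is represented by its extension by zero to
   C^d, so that equality on U is equality of the representatives. *)
Definition fun_on U (f : Cd -> C) := forall z, ~ U z -> f z = 0.

Definition Hol U : set (Cd -> C) :=
  [set f | fun_on U f /\ holomorphic_on U f].

(* [jacobian] acts on row vectors, i.e. it is the transpose of the usual
   Jacobian matrix; the determinant is the same. *)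
Definition Jac psi (z : Cd) : C := \det (jacobian psi z).

Definition affine_linear_map psi :=
  exists (A : {linear Cd -> Cd}) (B : Cd), forall z, psi z = A z + B.

Definition affine_linear_fun U (f : Cd -> C) :=
  exists (a : Cd) (b : C),
    forall z, U z -> f z = \sum_(j < d) a ord0 j * z ord0 j - b.

Definition involution sigma := continuous sigma /\ involutive sigma.

Definition invariant_set sigma U := forall z, U z -> U (sigma z).

Definition invariant_map sigma U phi :=
  invariant_set sigma U /\ forall z, U z -> phi (sigma z) = phi z.

(* A map U -> V is represented by a map on C^d of which only the values at the
   points of U matter. *)
Definition proper_map U V phi :=
  [/\ {homo phi : z / U z >-> V z},
      {within U, continuous phi} &
      forall K, K `<=` V -> compact K -> compact (U `&` phi @^-1` K)].

Definition crit_values U phi : set Cd :=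
  phi @` [set z | U z /\ Jac phi z = 0].

Definition m_proper (m : nat) U V phi :=
  [/\ proper_map U V phi,
      holomorphic_on U phi,
      (forall z, V z -> ~ crit_values U phi z ->
         (U `&` phi @^-1` [set z] #= `I_m)%card) &
      (forall z, crit_values U phi z ->
         exists2 k, (k < m)%N & (U `&` phi @^-1` [set z] #= `I_k)%card)].

End several_variables.

Section hilbert_spaces.
Context (R : realType).
Local Notation C := (Cplx R).

Definition ip_norm (E : Type) (ip : E -> E -> C) (f : E) : R :=
  Num.sqrt (complex.Re (ip f f)).

(* The set H is a linear subspace of E, ip restricted to H is an inner product
   (linear in the first argument), and H is complete for the induced norm; the
   values of ip outside H are irrelevant. *)
Record hilbert_space (E : lmodType C) (H : set E) (ip : E -> E -> C) : Prop := {
  hilbert_0 : H 0 ;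
  hilbert_lin : forall (a : C) f g, H f -> H g -> H (a *: f + g) ;
  hilbert_ip_lin : forall (a : C) f g h, H f -> H g -> H h ->
    ip (a *: f + g) h = a * ip f h + ip g h ;
  hilbert_ip_conj : forall f g, H f -> H g -> ip g f = (ip f g)^* ;
  hilbert_ip_ge0 : forall f, H f -> 0 <= ip f f ;
  hilbert_ip_eq0 : forall f, H f -> ip f f = 0 -> f = 0 ;
  hilbert_complete : forall u : nat -> E, (forall n, H (u n)) ->
    (forall e : R, 0 < e -> exists N : nat, forall m n : nat,
       (N <= m)%N -> (N <= n)%N -> ip_norm ip (u m - u n) < e) ->
    exists2 f, H f &
      forall e : R, 0 < e -> exists N : nat, forall n : nat,
        (N <= n)%N -> ip_norm ip (u n - f) < e }.

Definition unitary (E F : lmodType C) (H : set E) (ipH : E -> E -> C)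
    (K : set F) (ipK : F -> F -> C) (T : E -> F) :=
  [/\ (forall (a : C) f g, H f -> H g -> T (a *: f + g) = a *: T f + T g),
      set_bij H K T &
      forall f g, H f -> H g -> ipK (T f) (T g) = ipH f g].

End hilbert_spaces.

Section functional_hilbert_spaces.
Context (R : realType) (d : nat).
Local Notation C := (Cplx R).
Local Notation Cd := 'rV[C]_d.
Local Notation Fun := (Cd -> C).
Implicit Types (U V : set Cd) (H : set Fun) (ip : Fun -> Fun -> C).

(* (H, ip) is a reproducing kernel Hilbert space of functions on U, with
   reproducing kernel k. *)
Definition rkhs U H ip (k : Cd -> Cd -> C) :=
  [/\ hilbert_space H ip,
      (forall f, H f -> fun_on U f) &
      forall w, U w -> H (k^~ w) /\ forall f, H f -> ip f (k^~ w) = f w].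

Definition functional_hilbert_space U H ip k :=
  rkhs U H ip k /\ H `<=` Hol U.

Definition invariant_hilbert_space (sigma : Cd -> Cd) U H ip :=
  [/\ invariant_set sigma U,
      (forall f, H f -> H (f \o sigma)) &
      forall f g, H f -> H g -> ip (f \o sigma) (g \o sigma) = ip f g].

Definition anti_invariant (sigma : Cd -> Cd) H : set Fun :=
  [set f | H f /\ f = - (f \o sigma)].

Definition Gamma U (phi : Cd -> Cd) (f : Fun) : Fun :=
  (fun z => Jac phi z * f (phi z)) \_ U.

Definition H_phi U V H (phi : Cd -> Cd) : set Fun :=
  [set f | Hol V f /\ H (Gamma U phi f)].

Definition norm_phi U ip (phi : Cd -> Cd) (f : Fun) : R :=
  ip_norm ip (Gamma U phi f).

End functional_hilbert_spaces.

(* Main.v *)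
Require Import Defs.
From HB Require Import structures.
From mathcomp Require Import all_boot all_order all_algebra.
From mathcomp Require Import complex.
From mathcomp Require Import all_classical all_reals all_analysis.
From mathcomp Require Import ring lra.

Set Implicit Arguments.
Unset Strict Implicit.
Unset Printing Implicit Defensive.

Import Order.TTheory GRing.Theory Num.Theory.
Import numFieldNormedType.Exports.

Local Open Scope classical_set_scope.
Local Open Scope ring_scope.

(** Why the theorem is true.  Write J for the Jacobian of phi.  Differentiating
    phi o sigma = phi gives J o sigma = - J, so Gamma f = J (f o phi) is always
    anti-invariant.  Conversely, let g in H be anti-invariant.  The quotient
    g / J is sigma-invariant.  Over a point that is not a critical value the
    fibre of phi is a pair {z, sigma z}, and over a critical value it is a
    single point z, which is therefore fixed by sigma; hence g / J, once given
    a value on J = 0, factors as f o phi.  The point is that f is holomorphic;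
    then Gamma is onto the anti-invariant functions ([odd_descends],
    [Gamma_surj]), and the Hilbert space structure is transported through Gamma.

    At a regular value phi z0, properness makes the preimages of a nearby point
    v = phi z close to the fibre ([preimages_near]), and from
    phi z - phi z0 = (z - z0) B + o(z - z0) with B invertible one reads
    z - z0 = O(v - phi z0), so a first-order expansion of g / J in z becomes a
    first-order expansion of f in v ([descent]).

    At a critical value, J is affine, vanishes at z0, and its zero set in U is
    made of fixed points of sigma.  So sigma is a reflection: writing
    z = z0 + delta + t v with delta in the hyperplane parallel to J = 0 and
    t = J z, one has sigma z = z0 + delta - t v ([reflection]).  In these
    coordinates phi is even in t and g is odd in t, so phi and g / t are
    functions of Q = delta + t^2 v.  Both have a first-order expansion in Q
    ([even_quotient], [odd_quotient]), and the linear part of phi in Q is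
    invertible because J (z0 + t v) = t: the Jacobian of z |-> Q along that
    line is 2t, so the determinant of the linear part is t / (2t) = 1/2.  The
    same lemma [descent] then applies with Q in place of z - z0.

    The expansions in Q need Taylor coefficients of phi and g of order up to 3,
    although holomorphy only means Frechet differentiability at each point.
    They come from the theory of one complex variable, applied on complex
    lines: Goursat's argument on rectangles ([goursat]), transported by the
    exponential, shows that circular means of a function that is holomorphic
    off the centre and off one more circle are all equal to its value at the
    centre ([cmean_center]); this gives Cauchy's formula
    ([cauchy_formula]) and Taylor expansions whose coefficients are linear
    bounded functionals ([taylor_bound], [tcoef_bound]).  Applying these to
    g (z + s w) yields Lipschitz and second-order bounds for g and its
    derivatives that are uniform in z.

    For the kernel, at a regular point z the representer of f |-> f (phi z) is
    Gamma^-1 of (kappa_z - kappa_z o sigma) / 2 divided by the conjugate of J z.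
    A critical value is a limit of regular values phi z_n and f (phi z_n)
    converges for each f, so the representers converge weakly.  By the uniform
    boundedness principle and the Riesz representation theorem
    ([weak_limit]) they have a weak limit, which represents evaluation at the
    critical value. *)

(** * Real-valued norms *)

Section nrm.
Context {R : realType}.
Local Notation C := (Cplx R).

(** Norms over the field C are themselves elements of C; their real part is a
    real number, to which linear arithmetic applies. *)
Definition nrm {V : normedZmodType C} (v : V) : R := complex.Re `|v|.

(** The cast of a real number, typed in [Cplx R] so that the structures of
    that alias are found. *)
Definition toC (x : R) : C := real_complex R x.

Lemma toC0 : toC 0 = 0. Proof. by []. Qed.
Lemma toCD x y : toC (x + y) = toC x + toC y.
Proof. exact: (rmorphD (real_complex R)). Qed.
Lemma toCB x y : toC (x - y) = toC x - toC y.
Proof. exact: (rmorphB (real_complex R)). Qed.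
Lemma toCM x y : toC (x * y) = toC x * toC y.
Proof. exact: (rmorphM (real_complex R)). Qed.
Lemma toCV x : toC x^-1 = (toC x)^-1. Proof. exact: (fmorphV (real_complex R)). Qed.
Lemma toCX x n : toC (x ^+ n) = toC x ^+ n.
Proof. exact: (rmorphXn (real_complex R)). Qed.
Lemma toC_inj : injective toC. Proof. by move=> x y []. Qed.
Lemma toC_eq0 x : (toC x == 0) = (x == 0).
Proof. exact: (fmorph_eq0 (real_complex R)). Qed.
Lemma toC_le x y : (toC x <= toC y) = (x <= y). Proof. exact: lecR. Qed.
Lemma toC_lt x y : (toC x < toC y) = (x < y). Proof. exact: ltcR. Qed.
Lemma toC_nat n : toC n%:R = n%:R. Proof. exact: (rmorph_nat (real_complex R)). Qed.

Lemma ge0_toC (z : C) : 0 <= z -> z = toC (complex.Re z).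
Proof. by move=> /ger0_real/complex_realP[k ->]. Qed.

Lemma gt0_toC (z : C) : 0 < z -> exists2 e : R, 0 < e & z = toC e.
Proof.
move=> z0; exists (complex.Re z); last exact/ge0_toC/ltW.
by rewrite -toC_lt -ge0_toC // ltW.
Qed.

Lemma ReZ (a : R) (z : C) : complex.Re (toC a * z) = a * complex.Re z.
Proof. by case: z => x y; rewrite /toC /= mul0r subr0. Qed.
Lemma ImZ (a : R) (z : C) : complex.Im (toC a * z) = a * complex.Im z.
Proof. by case: z => x y; rewrite /toC /= mul0r addr0. Qed.
Lemma ReD (x y : C) : complex.Re (x + y) = complex.Re x + complex.Re y.
Proof. by case: x; case: y. Qed.
Lemma ImD (x y : C) : complex.Im (x + y) = complex.Im x + complex.Im y.
Proof. by case: x; case: y. Qed.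
Lemma ReN (x : C) : complex.Re (- x) = - complex.Re x.
Proof. by case: x. Qed.
Lemma ImN (x : C) : complex.Im (- x) = - complex.Im x.
Proof. by case: x. Qed.

Section generic.
Context {V : normedZmodType C}.
Implicit Types u v : V.

Lemma nrmE v : `|v| = toC (nrm v). Proof. exact/ge0_toC/normr_ge0. Qed.
Lemma nrm_ge0 v : 0 <= nrm v. Proof. by rewrite -toC_le -nrmE toC0. Qed.
Lemma nrmD u v : nrm (u + v) <= nrm u + nrm v.
Proof. by rewrite -toC_le toCD -!nrmE ler_normD. Qed.
Lemma nrmN v : nrm (- v) = nrm v. Proof. by rewrite /nrm normrN. Qed.
Lemma nrmBC u v : nrm (u - v) = nrm (v - u). Proof. by rewrite /nrm distrC. Qed.
Lemma nrmB u v : nrm (u - v) <= nrm u + nrm v.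
Proof. by rewrite -(nrmN v) nrmD. Qed.
Lemma nrm0 : nrm (0 : V) = 0. Proof. by rewrite /nrm normr0. Qed.
Lemma nrm_eq0 v : (nrm v == 0) = (v == 0).
Proof. by rewrite -[in RHS]normr_eq0 nrmE toC_eq0. Qed.
Lemma nrm_gt0 v : (0 < nrm v) = (v != 0).
Proof. by rewrite lt_def nrm_eq0 nrm_ge0 andbT. Qed.
Lemma nrm_small v : (forall e : R, 0 < e -> nrm v <= e) -> v = 0.
Proof.
move=> h; apply/eqP; rewrite -nrm_eq0 eq_le nrm_ge0 andbT.
by apply/ler_addgt0Pr => e e0; rewrite add0r h.
Qed.
Lemma nrm_sum (I : Type) (r : seq I) (P : pred I) (F : I -> V) :
  nrm (\sum_(i <- r | P i) F i) <= \sum_(i <- r | P i) nrm (F i).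
Proof.
elim/big_rec2 : _ => [|i x y _ h]; first by rewrite nrm0.
by apply: (le_trans (nrmD _ _)); rewrite lerD2l.
Qed.
End generic.

Lemma nrmZ (V : normedModType C) (a : C) (v : V) : nrm (a *: v) = nrm a * nrm v.
Proof. by apply: toC_inj; rewrite toCM -!nrmE normrZ. Qed.

Implicit Types z w : C.
Lemma nrmM z w : nrm (z * w) = nrm z * nrm w.
Proof. by apply: toC_inj; rewrite toCM -!nrmE normrM. Qed.
Lemma nrm1 : nrm (1 : C) = 1. Proof. by rewrite /nrm normr1. Qed.
Lemma nrmV z : nrm z^-1 = (nrm z)^-1.
Proof. by apply: toC_inj; rewrite toCV -!nrmE normfV. Qed.
Lemma nrmX z n : nrm (z ^+ n) = nrm z ^+ n.
Proof. by apply: toC_inj; rewrite toCX -!nrmE normrX. Qed.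
Lemma nrm_toC (x : R) : nrm (toC x) = `|x|.
Proof. by rewrite /nrm normc_def /= expr0n addr0 sqrtr_sqr. Qed.
Lemma nrm_conj z : nrm (z^*)%C = nrm z.
Proof. by rewrite /nrm (normcJ (z : R[i])). Qed.
Lemma nrmi : nrm ('i%C : C) = 1.
Proof. by rewrite /nrm normc_def /= expr0n add0r expr1n sqrtr1. Qed.
Lemma Re_nrm z : `|complex.Re z| <= nrm z.
Proof. by rewrite -toC_le -nrmE; exact: (normc_ge_Re (z : R[i])). Qed.
Lemma Im_nrm z : `|complex.Im z| <= nrm z.
Proof.
rewrite -[leRHS]mul1r -nrmi -nrmM mulrC; apply: le_trans (Re_nrm _).
by rewrite (ReiNIm (z : R[i])) normrN.
Qed.
Lemma nrm_ReIm z : nrm z <= `|complex.Re z| + `|complex.Im z|.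
Proof.
rewrite [z in leLHS](complexE (z : R[i])); apply: le_trans (nrmD _ _) _.
by rewrite nrmM nrmi mul1r !nrm_toC.
Qed.
Lemma eq_complexP z w : complex.Re z = complex.Re w -> complex.Im z = complex.Im w ->
  z = w.
Proof. by case: z; case: w => a b c d /= -> ->. Qed.
End nrm.

(** * Integrals of complex functions on segments *)

Section cint.
Context {R : realType}.
Local Notation C := (Cplx R).
Local Notation mu := (@lebesgue_measure R).
Implicit Types phi psi : R -> C.

(** Continuity from R to C by estimates, since R and C are normed over
    different fields. *)
Definition rcont phi :=
  forall x (e : R), 0 < e -> \forall y \near x, nrm (phi y - phi x) <= e.

Lemma rcont_Re phi : rcont phi -> continuous (fun x => complex.Re (phi x)).
Proof.
move=> h x; apply/cvgrPdist_le => e e0; near=> y.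
rewrite distrC -ReN -ReD; apply: le_trans (Re_nrm _) _.
by near: y; exact: h.
Unshelve. all: by end_near. Qed.

Lemma rcont_Im phi : rcont phi -> continuous (fun x => complex.Im (phi x)).
Proof.
move=> h x; apply/cvgrPdist_le => e e0; near=> y.
rewrite distrC -ImN -ImD; apply: le_trans (Im_nrm _) _.
by near: y; exact: h.
Unshelve. all: by end_near. Qed.

Lemma rcontD phi psi : rcont phi -> rcont psi -> rcont (fun x => phi x + psi x).
Proof.
move=> h k x e e0; near=> y.
rewrite [e]splitr opprD addrACA; apply: le_trans (nrmD _ _) _.
by apply: lerD; near: y; [apply: h|apply: k]; rewrite divr_gt0.
Unshelve. all: by end_near. Qed.

Lemma rcontZ (a : C) phi : rcont phi -> rcont (fun x => a * phi x).
Proof.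
move=> h x e e0.
have a0 : 0 < nrm a + 1 by rewrite ltr_wpDl ?nrm_ge0.
near=> y; rewrite -mulrBr nrmM.
have : nrm (phi y - phi x) <= e / (nrm a + 1).
  by near: y; apply: h; rewrite divr_gt0.
rewrite ler_pdivlMr // => h1; apply: le_trans h1.
by rewrite mulrC ler_wpM2l ?nrm_ge0 // lerDl.
Unshelve. all: by end_near. Qed.

Lemma rcontB phi psi : rcont phi -> rcont psi -> rcont (fun x => phi x - psi x).
Proof.
move=> h /(rcontZ (-1)) k; have := rcontD h k.
by under eq_fun do rewrite mulN1r.
Qed.

Lemma rcont_cst (c : C) : rcont (fun=> c).
Proof. by move=> x e e0; near=> y; rewrite subrr nrm0 ltW. Unshelve. all: by
  end_near. Qed.

Lemma integrable_continuous (f : R -> R) a b : continuous f ->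
  mu.-integrable `[a, b] (EFin \o f).
Proof.
move=> cf; apply: continuous_compact_integrable; first exact: segment_compact.
exact: continuous_subspaceT.
Qed.

Definition cint (a b : R) phi : C :=
  Complex (\int[mu]_(x in `[a, b]) complex.Re (phi x))
          (\int[mu]_(x in `[a, b]) complex.Im (phi x)).

Lemma eq_cint a b phi psi : (forall x, a <= x <= b -> phi x = psi x) ->
  cint a b phi = cint a b psi.
Proof.
move=> h; rewrite /cint; congr Complex; apply: eq_Rintegral => x;
by rewrite inE /= in_itv /= => /h ->.
Qed.

Lemma cintD a b phi psi : rcont phi -> rcont psi ->
  cint a b (fun x => phi x + psi x) = cint a b phi + cint a b psi.
Proof.
move=> h k; apply: eq_complexP; rewrite ?ReD ?ImD /cint /=.
- under eq_Rintegral do rewrite ReD.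
  by apply: RintegralD => //; apply: integrable_continuous; apply: rcont_Re.
- under eq_Rintegral do rewrite ImD.
  by apply: RintegralD => //; apply: integrable_continuous; apply: rcont_Im.
Qed.

Lemma cintZ a b (c : C) phi : rcont phi ->
  cint a b (fun x => c * phi x) = c * cint a b phi.
Proof.
move=> h; have hr := rcont_Re h; have hi := rcont_Im h.
case: c => u v; apply: eq_complexP; rewrite /cint /=.
- rewrite -!RintegralZl //; try exact: integrable_continuous.
  rewrite -RintegralB //.
  + by apply: eq_Rintegral => x _; case: (phi x).
  + by apply: integrable_continuous => x; apply: cvgM; [exact: cvg_cst|exact: hr].
  + by apply: integrable_continuous => x; apply: cvgM; [exact: cvg_cst|exact: hi].
- rewrite -!RintegralZl //; try exact: integrable_continuous.
  rewrite -RintegralD //.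
  + by apply: eq_Rintegral => x _; case: (phi x).
  + by apply: integrable_continuous => x; apply: cvgM; [exact: cvg_cst|exact: hi].
  + by apply: integrable_continuous => x; apply: cvgM; [exact: cvg_cst|exact: hr].
Qed.

Lemma cintB a b phi psi : rcont phi -> rcont psi ->
  cint a b (fun x => phi x - psi x) = cint a b phi - cint a b psi.
Proof.
move=> h k.
rewrite (_ : (fun x => _) = fun x => phi x + (-1) * psi x); last first.
  by apply/funext => x; rewrite mulN1r.
by rewrite cintD ?cintZ ?mulN1r //; exact: rcontZ.
Qed.

Lemma cint_cst a b (c : C) : a <= b -> cint a b (fun=> c) = toC (b - a) * c.
Proof.
move=> ab; apply: eq_complexP; rewrite ?ReZ ?ImZ /cint /= Rintegral_cst //=;
by rewrite lebesgue_measure_itv /= lte_fin; case: ltgtP ab => //= [_|->] _; rewrite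
  ?subrr ?mulr0 ?mul0r // mulrC.
Qed.

Lemma cint_split a c b phi : a <= c -> c <= b -> rcont phi ->
  cint a b phi = cint a c phi + cint c b phi.
Proof.
move=> ac cb h; have hr := rcont_Re h; have hi := rcont_Im h.
apply: eq_complexP; rewrite ?ReD ?ImD /cint /=.
- apply/eqP; rewrite -subr_eq0 opprD addrA subr_eq0; apply/eqP.
  rewrite Rintegral_itvB ?bnd_simp //; last exact: integrable_continuous.
  rewrite Rintegral_itv_obnd_cbnd //.
  apply: integrableS (integrable_continuous c b hr) => //.
  exact: subset_itv_oc_cc.
- apply/eqP; rewrite -subr_eq0 opprD addrA subr_eq0; apply/eqP.
  rewrite Rintegral_itvB ?bnd_simp //; last exact: integrable_continuous.
  rewrite Rintegral_itv_obnd_cbnd //.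
  apply: integrableS (integrable_continuous c b hi) => //.
  exact: subset_itv_oc_cc.
Qed.

Lemma Rint_bound (f : R -> R) a b M : a <= b -> continuous f ->
  (forall x, a <= x <= b -> `|f x| <= M) ->
  `|\int[mu]_(x in `[a, b]) f x| <= M * (b - a).
Proof.
move=> ab cf h; apply: le_trans (le_normr_Rintegral _ _) _ => //.
  exact: integrable_continuous.
have -> : M * (b - a) = \int[mu]_(x in `[a, b]) M.
  rewrite Rintegral_cst //= lebesgue_measure_itv /= lte_fin.
  by case: ltgtP ab => //= -> _; rewrite subrr.
apply: le_Rintegral => //.
- apply: integrable_continuous => x.
  by apply: (@cvg_norm _ R^o); exact: cf.
- by apply: integrable_continuous => x; exact: cvg_cst.

Qed.

(** The factor 2 comes from bounding the real and imaginary parts separately.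
    *)
Lemma cint_bound a b phi M : a <= b -> rcont phi ->
  (forall x, a <= x <= b -> nrm (phi x) <= M) ->
  nrm (cint a b phi) <= 2 * M * (b - a).
Proof.
move=> ab h hM; apply: le_trans (nrm_ReIm _) _.
rewrite -mulrA mulr_natl mulr2n /cint /=; apply: lerD; apply: Rint_bound => //.
- exact: rcont_Re.
- by move=> x /hM; apply: le_trans; exact: Re_nrm.
- exact: rcont_Im.
- by move=> x /hM; apply: le_trans; exact: Im_nrm.
Qed.

Lemma cint_conj a b phi : rcont phi ->
  cint a b (fun x => (phi x)^*%C) = (cint a b phi)^*%C.
Proof.
move=> h; apply: eq_complexP; rewrite /cint /=.
  by apply: eq_Rintegral => x _; case: (phi x).
rewrite -mulN1r -RintegralZl //; last exact/integrable_continuous/rcont_Im.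
by apply: eq_Rintegral => x _; rewrite mulN1r; case: (phi x).
Qed.

End cint.
(* Comparing two integrals by conversion would unfold the Lebesgue integral. *)
#[global] Opaque cint.

(** * Goursat's lemma on rectangles *)

Section goursat.
Context {R : realType}.
Local Notation C := (Cplx R).
Variable K : R -> R -> C.
Local Notation ii := ('i%C : C).

(** Complex differentiability of K at x + iy in real coordinates, the form in
    which it is checked for a pullback by the exponential. *)
Definition rect_diff x y := exists a : C, forall e : R, 0 < e ->
  exists2 d : R, 0 < d & forall x' y', `|x' - x| <= d -> `|y' - y| <= d ->
  nrm (K x' y' - K x y - a * (toC (x' - x) + ii * toC (y' - y)))
    <= e * (`|x' - x| + `|y' - y|).

(** The contour integral of K dz around a rectangle.  Opposite sides share one
    integrand, so that the constant part of K cancels pointwise. *)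
Definition rect_int x1 x2 y1 y2 : C :=
  cint x1 x2 (fun x => K x y1 - K x y2) + ii * cint y1 y2 (fun y => K x2 y - K x1 y).

Hypothesis Kx : forall y, rcont (K^~ y).
Hypothesis Ky : forall x, rcont (K x).

Lemma rect_int_splitx m x1 x2 y1 y2 : x1 <= m -> m <= x2 ->
  rect_int x1 x2 y1 y2 = rect_int x1 m y1 y2 + rect_int m x2 y1 y2.
Proof.
move=> h1 h2; rewrite /rect_int (cint_split h1 h2); last exact: rcontB.
rewrite addrACA; congr (_ + _); rewrite -mulrDr -cintD; try exact: rcontB.
by congr (_ * _); apply: eq_cint => y _; rewrite [RHS]addrC addrA subrK.
Qed.

Lemma rect_int_splity m x1 x2 y1 y2 : y1 <= m -> m <= y2 ->
  rect_int x1 x2 y1 y2 = rect_int x1 x2 y1 m + rect_int x1 x2 m y2.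
Proof.
move=> h1 h2; rewrite /rect_int (cint_split h1 h2); last exact: rcontB.
rewrite addrACA mulrDr; congr (_ + _); rewrite -cintD; try exact: rcontB.
by apply: eq_cint => y _; rewrite addrA subrK.
Qed.

(** Around a rectangle the first-order part of K integrates to 0, and what
    remains of K is at most e times the side lengths. *)
Lemma rect_int_local x y (e : R) : rect_diff x y -> 0 < e ->
  exists2 d : R, 0 < d & forall x1 x2 y1 y2, x1 <= x <= x2 -> y1 <= y <= y2 ->
    x2 - x1 <= d -> y2 - y1 <= d ->
    nrm (rect_int x1 x2 y1 y2) <= 4 * e * ((x2 - x1) + (y2 - y1)) ^+ 2.
Proof.
move=> [a ha] e0; have [d d0 hd] := ha _ e0; exists d => // x1 x2 y1 y2.
move=> /andP[xa xb] /andP[ya yb] wd hd'.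
set S := (x2 - x1) + (y2 - y1).
have S0 : 0 <= S by rewrite /S; lra.
pose E x' y' := K x' y' - K x y - a * (toC (x' - x) + ii * toC (y' - y)).
have EB x' y' : x1 <= x' <= x2 -> y1 <= y' <= y2 -> nrm (E x' y') <= e * S.
  move=> /andP[h1 h2] /andP[h3 h4]; apply: le_trans (hd _ _ _ _) _.
  - by rewrite ler_norml; apply/andP; split; lra.
  - by rewrite ler_norml; apply/andP; split; lra.
  - rewrite ler_pM2l // /S; apply: lerD; rewrite ler_norml;
    by apply/andP; split; lra.
have Hx : nrm (cint x1 x2 (fun x => K x y1 - K x y2) - toC (x2 - x1) * (a * ii * toC
  (y1 - y2))) <= 2 * (2 * (e * S)) * (x2 - x1).
  rewrite -cint_cst; last lra.
  rewrite -cintB; [|exact: rcontB|exact: rcont_cst].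
  apply: cint_bound; [lra|apply: rcontB; [exact: rcontB|exact: rcont_cst]|].
  move=> x' hx'; rewrite (_ : _ - _ - _ = E x' y1 - E x' y2); last first.
    rewrite /E !toCB; ring.
  apply: le_trans (nrmB _ _) _; rewrite mulr_natl mulr2n.
  by apply: lerD; apply: EB => //; rewrite lexx /=; lra.
have Hy : nrm (cint y1 y2 (fun y => K x2 y - K x1 y) - toC (y2 - y1) * (a * toC (x2 -
  x1))) <= 2 * (2 * (e * S)) * (y2 - y1).
  rewrite -cint_cst; last lra.
  rewrite -cintB; [|exact: rcontB|exact: rcont_cst].
  apply: cint_bound; [lra|apply: rcontB; [exact: rcontB|exact: rcont_cst]|].
  move=> y' hy'; rewrite (_ : _ - _ - _ = E x2 y' - E x1 y'); last first.
    rewrite /E !toCB; ring.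
  apply: le_trans (nrmB _ _) _; rewrite mulr_natl mulr2n.
  by apply: lerD; apply: EB => //; rewrite lexx ?andbT /=; lra.
move: Hx Hy; rewrite /rect_int.
set A := cint _ _ _; set B := cint _ _ _.
set A' := toC _ * _; set B' := toC _ * _ => Hx Hy.
have -> : A + ii * B = (A - A') + ii * (B - B').
  have -> : A' = - ii * B' by rewrite /A' /B' !toCB; ring.
  ring.
apply: le_trans (nrmD _ _) _; rewrite nrmM nrmi mul1r.
apply: le_trans (lerD Hx Hy) _; rewrite -mulrDr -/S.
by rewrite le_eqVlt; apply/orP; left; apply/eqP; ring.
Qed.

(** Bisection: if the integral exceeds eta times the square of the half
    perimeter, so does the integral around one of the four quarters; iterating
    leads to a point where [rect_int_local] fails. *)
Lemma goursat x1 x2 y1 y2 : x1 <= x2 -> y1 <= y2 ->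
  (forall x y, x1 <= x <= x2 -> y1 <= y <= y2 -> rect_diff x y) ->
  rect_int x1 x2 y1 y2 = 0.
Proof.
move=> hx hy hK; apply: contrapT => /eqP; rewrite -nrm_gt0 => Lpos.
(* Rectangles are recorded by their lower left corner; their sides are halved
    at each step. *)
pose w n : R := (x2 - x1) / 2 ^+ n; pose h n : R := (y2 - y1) / 2 ^+ n.
have w0 n : 0 <= w n by rewrite divr_ge0 ?subr_ge0 ?exprn_ge0.
have h0 n : 0 <= h n by rewrite divr_ge0 ?subr_ge0 ?exprn_ge0.
have wS n : w n = w n.+1 + w n.+1.
  by rewrite /w exprS; field; rewrite expf_neq0.
have hS n : h n = h n.+1 + h n.+1.
  by rewrite /h exprS; field; rewrite expf_neq0.
pose L n (p : R * R) := nrm (rect_int p.1 (p.1 + w n) p.2 (p.2 + h n)).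
have [eta eta0 heta] : exists2 eta : R, 0 < eta &
    eta * (w 0%N + h 0%N) ^+ 2 < nrm (rect_int x1 x2 y1 y2).
  set S := _ ^+ 2; have S0 : 0 < S + 1 by rewrite ltr_wpDl ?sqr_ge0.
  exists (nrm (rect_int x1 x2 y1 y2) / (S + 1)); first by rewrite divr_gt0.
  by rewrite -[ltRHS](divfK (lt0r_neq0 S0)) ltr_pM2l ?divr_gt0 // ltrDl.
pose bad n p := eta * (w n + h n) ^+ 2 < L n p.
have step n p : exists q, bad n p -> [/\ bad n.+1 q,
    p.1 <= q.1, q.1 + w n.+1 <= p.1 + w n, p.2 <= q.2 & q.2 + h n.+1 <= p.2 + h n].
  apply: contrapT => /forallNP hq.
  have : bad n p by apply: contrapT => nb; apply: (hq p) => /nb.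
  case: p hq => px py hq; rewrite /bad; apply/negP; rewrite -leNgt.
  have w1 := w0 n.+1; have h1 := h0 n.+1.
  have good q : px <= q.1 -> q.1 + w n.+1 <= px + w n -> py <= q.2 ->
      q.2 + h n.+1 <= py + h n -> L n.+1 q <= eta * (w n.+1 + h n.+1) ^+ 2.
    move=> a b c d; rewrite leNgt; apply/negP => bq.
    by apply: (hq q) => _.
  rewrite /L /= (rect_int_splitx (m := px + w n.+1)); [|lra|rewrite (wS n); lra].
  rewrite (rect_int_splity (m := py + h n.+1)); [|lra|rewrite (hS n); lra].
  rewrite (rect_int_splity (m := py + h n.+1) (px + w n.+1)); [|lra|rewrite (hS n);
    lra].
  have e1 : px + w n = px + w n.+1 + w n.+1 by rewrite (wS n) addrA.
  have e2 : py + h n = py + h n.+1 + h n.+1 by rewrite (hS n) addrA.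
  have := good (px, py); have := good (px, py + h n.+1).
  have := good (px + w n.+1, py); have := good (px + w n.+1, py + h n.+1).
  rewrite /L /= e1 e2 => g1 g2 g3 g4.
  set A := rect_int _ _ _ _ + _.
  apply: le_trans (nrmD _ _) _; rewrite {}/A.
  have -> : eta * (w n + h n) ^+ 2 = (eta * (w n.+1 + h n.+1) ^+ 2 + eta * (w n.+1 +
    h n.+1) ^+ 2) + (eta * (w n.+1 + h n.+1) ^+ 2 + eta * (w n.+1 + h n.+1) ^+ 2).
    by rewrite (wS n) (hS n); ring.
  apply: lerD; apply: le_trans (nrmD _ _) _; apply: lerD.
  - by apply: g4; rewrite ?lexx ?lerDl ?lerD2r.
  - by apply: g3; rewrite ?lexx ?lerDl ?lerD2r.
  - by apply: g2; rewrite ?lexx ?lerDl ?lerD2r.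
  - by apply: g1; rewrite ?lexx ?lerDl ?lerD2r.
pose next n p := projT1 (cid (step n p)).
have nextP n p : bad n p -> _ := projT2 (cid (step n p)).
pose c := fix c n := if n is m.+1 then next m (c m) else (x1, y1).
have c_bad n : bad n (c n).
  elim: n => [|n IH]; last by have [] := nextP _ _ IH.
  by rewrite /bad /L /= /w /h expr0 !divr1 !subrKC; move: heta; rewrite /w /h expr0
    !divr1.
have cn n := nextP _ _ (c_bad n).
have mono1 n m : (c n).1 <= (c (n + m)%N).1 /\ (c (n + m)%N).1 + w (n + m)%N <= (c
  n).1 + w n.
  elim: m => [|m [I1 I2]]; first by rewrite addn0.
  rewrite addnS; have [_ a b _ _] := cn (n + m)%N.
  by split; [exact: le_trans I1 a|exact: le_trans b I2].
have mono2 n m : (c n).2 <= (c (n + m)%N).2 /\ (c (n + m)%N).2 + h (n + m)%N <= (c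
  n).2 + h n.
  elim: m => [|m [I1 I2]]; first by rewrite addn0.
  rewrite addnS; have [_ _ _ a b] := cn (n + m)%N.
  by split; [exact: le_trans I1 a|exact: le_trans b I2].
have ub1 n m : (c n).1 <= (c m).1 + w m.
  have [[a _]] := (mono1 n m, mono1 m n); rewrite addnC => -[_ b].
  by apply: le_trans a (le_trans _ b); rewrite lerDl.
have ub2 n m : (c n).2 <= (c m).2 + h m.
  have [[a _]] := (mono2 n m, mono2 m n); rewrite addnC => -[_ b].
  by apply: le_trans a (le_trans _ b); rewrite lerDl.
(* The corners increase in both coordinates, and (X, Y) lies in all the
    rectangles. *)
pose X := sup (range (fun n => (c n).1)).
pose Y := sup (range (fun n => (c n).2)).
have XP n : (c n).1 <= X <= (c n).1 + w n.
  apply/andP; split.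
    by apply: ub_le_sup; [exists ((c 0%N).1 + w 0%N) => _ [m _ <-]|exists n].
  by apply: ge_sup; [exists (c 0%N).1; exists 0%N|move=> _ [m _ <-]].
have YP n : (c n).2 <= Y <= (c n).2 + h n.
  apply/andP; split.
    by apply: ub_le_sup; [exists ((c 0%N).2 + h 0%N) => _ [m _ <-]|exists n].
  by apply: ge_sup; [exists (c 0%N).2; exists 0%N|move=> _ [m _ <-]].
have dXY : rect_diff X Y.
  apply: hK.
    by have := XP 0%N; rewrite /= /w expr0 divr1 subrKC.
  by have := YP 0%N; rewrite /= /h expr0 divr1 subrKC.
have e0 : 0 < eta / 4 by rewrite divr_gt0.
have [d d0 hd] := rect_int_local dXY e0.
have small (a : R) : 0 <= a -> \forall n \near \oo, a / 2 ^+ n <= d.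
  move=> a0; have : (fun n => a * (2^-1 ^+ n)) @ \oo --> (a * 0 : R).
    apply: cvgM; first exact: cvg_cst.
    by apply: cvg_expr; rewrite ger0_norm ?invr_ge0 // invf_lt1 // ltr1n.
  rewrite mulr0 => /cvgrPdist_le /(_ d d0); apply: filterS => n.
  rewrite sub0r normrN exprVn => hh; apply: le_trans hh.
  exact: ler_norm.
have [n [wn hn]] : exists n, w n <= d /\ h n <= d.
  have sw := small _ (_ : 0 <= x2 - x1); have sh := small _ (_ : 0 <= y2 - y1).
  rewrite !subr_ge0 in sw sh; have [N _ P] := filterI (sw hx) (sh hy).
  by exists N; apply: (P N); rewrite /= leqnn.
have := c_bad n; rewrite /bad ltNge => /negP; apply.
have := hd _ _ _ _ (XP n) (YP n).
have sub (a b : R) : a + b - a = b by rewrite addrAC subrr add0r.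
by rewrite !sub (_ : 4 * (eta / 4) = eta); [exact|field].
Qed.

End goursat.

(** * The exponential and complex differentiability *)

Section cexp.
Context {R : realType}.
Local Notation C := (Cplx R).
Local Notation ii := ('i%C : C).
Implicit Types (x y s t e r : R) (z w : C).

Definition circ y : C := Complex (cos y) (sin y).
(** The exponential of x + iy; it maps rectangles to sectors of annuli. *)
Definition cexp x y : C := toC (expR x) * circ y.

Lemma nrm_circ y : nrm (circ y) = 1.
Proof. by rewrite /nrm normc_def /= cos2Dsin2 sqrtr1. Qed.

Lemma nrm_cexp x y : nrm (cexp x y) = expR x.
Proof. by rewrite nrmM nrm_circ mulr1 nrm_toC ger0_norm ?expR_ge0. Qed.

Lemma cexp_neq0 x y : cexp x y != 0.
Proof. by rewrite -nrm_gt0 nrm_cexp expR_gt0. Qed.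

Lemma cexpD x y s t : cexp (x + s) (y + t) = cexp x y * cexp s t.
Proof.
rewrite /cexp expRD toCM mulrACA; congr (_ * _).
apply: eq_complexP; rewrite /= ?cosD ?sinD //.
by rewrite addrC (mulrC (sin y)).
Qed.

Lemma circ2pi : circ (pi *+ 2) = circ 0.
Proof. by rewrite /circ cos2pi sin2pi cos0 sin0. Qed.

Lemma cexp2pi x : cexp x (pi *+ 2) = cexp x 0.
Proof. by rewrite /cexp circ2pi. Qed.

Lemma derive_near (f : R -> R) x (df : R) : is_derive x 1 f df ->
  forall e, 0 < e -> \forall h \near 0, `|f (x + h) - f x - df * h| <= e * `|h|.
Proof.
move=> [/derivable_nbhsP + <-] => /eqaddoP hf e e0; have := hf e e0.
apply: filterS => h; rewrite !fctE /= scaler1 opprD addrA (addrC h).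
by rewrite [_ *: _]mulrC.
Qed.

Lemma near0_ball (P : R -> Prop) : (\forall h \near 0, P h) ->
  exists2 d : R, 0 < d & forall h, `|h| <= d -> P h.
Proof.
move=> /nbhs_ballP[d /= d0 hd]; exists (d / 2); first by rewrite divr_gt0.
move=> h hh; apply: hd; rewrite /ball /= sub0r normrN.
by apply: le_lt_trans hh _; rewrite ltr_pdivrMr // mulr_natr mulr2n ltrDl.
Qed.

(** Differentiability of the exponential at 0, which the functional equation
    [cexpD] propagates to every point. *)
Lemma cexp_diff0 e : 0 < e -> exists2 d : R, 0 < d & forall s t,
  `|s| <= d -> `|t| <= d ->
  nrm (cexp s t - 1 - (toC s + ii * toC t)) <= e * (`|s| + `|t|).
Proof.
move=> e0; pose e' := Num.min 1 (e / 5).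
have e'0 : 0 < e' by rewrite lt_min ltr01 divr_gt0.
have e'1 : e' <= 1 by rewrite ge_min lexx.
have e'e : 5 * e' <= e by rewrite mulrC -ler_pdivlMr // ge_min lexx orbT.
have [d1 d10 h1] := near0_ball (derive_near (is_derive_expR 0) e'0).
have [d2 d20 h2] := near0_ball (derive_near (is_derive_cos 0) e'0).
have [d3 d30 h3] := near0_ball (derive_near (is_derive_sin 0) e'0).
pose d := Num.min (Num.min d1 d2) (Num.min d3 (e' / 2)).
exists d; first by rewrite !lt_min d10 d20 d30 divr_gt0.
move=> s t; rewrite /d !le_min => /andP[/andP[s1 _] /andP[_ s4]] /andP[/andP[_ t2]
  /andP[t3 t4]].
have := h1 _ s1; have := h2 _ t2; have := h3 _ t3.
rewrite !add0r expR0 cos0 sin0 oppr0 mul0r !subr0 ?addr0 !mul1r.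
set a := expR s; set c := cos t; set si := sin t => H3 H2 H1.
have a1 : `|a - 1| <= e'.
  have -> : a - 1 = (a - 1 - s) + s by ring.
  apply: le_trans (ler_normD _ _) _.
  have := normr_ge0 s; nra.
have a2 : `|a| <= 2.
  have -> : a = (a - 1) + 1 by ring.
  by apply: le_trans (ler_normD _ _) _; rewrite normr1; lra.
have -> : cexp s t - 1 - (toC s + ii * toC t) =
    Complex ((a - 1 - s) + a * (c - 1)) (a * (si - t) + (a - 1) * t).
  by apply: eq_complexP; rewrite /cexp /= -/a -/c -/si; ring.
apply: le_trans (nrm_ReIm _) _ => /=.
have E : forall u v k l : R, `|k| <= 2 -> `|v| <= e' * l -> `|k * v| <= 2 * (e' * l).
  by move=> u v k l hk hv; rewrite normrM; apply: ler_pM.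
have B1 := ler_normD (a - 1 - s) (a * (c - 1)).
have B2 := ler_normD (a * (si - t)) ((a - 1) * t).
have B3 := E 0 _ _ _ a2 H2.
have B4 := E 0 _ _ _ a2 H3.
have B5 : `|(a - 1) * t| <= e' * `|t| by rewrite normrM ler_wpM2r.
have P1 : 5 * e' * `|s| <= e * `|s| by rewrite ler_wpM2r.
have P2 : 5 * e' * `|t| <= e * `|t| by rewrite ler_wpM2r.
have P3 : 0 <= e' * `|s| by rewrite mulr_ge0 // ltW.
by rewrite (mulrDr e); lra.
Qed.

Lemma nrm_sit s t : nrm (toC s + ii * toC t) <= `|s| + `|t|.
Proof.
by apply: le_trans (nrmD _ _) _; rewrite nrmM nrmi mul1r !nrm_toC.
Qed.

Lemma cexpB x y x' y' : cexp x' y' - cexp x y = cexp x y * (cexp (x' - x) (y' - y) - 1).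
Proof. by rewrite mulrBr -cexpD !subrKC mulr1. Qed.

Lemma cexp_lip x y : exists2 d : R, 0 < d & forall x' y',
  `|x' - x| <= d -> `|y' - y| <= d ->
  nrm (cexp x' y' - cexp x y) <= expR x * 2 * (`|x' - x| + `|y' - y|).
Proof.
have [d d0 hd] := cexp_diff0 ltr01; exists d => // x' y' hx hy.
rewrite cexpB nrmM nrm_cexp -mulrA ler_pM2l ?expR_gt0 //.
have := hd _ _ hx hy; rewrite mul1r => h.
have -> : cexp (x' - x) (y' - y) - 1 =
  (cexp (x' - x) (y' - y) - 1 - (toC (x' - x) + ii * toC (y' - y))) +
  (toC (x' - x) + ii * toC (y' - y)) by ring.
apply: le_trans (nrmD _ _) _.
by have := nrm_sit (x' - x) (y' - y); lra.
Qed.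

Lemma cexp_cont x y e : 0 < e -> exists2 d : R, 0 < d & forall x' y',
  `|x' - x| <= d -> `|y' - y| <= d -> nrm (cexp x' y' - cexp x y) <= e.
Proof.
move=> e0; have [d d0 hd] := cexp_lip x y.
have p0 : 0 < expR x * 4 by rewrite mulr_gt0 ?expR_gt0.
exists (Num.min d (e / (expR x * 4))); first by rewrite lt_min d0 divr_gt0.
move=> x' y'; rewrite !le_min => /andP[a b] /andP[c f].
apply: le_trans (hd _ _ a c) _.
have -> : e = expR x * 2 * (e / (expR x * 4) + e / (expR x * 4)).
  by field; rewrite gt_eqF ?expR_gt0.
by rewrite ler_pM2l ?mulr_gt0 ?expR_gt0 // lerD.
Qed.

Definition ccont (f : C -> C) z := forall e, 0 < e ->
  exists2 d : R, 0 < d & forall w, nrm (w - z) <= d -> nrm (f w - f z) <= e.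

Definition cdiff_at (f : C -> C) z (a : C) := forall e, 0 < e ->
  exists2 d : R, 0 < d & forall w, nrm (w - z) <= d ->
    nrm (f w - f z - a * (w - z)) <= e * nrm (w - z).

Definition cdiff f z := exists a, cdiff_at f z a.

(** Chain rule along the exponential, with derivative a z at z = exp (x + iy).
    *)
Lemma cdiff_rect f x y : cdiff f (cexp x y) ->
  rect_diff (fun x y => f (cexp x y)) x y.
Proof.
set z := cexp x y => -[a ha]; exists (a * z) => e e0.
have ex0 := expR_gt0 x.
pose e1 := e / (2 * (expR x * 2)).
have e10 : 0 < e1 by rewrite divr_gt0 ?mulr_gt0.
have [d1 d10 h1] := ha _ e10.
pose k := (nrm a + 1) * expR x.
have k0 : 0 < k by rewrite mulr_gt0 // ltr_wpDl ?nrm_ge0.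
pose e2 := e / (2 * k).
have e20 : 0 < e2 by rewrite divr_gt0 // mulr_gt0.
have [d2 d20 h2] := cexp_diff0 e20.
have [d3 d30 h3] := cexp_lip x y.
have [d4 d40 h4] := cexp_cont x y d10.
exists (Num.min d2 (Num.min d3 d4)); first by rewrite !lt_min d20 d30 d40.
move=> x' y'; rewrite !le_min => /andP[x2 /andP[x3 x4]] /andP[y2 /andP[y3 y4]].
have A := h1 _ (h4 _ _ x4 y4); have B := h2 _ _ x2 y2.
have D := h3 _ _ x3 y3; rewrite -/z in A D.
set s := x' - x in A B D *; set t := y' - y in A B D *.
have -> : f (cexp x' y') - f z - a * z * (toC s + ii * toC t) =
  (f (cexp x' y') - f z - a * (cexp x' y' - z)) +
  a * z * (cexp s t - 1 - (toC s + ii * toC t)).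
  by rewrite cexpB -/z -/s -/t; ring.
apply: le_trans (nrmD _ _) _.
rewrite [e in leRHS]splitr mulrDl; apply: lerD.
  apply: le_trans A _; apply: le_trans (ler_wpM2l (ltW e10) D) _.
  by rewrite le_eqVlt; apply/orP; left; apply/eqP; rewrite /e1; field; rewrite gt_eqF.
rewrite 2!nrmM nrm_cexp; apply: le_trans (ler_wpM2l _ B) _.
  by rewrite mulr_ge0 ?nrm_ge0 // ltW.
rewrite mulrA ler_wpM2r ?addr_ge0 //.
apply: (@le_trans _ _ (k * e2)).
  by rewrite ler_pM2r // /k ler_pM2r // lerDl.
by rewrite le_eqVlt; apply/orP; left; apply/eqP; rewrite /e2; field; rewrite gt_eqF.
Qed.

Lemma ccont_cexp f x y e : ccont f (cexp x y) -> 0 < e ->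
  exists2 d : R, 0 < d & forall x' y', `|x' - x| <= d -> `|y' - y| <= d ->
  nrm (f (cexp x' y') - f (cexp x y)) <= e.
Proof.
move=> hf e0; have [d d0 h] := hf e e0; have [d' d'0 h'] := cexp_cont x y d0.
by exists d' => // x' y' a b; apply: h; apply: h'.
Qed.

Lemma near_abs x d : 0 < d -> \forall x' \near x, `|x' - x| <= d.
Proof.
move=> d0; near=> x'; rewrite distrC; near: x'.
by have := @cvg_id _ (nbhs x); move=> /cvgrPdist_le; apply.
Unshelve. all: by end_near. Qed.

End cexp.

(** * Means over circles *)

Section circle_mean.
Context {R : realType}.
Local Notation C := (Cplx R).
Local Notation ii := ('i%C : C).
Local Notation tau := ((pi : R) *+ 2).
Implicit Types (x y s t e r : R) (z w : C) (f g : C -> C).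

Lemma tau_gt0 : 0 < tau. Proof. by rewrite mulrn_wgt0 // pi_gt0. Qed.

Definition on_circle r f y := f (toC r * circ y).
Definition circle_cont r f := rcont (on_circle r f).
Definition cmean r f : C := toC tau^-1 * cint 0 tau (on_circle r f).

Lemma ccont_circle r f : 0 < r -> (forall y, ccont f (toC r * circ y)) ->
  circle_cont r f.
Proof.
move=> r0 h y e e0; have E y' : toC r * circ y' = cexp (ln r) y'.
  by rewrite /cexp lnK.
have hy := h y; rewrite E in hy.
have [d d0 hd] := ccont_cexp hy e0.
near=> y'; rewrite /on_circle !E; apply: hd; first by rewrite subrr normr0 ltW.
by near: y'; exact: near_abs.
Unshelve. all: by end_near. Qed.

Lemma cmeanZ r (c : C) f : circle_cont r f -> cmean r (fun z => c * f z) = c * cmean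
  r f.
Proof. by move=> h; rewrite /cmean cintZ // mulrCA. Qed.

Lemma cmeanD r f g : circle_cont r f -> circle_cont r g ->
  cmean r (fun z => f z + g z) = cmean r f + cmean r g.
Proof. by move=> h k; rewrite /cmean cintD // mulrDr. Qed.

Lemma cmeanB r f g : circle_cont r f -> circle_cont r g ->
  cmean r (fun z => f z - g z) = cmean r f - cmean r g.
Proof. by move=> h k; rewrite /cmean cintB // mulrBr. Qed.

Lemma eq_cmean r f g : 0 <= r -> (forall z, nrm z = r -> f z = g z) -> cmean r f =
  cmean r g.
Proof.
move=> r0 h; rewrite /cmean; congr (_ * _); apply: eq_cint => y _.
by apply: h; rewrite nrmM nrm_circ mulr1 nrm_toC ger0_norm.
Qed.

Lemma cmean_conj r f : circle_cont r f -> cmean r (fun z => (f z)^*%C) = (cmean r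
  f)^*%C.
Proof.
move=> h; rewrite /cmean /on_circle cint_conj // rmorphM /=; congr (_ * _).
exact/esym/conjc_real.
Qed.

Lemma cmean_bound r f M : 0 <= r -> circle_cont r f ->
  (forall z, nrm z = r -> nrm (f z) <= M) -> nrm (cmean r f) <= 2 * M.
Proof.
move=> r0 h hM; rewrite /cmean nrmM nrm_toC ger0_norm; last first.
  by rewrite invr_ge0 ltW // tau_gt0.
rewrite mulrC ler_pdivrMr ?tau_gt0 // -[tau in leRHS]subr0.
apply: cint_bound => //; first by rewrite ltW // tau_gt0.
by move=> y _; apply: hM; rewrite nrmM nrm_circ mulr1 nrm_toC ger0_norm.
Qed.

Lemma cdiff_ccont f z : cdiff f z -> ccont f z.
Proof.
move=> [a ha] e e0; have [d d0 hd] := ha _ ltr01.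
have k0 : 0 < nrm a + 1 by rewrite ltr_wpDl ?nrm_ge0.
exists (Num.min d (e / (nrm a + 1))); first by rewrite lt_min d0 divr_gt0.
move=> w; rewrite le_min => /andP[h1 h2]; have := hd w h1; rewrite mul1r => h3.
have -> : f w - f z = (f w - f z - a * (w - z)) + a * (w - z) by rewrite subrK.
apply: le_trans (nrmD _ _) _; rewrite nrmM.
move: h2; rewrite ler_pdivlMr // mulrDr mulr1 [nrm a * _]mulrC; lra.
Qed.

Section invariance.
Variables (f : C -> C) (r0 S : R).
Hypothesis fc : forall z, nrm z < r0 -> ccont f z.
Hypothesis fd : forall z, z != 0 -> nrm z < r0 -> nrm z != S -> cdiff f z.

(** In the coordinates exp (x + iy) the mean over the circle of radius exp x
    integrates a function of period 2 pi in y over one period.  In [goursat]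
    on the rectangle [x1, x2] x [0, 2 pi] the horizontal sides cancel, so the
    mean does not depend on x.  Its continuity in x carries this across the
    circle of radius S, and down to the centre. *)
Lemma cmean_center r : 0 < r < r0 -> cmean r f = f 0.
Proof.
move=> /andP[rp rr0].
pose X := ln ((r + r0) / 2).
have eX : expR X = (r + r0) / 2 by rewrite /X lnK // posrE; lra.
have Xr0 : expR X < r0 by rewrite eX; lra.
have rX : ln r < X by rewrite ltr_ln ?posrE //; lra.
(* Clipping x at X keeps the points inside the disk, so that K is continuous
    on the whole plane. *)
pose K x y := f (cexp (Num.min x X) y).
have insd x y : nrm (cexp (Num.min x X) y) < r0.
  by rewrite nrm_cexp; apply: le_lt_trans Xr0; rewrite ler_expR ge_min lexx orbT.
have minlip x x' : `|Num.min x' X - Num.min x X| <= `|x' - x|.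
  rewrite /Num.min; case: ltP => h1; case: ltP => h2 //; rewrite ?subrr ?normr0 //.
    rewrite ler_norml; have := ler_norm (x' - x); have := ler_norm (-(x' - x)).
    by rewrite normrN => a b; apply/andP; split; lra.
  rewrite ler_norml; have := ler_norm (x' - x); have := ler_norm (-(x' - x)).
  by rewrite normrN => a b; apply/andP; split; lra.
have Kc x y e : 0 < e -> exists2 d : R, 0 < d & forall x' y', `|x' - x| <= d ->
    `|y' - y| <= d -> nrm (K x' y' - K x y) <= e.
  move=> e0; have [d d0 hd] := ccont_cexp (fc (insd x y)) e0.
  by exists d => // x' y' a b; apply: hd => //; apply: le_trans a.
have Kx y : rcont (K^~ y).
  move=> x e e0; have [d d0 hd] := Kc x y e e0; near=> x'.
  apply: hd; last by rewrite subrr normr0 ltW.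
  by near: x'; exact: near_abs.
have Ky x : rcont (K x).
  move=> y e e0; have [d d0 hd] := Kc x y e e0; near=> y'.
  apply: hd; first by rewrite subrr normr0 ltW.
  by near: y'; exact: near_abs.
pose M x := cint 0 tau (K x).
have tau0 : 0 <= tau by rewrite ltW // tau_gt0.
have M_const x1 x2 : x1 <= x2 -> x2 < X -> ~~ (0 < S) || ~~ (x1 <= ln S <= x2) ->
    M x1 = M x2.
  move=> x12 x2X hS.
  have : rect_int K x1 x2 0 tau = 0.
    apply: goursat => // x y /andP[xa xb] _.
    have xX : x < X by apply: le_lt_trans x2X.
    have cz : cdiff f (cexp x y).
      apply: fd; first exact: cexp_neq0.
      - by rewrite nrm_cexp; apply: lt_trans Xr0; rewrite ltr_expR.
      - rewrite nrm_cexp; apply/eqP => ES; move: hS; rewrite -ES expR_gt0 expRK /=.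
        by rewrite xa xb.
    have [a ha] := cdiff_rect cz; exists a => e e0; have [d d0 hd] := ha e e0.
    exists (Num.min d ((X - x) / 2)); first by rewrite lt_min d0 divr_gt0 ?subr_gt0.
    move=> x' y'; rewrite !le_min => /andP[h1 h2] /andP[h3 _].
    have x'X : x' <= X by have := ler_norm (x' - x); lra.
    by rewrite /K !min_l ?(ltW xX) //; exact: hd.
  rewrite /rect_int.
  have -> : cint x1 x2 (fun x => K x 0 - K x tau) = 0.
    rewrite (@eq_cint _ _ _ _ (fun=> 0)) ?cint_cst ?mulr0 //.
    by move=> x _; rewrite /K cexp2pi subrr.
  rewrite add0r cintB; [|exact: Ky|exact: Ky].
  rewrite -/(M x1) -/(M x2); move: (M x1) (M x2) => m1 m2 /(congr1 nrm).
  rewrite nrmM nrmi mul1r nrm0 => /eqP; rewrite nrm_eq0 subr_eq0.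
  by move=> /eqP ->.
have M_cont x e : 0 < e -> exists2 d, 0 < d & forall x', `|x' - x| <= d ->
    nrm (M x' - M x) <= 2 * e * tau.
  move=> e0.
  (* The segment of integration is compact, so K is continuous in x uniformly
      in y. *)
  have : \forall x' \near x, forall y, `[0, tau]%classic y -> nrm (K x' y - K x y) <= e.
    have := @segment_compact R 0 tau; move=> /compact_near_coveringP.
    move=> /(_ R (nbhs x) (fun x' y => nrm (K x' y - K x y) <= e)) /=.
    move=> h; have {}h := h _ _.
    apply: h => y _.
    have e20 : 0 < e / 2 by rewrite divr_gt0.
    have [d d0 hd] := Kc x y _ e20.
    near=> y' x'.
    have -> : K x' y' - K x y' = (K x' y' - K x y) - (K x y' - K x y) by ring.
    apply: le_trans (nrmB _ _) _; rewrite [e]splitr; apply: lerD; apply: hd.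
    - by near: x'; exact: near_abs.
    - by near: y'; exact: near_abs.
    - by rewrite subrr normr0 ltW.
    - by near: y'; exact: near_abs.
  move=> /nbhs_ballP[d /= d0 hd]; exists (d / 2); first by rewrite divr_gt0.
  move=> x' hx'; rewrite /M -cintB // -[tau in leRHS]subr0.
  apply: cint_bound => //; first exact: rcontB.
  move=> y y0; apply: hd; last by rewrite /= in_itv.
  by rewrite /ball /= distrC; apply: le_lt_trans hx' _; lra.
have M_eq x1 x2 : x1 <= x2 -> x2 < X -> M x1 = M x2.
  move=> x12 x2X; have [S0|S0] := boolP (0 < S); last by apply: M_const => //;
    rewrite S0.
  have [/andP[L1 L2]|hL] := boolP (x1 <= ln S <= x2); last by apply: M_const => //;
    rewrite hL orbT.
  have close x : x < X -> (forall d, 0 < d -> exists2 x', `|x' - ln S| <= d & M x = M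
    x') -> M x = M (ln S).
    move=> xX h; apply/eqP; rewrite -subr_eq0; apply/eqP; apply: nrm_small => e e0.
    have e1 : 0 < e / (2 * tau) by rewrite divr_gt0 // mulr_gt0 // tau_gt0.
    have [d d0 hd] := M_cont (ln S) _ e1.
    have [x' x'd ->] := h d d0.
    apply: le_trans (hd _ x'd) _.
    by rewrite mulrAC [X in X <= _]mulrC divfK // gt_eqF // mulr_gt0 // tau_gt0.
  transitivity (M (ln S)).
    apply: close; first exact: le_lt_trans x2X.
    move=> d d0; move: L1; rewrite le_eqVlt => /orP[/eqP ->|L1].
      by exists (ln S) => //; rewrite subrr normr0 ltW.
    exists (Num.max x1 (ln S - d)).
      by rewrite ler_norml; apply/andP; split; rewrite /Num.max; case: ifP; lra.
    apply: M_const; first by rewrite le_max lexx.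
      by rewrite gt_max; apply/andP; split; lra.
    rewrite S0 /= negb_and -!ltNge gt_max L1 /=; apply/orP; right; lra.
  symmetry; apply: close => // d d0; move: L2; rewrite le_eqVlt => /orP[/eqP <-|L2].
    by exists (ln S) => //; rewrite subrr normr0 ltW.
  exists (Num.min x2 (ln S + d)).
    by rewrite ler_norml; apply/andP; split; rewrite /Num.min; case: ifP; lra.
  symmetry; apply: M_const => //; first by rewrite ge_min lexx.
  by rewrite S0 /= negb_and -!ltNge lt_min L2 /=; apply/orP; left; lra.
suff Mr : M (ln r) = toC tau * f 0.
  rewrite /cmean (_ : cint 0 tau (on_circle r f) = M (ln r)); last first.
    by apply: eq_cint => y _; rewrite /on_circle /K min_l ?(ltW rX) // /cexp lnK.
  by rewrite Mr mulrA -toCM mulVf ?mul1r // gt_eqF // tau_gt0.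
apply/eqP; rewrite -subr_eq0; apply/eqP; apply: nrm_small => e e0.
have e1 : 0 < e / (2 * tau) by rewrite divr_gt0 // mulr_gt0 // tau_gt0.
have r00 : 0 < r0 by apply: lt_trans rp _.
have r00' : nrm (0 : C) < r0 by rewrite nrm0.
have [d d0 hd] := fc r00' e1.
pose x := Num.min (ln r) (ln d).
rewrite -(M_eq x (ln r)) //; last by rewrite ge_min lexx.
rewrite -[tau in toC tau]subr0 -cint_cst // /M -cintB //; last exact: rcont_cst.
have -> : e = 2 * (e / (2 * tau)) * (tau - 0).
  by rewrite subr0 mulrAC [RHS]mulrC divfK // gt_eqF // mulr_gt0 // tau_gt0.
apply: cint_bound => //; first by apply: rcontB => //; exact: rcont_cst.
move=> y _; apply: hd => //; rewrite subr0 nrm_cexp -[leRHS]lnK // ler_expR.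
by rewrite /x !ge_min lexx !orbT.
Unshelve. all: by end_near. Qed.

End invariance.
End circle_mean.

(** * Cauchy's formula and Taylor expansions *)

Section taylor.
Context {R : realType}.
Local Notation C := (Cplx R).
Implicit Types (x y s e r : R) (z w t : C) (f g : C -> C).

Lemma derivable_cdiff f z : derivable f z 1 -> cdiff_at f z ('D_1 f z).
Proof.
move=> /derivable_nbhsP /eqaddoP h e e0.
have e0' : 0 < toC e by rewrite -toC0 toC_lt.
have := h _ e0'; rewrite nearE /= => /nbhs_ballP[d /gt0_toC[d' d'0 ->] hd].
exists (d' / 2); first by rewrite divr_gt0.
move=> w hw; have : ball (0 : C) (toC d') (w - z).
  rewrite /ball /= sub0r normrN nrmE toC_lt.
  by apply: le_lt_trans hw _; lra.
move=> /hd /=; rewrite !fctE /= [_%:A]mulr1 subrK opprD addrA.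
by rewrite !nrmE -toCM toC_le [_ *: _]mulrC.
Qed.

Lemma derivable_ccont f z : derivable f z 1 -> ccont f z.
Proof. by move=> /derivable_cdiff h; apply: cdiff_ccont; exists ('D_1 f z). Qed.

Lemma derivable_pow k z : derivable (fun w : C => w ^+ k) z 1.
Proof.
elim: k => [|k IH]; first by under eq_fun do rewrite expr0; exact: derivable_cst.
under eq_fun do rewrite exprS.
exact: (derivableM (@derivable_id _ _ z 1) IH).
Qed.

Lemma cdiff_near f g z (d : R) : 0 < d ->
  (forall w, nrm (w - z) <= d -> f w = g w) -> cdiff f z -> cdiff g z.
Proof.
move=> d0 fg [a ha]; exists a => e e0; have [d' d'0 hd] := ha e e0.
exists (Num.min d d'); first by rewrite lt_min d0 d'0.
move=> w; rewrite le_min => /andP[h1 h2]; rewrite -!fg //; first exact: hd.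
by rewrite subrr nrm0 ltW.
Qed.

Lemma rcontM (phi psi : R -> C) : rcont phi -> rcont psi -> rcont (fun x => phi x *
  psi x).
Proof.
move=> h k x e e0.
pose A := nrm (phi x) + nrm (psi x) + 1.
have A0 : 0 < A by rewrite /A ltr_wpDl // addr_ge0 ?nrm_ge0.
pose e' := Num.min 1 (e / A).
have e'0 : 0 < e' by rewrite lt_min ltr01 divr_gt0.
near=> y.
have H1 : nrm (phi y - phi x) <= e' by near: y; exact: h.
have H2 : nrm (psi y - psi x) <= e' by near: y; exact: k.
have -> : phi y * psi y - phi x * psi x = (phi y - phi x) * (psi y - psi x)
  + (phi x * (psi y - psi x) + (phi y - phi x) * psi x) by ring.
have e'A : e' * A <= e by rewrite -ler_pdivlMr // ge_min lexx orbT.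
have e'1 : e' <= 1 by rewrite ge_min lexx.
apply: le_trans (nrmD _ _) _; rewrite nrmM.
have := nrmD (phi x * (psi y - psi x)) ((phi y - phi x) * psi x); rewrite !nrmM.
have P1 : nrm (phi y - phi x) * nrm (psi y - psi x) <= e' * 1.
  by apply: ler_pM; rewrite ?nrm_ge0 //; apply: le_trans H2 _.
have P2 : nrm (phi x) * nrm (psi y - psi x) <= nrm (phi x) * e'.
  by rewrite ler_wpM2l ?nrm_ge0.
have P3 : nrm (phi y - phi x) * nrm (psi x) <= e' * nrm (psi x).
  by rewrite ler_wpM2r ?nrm_ge0.
move: e'A; rewrite /A; lra.
Unshelve. all: by end_near. Qed.

Lemma circle_contM r f g : circle_cont r f -> circle_cont r g ->
  circle_cont r (fun z => f z * g z).
Proof. exact: rcontM. Qed.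

Lemma derivable_circle r f : 0 < r -> (forall z, nrm z = r -> derivable f z 1) ->
  circle_cont r f.
Proof.
move=> r0 h; apply: ccont_circle => // y; apply: derivable_ccont; apply: h.
by rewrite nrmM nrm_circ mulr1 nrm_toC gtr0_norm.
Qed.

(** On the circle of radius r the conjugate of z / (z - t) is 1 / (1 - t^* z /
    r^2), a holomorphic function on a larger disk with value 1 at the centre.
    *)
Lemma cmean_kernel r t : nrm t < r -> cmean r (fun z => z / (z - t)) = 1.
Proof.
move=> tr; have r0 : 0 < r by apply: le_lt_trans (nrm_ge0 t) tr.
(* A radius between |t| and r: the function g below is holomorphic on the disk
    of radius r^2 / s, which is larger than r. *)
pose s := (nrm t + r) / 2.
have ts : nrm t < s by rewrite /s; lra.
have sr : s < r by rewrite /s; lra.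
have s0 : 0 < s by apply: le_lt_trans (nrm_ge0 t) ts.
pose g z := (1 - (t^*)%C / toC (r ^+ 2) * z)^-1 : C.
have gd z : nrm z < r ^+ 2 / s -> derivable g z 1.
  move=> hz; apply: derivableV; last by apply: derivableB => //; apply: derivableM.
  rewrite subr_eq0; apply/eqP => /(congr1 nrm).
  rewrite nrm1 !nrmM nrmV nrm_conj nrm_toC ger0_norm ?exprn_ge0 ?ltW // => E.
  have : nrm z * s < r ^+ 2 by rewrite -ltr_pdivlMr.
  have : r ^+ 2 = nrm t * nrm z.
    by rewrite -[LHS]mul1r E; field; rewrite gt_eqF.
  move=> ->; rewrite [_ * s]mulrC ltNge => /negP; apply.
  by rewrite ler_wpM2r ?nrm_ge0 // ltW.
have rr : r < r ^+ 2 / s by rewrite ltr_pdivlMr // expr2 ltr_pM2l.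
have E : cmean r g = 1.
  have -> : 1 = g 0 by rewrite /g mulr0 subr0 invr1.
  apply: (@cmean_center _ g (r ^+ 2 / s) (-1)); last by rewrite r0 rr.
  - by move=> z /gd; exact: derivable_ccont.
  - by move=> z _ /gd /derivable_cdiff h _; exists ('D_1 g z).
have gc : circle_cont r g.
  by apply: derivable_circle => // z zr; apply: gd; rewrite zr.
rewrite -(@conjc1 R) -E -cmean_conj //; apply: eq_cmean; first exact: ltW.
move=> z zr; have z0 : z != 0 by rewrite -nrm_gt0 zr.
have zt : z - t != 0.
  by rewrite subr_eq0; apply/eqP => ztE; move: tr; rewrite -ztE zr ltxx.
have zz : z * (z^*)%C = toC (r ^+ 2).
  by rewrite toCX -zr -nrmE (sqr_normc (z : R[i])).
have zc0 : (z^*)%C != 0 :> C by rewrite -nrm_gt0 nrm_conj zr.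
have -> : ((g z)^*)%C = (1 - t / toC (r ^+ 2) * (z^*)%C)^-1.
  rewrite /g conjc_inv -toCV rmorphB rmorph1 !rmorphM.
  by congr ((1 - _ * _ * _)^-1); [exact: conjcK|exact: conjc_real].
rewrite -zz; field; rewrite ?z0 ?zt ?zc0 //.
Qed.

Section cauchy.
Variables (f : C -> C) (r0 : R).
Hypothesis fd : forall z, nrm z < r0 -> derivable f z 1.

(** The function z (f z - f t) / (z - t), extended by continuity at t,
    vanishes at 0 and is differentiable off t.  Hence its mean is 0 by
    [cmean_center], the exceptional circle being the one through t, and
    [cmean_kernel] evaluates the term in f t. *)
Lemma cauchy_formula r t : nrm t < r -> r < r0 ->
  f t = cmean r (fun z => z / (z - t) * f z).
Proof.
move=> tr rr0; have rp : 0 < r by apply: le_lt_trans (nrm_ge0 t) tr.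
have dt := derivable_cdiff (fd (lt_trans tr rr0)); set a := 'D_1 f t in dt.
pose q z := if z == t then a else (f z - f t) / (z - t).
pose k z := z * q z.
have qd z : nrm z < r0 -> z != t -> cdiff k z.
  move=> zr0 zt.
  apply: (@cdiff_near (fun w => w * ((f w - f t) / (w - t))) _ _ (nrm (z - t) / 2)).
  - by rewrite divr_gt0 // nrm_gt0 subr_eq0.
  - move=> w hw; rewrite /k /q; case: eqP => // wt; move: hw; rewrite wt nrmBC.
    have : 0 < nrm (z - t) by rewrite nrm_gt0 subr_eq0.
    by move=> {wt} h1 h2; exfalso; lra.
  - eexists; apply: derivable_cdiff; apply: derivableM => //; apply: derivableM.
      by apply: derivableB => //; exact: fd.
    by apply: derivableV; [rewrite subr_eq0|apply: derivableB].
have qc z : nrm z < r0 -> ccont k z.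
  move=> zr0; have [->|zt] := eqVneq z t; last exact/cdiff_ccont/qd.
  move=> e e0.
  pose A := nrm t + nrm a + 2.
  have A0 : 0 < A by rewrite /A ltr_wpDl // addr_ge0 ?nrm_ge0.
  pose e1 := Num.min 1 (e / A).
  have e10 : 0 < e1 by rewrite lt_min ltr01 divr_gt0.
  have e11 : e1 <= 1 by rewrite ge_min lexx.
  have e1A : e1 * A <= e by rewrite -ler_pdivlMr // ge_min lexx orbT.
  have [d d0 hd] := dt _ e10; exists (Num.min d e1); first by rewrite lt_min d0.
  move=> w; rewrite le_min => /andP[h1 h2].
  have hq : nrm (q w - a) <= e1.
    rewrite /q; case: eqP => [_|/eqP wt]; first by rewrite subrr nrm0 ltW.
    have wt0 : 0 < nrm (w - t) by rewrite nrm_gt0 subr_eq0.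
    have -> : (f w - f t) / (w - t) - a = (f w - f t - a * (w - t)) / (w - t).
      by field; rewrite subr_eq0.
    by rewrite nrmM nrmV ler_pdivrMr //; exact: hd.
  have -> : k w - k t = (w - t) * (q w - a) + ((w - t) * a + t * (q w - a)).
    by rewrite /k [q t]/q eqxx; ring.
  apply: le_trans (nrmD _ _) _; have := nrmD ((w - t) * a) (t * (q w - a)).
  rewrite !nrmM.
  have P1 : nrm (w - t) * nrm (q w - a) <= e1 * 1.
    by apply: ler_pM; rewrite ?nrm_ge0 //; apply: le_trans hq _.
  have P2 : nrm (w - t) * nrm a <= e1 * nrm a by rewrite ler_wpM2r ?nrm_ge0.
  have P3 : nrm t * nrm (q w - a) <= nrm t * e1 by rewrite ler_wpM2l ?nrm_ge0.
  move: e1A; rewrite /A; lra.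
have kmean : cmean r k = 0.
  have <- : k 0 = 0 by rewrite /k mul0r.
  apply: (@cmean_center _ k r0 (nrm t)) => //; last by rewrite rp.
  by move=> z _ zr0 zt; apply: qd => //; apply: contra_neq zt => ->.
have zt0 z : nrm z = r -> z - t != 0.
  by move=> zr; rewrite subr_eq0; apply/eqP => ztE; move: tr; rewrite -ztE zr ltxx.
have c1 : circle_cont r (fun z => z / (z - t)).
  apply: derivable_circle => // z zr; apply: derivableM => //.
  by apply: derivableV; [exact: zt0|apply: derivableB].
have c2 : circle_cont r f.
  by apply: derivable_circle => // z zr; apply: fd; rewrite zr.
have : cmean r k = cmean r (fun z => z / (z - t) * f z) - f t * cmean r (fun z => z /
  (z - t)).
  rewrite -cmeanZ // -cmeanB; last 2 first.
  - exact: circle_contM.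
  - exact: rcontZ.
  apply: eq_cmean; first exact: ltW.
  move=> z zr; rewrite /k /q; case: eqP => [E|_]; last by ring.
  by move: (zt0 z zr); rewrite E subrr eqxx.
by rewrite kmean cmean_kernel // mulr1 => /eqP; rewrite eq_sym subr_eq0 => /eqP.
Qed.

(** The k-th Taylor coefficient at 0 as an integral.  In this form it is a
    bounded linear functional of every function that is continuous on the
    circle, holomorphic or not. *)
Definition tcoef r k g : C := cmean r (fun z => z ^- k * g z).

Lemma circle_contV r k g : 0 < r -> circle_cont r g -> circle_cont r (fun z => z ^- k
  * g z).
Proof.
move=> rp h; apply: circle_contM => //; apply: derivable_circle => // z zr.
apply: derivableV; first by rewrite expf_neq0 // -nrm_gt0 zr.
exact: derivable_pow.
Qed.

(** Iteration of z / (z - t) = 1 + (t / z) z / (z - t) under the integral of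
    Cauchy's formula. *)
Lemma taylor_remainder n r t : nrm t < r -> r < r0 ->
  f t - \sum_(k < n) tcoef r k f * t ^+ k =
  cmean r (fun z => z / (z - t) * (t ^+ n * (z ^- n * f z))).
Proof.
move=> tr rr0; have rp : 0 < r by apply: le_lt_trans (nrm_ge0 t) tr.
have zt0 z : nrm z = r -> z - t != 0.
  by move=> zr; rewrite subr_eq0; apply/eqP => ztE; move: tr; rewrite -ztE zr ltxx.
have c1 : circle_cont r (fun z => z / (z - t)).
  apply: derivable_circle => // z zr; apply: derivableM => //.
  by apply: derivableV; [exact: zt0|apply: derivableB].
have c2 : circle_cont r f.
  by apply: derivable_circle => // z zr; apply: fd; rewrite zr.
elim: n => [|n IH].
  rewrite big_ord0 subr0 {1}(cauchy_formula tr rr0).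
  by apply: eq_cmean => [|z _]; [exact: ltW|rewrite expr0 invr1 !mul1r].
rewrite big_ord_recr /= opprD addrA IH /tcoef mulrC -cmeanZ; last exact: circle_contV.
rewrite -cmeanB; last 2 first.
- by apply: circle_contM => //; apply: rcontZ; exact: circle_contV.
- by apply: rcontZ; exact: circle_contV.
apply: eq_cmean; first exact: ltW.
move=> z zr; have z0 : z != 0 by rewrite -nrm_gt0 zr.
rewrite !exprS; field; rewrite zt0 // z0 expf_neq0 //.
Qed.

(** For |t| <= r / 2 the kernel z / (z - t) is at most 2 in modulus; the other
    factor 2 is that of [cmean_bound]. *)
Lemma taylor_bound n r M t : 0 < r -> r < r0 ->
  (forall z, nrm z = r -> nrm (f z) <= M) -> nrm t <= r / 2 ->
  nrm (f t - \sum_(k < n) tcoef r k f * t ^+ k) <= 4 * M * (nrm t / r) ^+ n.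
Proof.
move=> rp rr0 hM ht; have tr : nrm t < r by lra.
rewrite taylor_remainder //.
have -> : 4 * M * (nrm t / r) ^+ n = 2 * (2 * (nrm t / r) ^+ n * M) by ring.
have zt0 z : nrm z = r -> z - t != 0.
  by move=> zr; rewrite subr_eq0; apply/eqP => ztE; move: tr; rewrite -ztE zr ltxx.
apply: cmean_bound; first exact: ltW.
  apply: circle_contM.
    apply: derivable_circle => // z zr; apply: derivableM => //.
    by apply: derivableV; [exact: zt0|apply: derivableB].
  apply: rcontZ; apply: circle_contV => //.
  by apply: derivable_circle => // z zr; apply: fd; rewrite zr.
move=> z zr.
have -> : nrm (z / (z - t) * (t ^+ n * (z ^- n * f z))) =
    r / nrm (z - t) * ((nrm t / r) ^+ n * nrm (f z)).
  by rewrite !nrmM !nrmV !nrmX zr expr_div_n; ring.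
have h : r / nrm (z - t) <= 2.
  rewrite ler_pdivrMr ?nrm_gt0 ?zt0 //.
  by have := nrmD (z - t) t; rewrite subrK zr; lra.
have p0 : 0 <= (nrm t / r) ^+ n by rewrite exprn_ge0 // divr_ge0 ?nrm_ge0 // ltW.
rewrite -[leRHS]mulrA; apply: ler_pM => //.
- by rewrite divr_ge0 ?nrm_ge0 // ltW.
- by rewrite mulr_ge0 ?nrm_ge0.
- by rewrite ler_wpM2l // hM.
Qed.

End cauchy.

Lemma tcoef_bound k r g M : 0 < r -> circle_cont r g ->
  (forall z, nrm z = r -> nrm (g z) <= M) -> nrm (tcoef r k g) <= 2 * (M / r ^+ k).
Proof.
move=> rp gc hM; apply: cmean_bound; [exact: ltW|exact: circle_contV|].
by move=> z zr; rewrite nrmM nrmV nrmX zr mulrC ler_pM2r ?hM // invr_gt0 exprn_gt0.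
Qed.

Lemma tcoefD k r f g : 0 < r -> circle_cont r f -> circle_cont r g ->
  tcoef r k (fun z => f z + g z) = tcoef r k f + tcoef r k g.
Proof.
move=> rp hf hg; rewrite /tcoef -cmeanD; try exact: circle_contV.
by congr cmean; apply/funext => z; rewrite mulrDr.
Qed.

Lemma tcoefZ k r (c : C) f : 0 < r -> circle_cont r f ->
  tcoef r k (fun z => c * f z) = c * tcoef r k f.
Proof.
move=> rp hf; rewrite /tcoef -cmeanZ; last exact: circle_contV.
by congr cmean; apply/funext => z; rewrite mulrCA.
Qed.

Lemma tcoefB k r f g : 0 < r -> circle_cont r f -> circle_cont r g ->
  tcoef r k (fun z => f z - g z) = tcoef r k f - tcoef r k g.
Proof.
move=> rp hf hg; rewrite /tcoef -cmeanB; try exact: circle_contV.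
by congr cmean; apply/funext => z; rewrite mulrBr.
Qed.

End taylor.

#[global] Opaque tcoef.

Section one_variable.
Context {R : realType}.
Local Notation C := (Cplx R).
Variables (f : C -> C) (r r0 M : R).
Hypothesis fd : forall z, nrm z < r0 -> derivable f z 1.
Hypothesis rp : 0 < r.
Hypothesis rr0 : r < r0.
Hypothesis fM : forall z, nrm z = r -> nrm (f z) <= M.

Lemma tcoef0 : tcoef r 0 f = f 0.
Proof.
have h : nrm (0 : C) <= r / 2 by rewrite nrm0 divr_ge0 // ltW.
have := taylor_bound fd 1 rp rr0 fM h.
rewrite nrm0 mul0r expr0n mulr0 big_ord_recl big_ord0 addr0 expr0 mulr1 => H.
apply/eqP; rewrite eq_sym -subr_eq0 -nrm_eq0 eq_le nrm_ge0 andbT; exact: H.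
Qed.

(** Uniqueness of the first-order expansion, tested on positive real t that
    tend to 0. *)
Lemma tcoef1 : tcoef r 1 f = 'D_1 f 0.
Proof.
have M0 : 0 <= M.
  by apply: le_trans (nrm_ge0 (f (toC r))) (fM _); rewrite nrm_toC gtr0_norm.
have d0 : nrm (0 : C) < r0 by rewrite nrm0; apply: lt_trans rr0.
have da := derivable_cdiff (fd d0); set a := 'D_1 f 0 in da *.
apply/eqP; rewrite -subr_eq0; apply/eqP; apply: nrm_small => e e0.
have e20 : 0 < e / 2 by rewrite divr_gt0.
have [d dp hd] := da _ e20.
pose k := 4 * M / r ^+ 2 + 1.
have kp : 0 < k.
  by rewrite /k ltr_wpDl // divr_ge0 ?exprn_ge0 ?mulr_ge0 // ltW.
pose s := Num.min (Num.min d (r / 2)) (e / 2 / k).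
have sp : 0 < s by rewrite !lt_min dp !divr_gt0.
have s1 : s <= d by rewrite !ge_min lexx.
have s2 : s <= r / 2 by rewrite !ge_min lexx orbT.
have s3 : s * k <= e / 2 by rewrite -ler_pdivlMr // !ge_min lexx orbT.
have ns : nrm (toC s) = s by rewrite nrm_toC gtr0_norm.
have := hd (toC s); rewrite subr0 ns => /(_ s1) H1.
have := taylor_bound fd 2 rp rr0 fM (t := toC s); rewrite ns => /(_ s2).
rewrite !big_ord_recl big_ord0 addr0 expr0 mulr1 expr1 /= tcoef0.
rewrite expr_div_n => H2.
rewrite -(@ler_pM2r _ s) // -{1}ns -nrmM.
have -> : (tcoef r 1 f - a) * toC s = (f (toC s) - f 0 - a * toC s) -
  (f (toC s) - (f 0 + tcoef r 1 f * toC s)) by ring.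
apply: le_trans (nrmB _ _) _.
apply: le_trans (lerD H1 H2) _.
have -> : 4 * M * (s ^+ 2 / r ^+ 2) = s * (4 * M / r ^+ 2) * s by ring.
rewrite -mulrDl ler_pM2r //; move: s3; rewrite /k mulrDr mulr1; lra.
Qed.

End one_variable.

(** * Uniform estimates for holomorphic functions on a ball *)

Section several.
Context {R : realType}.
Local Notation C := (Cplx R).
Context {V : normedModType C}.
Variables (g : V -> C) (z0 : V) (rho M : R).
Hypothesis rho0 : 0 < rho.
Hypothesis gd : forall z, nrm (z - z0) < 4 * rho -> differentiable g z.
Hypothesis gM : forall z, nrm (z - z0) < 4 * rho -> nrm (g z) <= M.
Implicit Types (z v : V) (t : C) (r : R).

Lemma bound_ge0 : 0 <= M.
Proof.
apply: le_trans (nrm_ge0 (g z0)) (gM _).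
by rewrite subrr nrm0 mulr_gt0.
Qed.

Lemma line_diff z v t : differentiable g (z + t *: v) ->
  derivable (fun s : C => g (z + s *: v)) t 1 /\
  'D_1 (fun s : C => g (z + s *: v)) t = 'd g (z + t *: v) v.
Proof.
move=> dg.
have dl : is_diff t (cst z + ( *:%R ^~ v) : C -> V) (0 + ( *:%R ^~ v) : C -> V).
  exact: is_diffD.
have dc : differentiable (g \o (cst z + ( *:%R ^~ v) : C -> V)) t.
  by apply: differentiable_comp.
split; first exact: diff_derivable.
rewrite deriveE // diff_comp //= diff_val /=.
by rewrite !fctE add0r scale1r.
Qed.

(** Radius 4 rho leaves room for a disk of radius 3 rho / 2 in the direction v
    around each point within 2 rho of the centre. *)
Lemma line_in z v r t : nrm (z - z0) <= 2 * rho -> r * nrm v <= rho ->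
  nrm t < r + r / 2 -> nrm (z + t *: v - z0) < 4 * rho.
Proof.
move=> hz hv ht; rewrite addrAC; apply: le_lt_trans (nrmD _ _) _.
rewrite nrmZ; have : nrm t * nrm v <= (r + r / 2) * nrm v.
  by rewrite ler_wpM2r ?nrm_ge0 // ltW.
by rewrite mulrDl mulrAC; (move: rho0; lra).
Qed.

(** Taylor coefficients of g at z in the direction v. *)
Definition lcoef r k v z : C := tcoef r k (fun s : C => g (z + s *: v)).

Section line.
Variables (z v : V) (r : R).
Hypothesis zin : nrm (z - z0) <= 2 * rho.
Hypothesis rp : 0 < r.
Hypothesis rv : r * nrm v <= rho.

Let ld (s : C) : nrm s < r + r / 2 -> derivable (fun s : C => g (z + s *: v)) s 1.
Proof. by move=> hs; apply: (line_diff _).1; apply: gd; exact: line_in rv hs. Qed.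

Let lM (s : C) : nrm s = r -> nrm (g (z + s *: v)) <= M.
Proof. by move=> hs; apply: gM; apply: line_in rv _ => //; rewrite hs; (move: rho0
  zin rp rv; lra). Qed.

Let r32 : r < r + r / 2. Proof. (move: rho0 zin rp rv; lra). Qed.

Lemma line_circle : circle_cont r (fun s : C => g (z + s *: v)).
Proof. by apply: derivable_circle => // s hs; apply: ld; rewrite hs. Qed.

Lemma line_taylor n t : nrm t <= r / 2 ->
  nrm (g (z + t *: v) - \sum_(k < n) lcoef r k v z * t ^+ k) <= 4 * M * (nrm t / r)
    ^+ n.
Proof. exact: (taylor_bound ld). Qed.

Lemma lcoef0 : lcoef r 0 v z = g z.
Proof. by rewrite /lcoef (tcoef0 ld rp r32 lM) scale0r addr0. Qed.

Lemma lcoef1 : lcoef r 1 v z = 'd g z v.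
Proof.
rewrite /lcoef (tcoef1 ld rp r32 lM).
have -> := (@line_diff z v 0 _).2; rewrite scale0r addr0 //.
by apply: gd; apply: le_lt_trans zin _; (move: rho0 zin rp rv; lra).
Qed.

End line.

Let r_of v : v != 0 -> 0 < rho / nrm v /\ rho / nrm v * nrm v = rho.
Proof.
by move=> v0; rewrite divr_gt0 ?nrm_gt0 // divfK // nrm_eq0.
Qed.

(** Cauchy's estimate on the complex line through z in the direction v, on
    which g is bounded up to distance rho. *)
Lemma bounded_holomorphic_lip z v : nrm (z - z0) <= 2 * rho -> nrm v <= rho / 2 ->
  nrm (g (z + v) - g z) <= 4 * M * (nrm v / rho).
Proof.
move=> hz hv; have [->|v0] := eqVneq v 0.
  by rewrite addr0 subrr !nrm0 mul0r mulr0.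
have [rp rv] := r_of v0; have rv' : rho / nrm v * nrm v <= rho by rewrite rv.
have t2 : nrm (1 : C) <= rho / nrm v / 2.
  by rewrite nrm1 mulrAC ler_pdivlMr ?nrm_gt0 // mul1r.
have := line_taylor hz rp rv' 1 t2.
rewrite big_ord_recl big_ord0 expr0 mulr1 addr0 (lcoef0 hz rp rv') scale1r.
by rewrite nrm1 expr1 div1r invf_div.
Qed.

(** The Taylor expansion of order 2 on the line through z in the direction v,
    taken at parameter 1. *)
Lemma second_order z v : nrm (z - z0) <= 2 * rho -> nrm v <= rho / 2 ->
  nrm (g (z + v) - g z - 'd g z v) <= 4 * M * (nrm v / rho) ^+ 2.
Proof.
move=> hz hv; have [->|v0] := eqVneq v 0.
  by rewrite addr0 subrr linear0 subrr !nrm0 mul0r expr0n mulr0.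
have [rp rv] := r_of v0; have rv' : rho / nrm v * nrm v <= rho by rewrite rv.
have t2 : nrm (1 : C) <= rho / nrm v / 2.
  by rewrite nrm1 mulrAC ler_pdivlMr ?nrm_gt0 // mul1r.
have := line_taylor hz rp rv' 2 t2.
rewrite !big_ord_recl big_ord0 !expr1n !mulr1 addr0 (lcoef0 hz rp rv') (lcoef1 hz rp
  rv').
by rewrite scale1r nrm1 div1r invf_div opprD addrA.
Qed.

(** The coefficient functional applied to the difference of g along two
    parallel lines, which [bounded_holomorphic_lip] bounds. *)
Lemma lcoef_lip k v r z z' : 0 < r -> r * nrm v <= rho ->
  nrm (z - z0) <= rho -> nrm (z' - z0) <= rho -> nrm (z' - z) <= rho / 2 ->
  nrm (lcoef r k v z' - lcoef r k v z) <= 8 * M * (nrm (z' - z) / rho) / r ^+ k.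
Proof.
move=> rp rv hz hz' hzz.
have hz2 : nrm (z - z0) <= 2 * rho by (move: rho0; lra).
have hz'2 : nrm (z' - z0) <= 2 * rho by (move: rho0; lra).
rewrite /lcoef -tcoefB //; try exact: line_circle rv.
have -> : 8 * M * (nrm (z' - z) / rho) / r ^+ k =
  2 * (4 * M * (nrm (z' - z) / rho) / r ^+ k) by ring.
apply: tcoef_bound => //.
  by apply: rcontB; exact: line_circle rv.
move=> s sr; have -> : z' + s *: v = (z + s *: v) + (z' - z).
  by rewrite addrAC addrCA subrr addr0.
apply: bounded_holomorphic_lip => //; rewrite addrAC; apply: le_trans (nrmD _ _) _.
by rewrite nrmZ sr; (move: rho0; lra).
Qed.

(** The derivative is a first Taylor coefficient, so [lcoef_lip] applies to
    it. *)
Lemma deriv_lip z z' v : nrm (z - z0) <= rho -> nrm (z' - z0) <= rho ->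
  nrm (z' - z) <= rho / 2 ->
  nrm ('d g z' v - 'd g z v) <= 8 * M * (nrm (z' - z) / rho) * (nrm v / rho).
Proof.
move=> hz hz' hzz.
have hz2 : nrm (z - z0) <= 2 * rho by (move: rho0; lra).
have hz'2 : nrm (z' - z0) <= 2 * rho by (move: rho0; lra).
have [->|v0] := eqVneq v 0.
  by rewrite !linear0 addr0 !nrm0 mul0r mulr0.
have [rp rv] := r_of v0; have rv' : rho / nrm v * nrm v <= rho by rewrite rv.
rewrite -(lcoef1 hz2 rp rv') -(lcoef1 hz'2 rp rv').
by have := lcoef_lip 1 rp rv' hz hz' hzz; rewrite expr1 invf_div.
Qed.

(** Candidate for the derivative at z0 of z |-> lcoef r 1 v z, obtained by
    differentiating g under the integral. *)
Definition lcoef1_diff r v (dl : V) : C := tcoef r 1 (fun s : C => 'd g (z0 + s *: v)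
  dl).

Section lcoef1_diff.
Variables (v : V) (r : R).
Hypothesis rp : 0 < r.
Hypothesis rv : r * nrm v <= rho / 2.

Let circ_in (s : C) : nrm s = r -> nrm (z0 + s *: v - z0) <= rho / 2.
Proof. by move=> sr; rewrite addrAC subrr add0r nrmZ sr. Qed.

Lemma dcircle dl : circle_cont r (fun s : C => 'd g (z0 + s *: v) dl).
Proof.
apply: ccont_circle => // y e e0; set s := _ * circ y.
have sr : nrm s = r by rewrite nrmM nrm_circ mulr1 nrm_toC gtr0_norm.
pose k := 8 * M / rho * (nrm v + 1) * (nrm dl / rho) + 1.
have kp : 0 < k.
  rewrite ltr_wpDl // !mulr_ge0 ?invr_ge0 ?nrm_ge0 ?bound_ge0 ?addr_ge0 ?nrm_ge0 //
    ltW //.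
pose d := Num.min (rho / 2 / (nrm v + 1)) (e / k).
have v1 : 0 < nrm v + 1 by rewrite ltr_wpDl ?nrm_ge0.
have dp : 0 < d by rewrite lt_min !divr_gt0.
exists d => // w hw.
have hwv : nrm (w - s) * (nrm v + 1) <= rho / 2.
  by rewrite -ler_pdivlMr //; apply: le_trans hw _; rewrite ge_min lexx.
have wk : nrm (w - s) * k <= e.
  by rewrite -ler_pdivlMr //; apply: le_trans hw _; rewrite ge_min lexx orbT.
have E : (z0 + w *: v) - (z0 + s *: v) = (w - s) *: v.
  by rewrite opprD addrACA subrr add0r scalerBl.
have N : nrm ((w - s) *: v) <= nrm (w - s) * (nrm v + 1).
  by rewrite nrmZ ler_wpM2l ?nrm_ge0 // lerDl.
have hs := circ_in sr.
apply: le_trans (deriv_lip _ _ _ _) _.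
- (move: rho0 rp rv; lra).
- have -> : z0 + w *: v - z0 = (z0 + s *: v - z0) + (w - s) *: v.
    by rewrite scalerBl [z0 + w *: v]addrC [z0 + s *: v]addrC !addrK addrC subrK.
  by apply: le_trans (nrmD _ _) _; (move: rho0 rp rv; lra).
- rewrite E; (move: rho0 rp rv; lra).
rewrite E; apply: le_trans wk; rewrite /k mulrDr mulr1.
apply: le_trans (_ : nrm (w - s) * (8 * M / rho * (nrm v + 1) * (nrm dl / rho)) <=
  _); last first.
  by rewrite lerDl nrm_ge0.
have -> : nrm (w - s) * (8 * M / rho * (nrm v + 1) * (nrm dl / rho)) =
  8 * M * (nrm (w - s) * (nrm v + 1) / rho) * (nrm dl / rho) by ring.
apply: ler_wpM2r; first by rewrite divr_ge0 ?nrm_ge0 // ltW.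
apply: ler_wpM2l; first by rewrite mulr_ge0 // bound_ge0.
by rewrite ler_pM2r // invr_gt0.
Qed.

Lemma lcoef1_diffD dl dl' : lcoef1_diff r v (dl + dl') = lcoef1_diff r v dl +
  lcoef1_diff r v dl'.
Proof.
rewrite /lcoef1_diff -tcoefD //; try exact: dcircle.
by congr tcoef; apply/funext => s; rewrite linearD.
Qed.

Lemma lcoef1_diffZ (a : C) dl : lcoef1_diff r v (a *: dl) = a * lcoef1_diff r v dl.
Proof.
rewrite /lcoef1_diff -tcoefZ //; try exact: dcircle.
by congr tcoef; apply/funext => s; rewrite linearZ.
Qed.

(** The bound [second_order] is uniform on the circle, and the coefficient
    functional preserves it. *)
Lemma lcoef1_second dl : nrm dl <= rho / 2 ->
  nrm (lcoef r 1 v (z0 + dl) - lcoef r 1 v z0 - lcoef1_diff r v dl)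
    <= 8 * M * (nrm dl / rho) ^+ 2 / r.
Proof.
move=> hdl.
have rv' : r * nrm v <= rho by (move: rho0 rp rv; lra).
have c1 : circle_cont r (fun s : C => g (z0 + dl + s *: v)).
  by apply: line_circle => //; rewrite addrAC subrr add0r; (move: rho0 rp rv; lra).
have c2 : circle_cont r (fun s : C => g (z0 + s *: v)).
  by apply: line_circle => //; rewrite subrr nrm0 mulr_ge0 // ltW.
rewrite /lcoef /lcoef1_diff -tcoefB // -tcoefB //; [|exact: rcontB|exact: dcircle].
have -> : 8 * M * (nrm dl / rho) ^+ 2 / r = 2 * (4 * M * (nrm dl / rho) ^+ 2 / r ^+ 1).
  by rewrite expr1; ring.
apply: tcoef_bound => //.
  by apply: rcontB; [exact: rcontB|exact: dcircle].
move=> s sr; rewrite [z0 + dl + _]addrAC; apply: second_order => //.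
by apply: le_trans (circ_in sr) _; (move: rho0 rp rv; lra).
Qed.

End lcoef1_diff.
End several.

#[global] Opaque lcoef lcoef1_diff.

(** * Even and odd functions along a line *)

(** Averaging f t and - f (- t) removes the even coefficients of a Taylor
    polynomial.  This identity and the next two are stated over any
    commutative ring so that the coefficients are variables. *)
Lemma odd_part_eq (F : comNzRingType) (x a b c d t : F) :
  (x - (b * t + d * t ^+ 3)) + (x - (b * t + d * t ^+ 3)) =
  (x - (a * t ^+ 0 + (b * t ^+ 1 + (c * t ^+ 2 + (d * t ^+ 3 + 0))))) -
  (- x - (a * (- t) ^+ 0 + (b * (- t) ^+ 1 + (c * (- t) ^+ 2 + (d * (- t) ^+ 3 + 0))))).
Proof. by ring. Qed.

Lemma odd_telescope_eq (F : comNzRingType) (x p p' q r r' t : F) :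
  x - (p + q + r * t ^+ 2) * t =
  (x - (p' * t + r' * t ^+ 3)) + (r' - r) * t ^+ 3 + (p' - p - q) * t.
Proof. by ring. Qed.

Lemma even_deriv_eq (F : comNzRingType) (x y z b c c' e t : F) :
  - ((t + t) * b - e * (t + t) ^+ 2) =
  ((x - (z * t ^+ 0 + (b * t ^+ 1 + (c * t ^+ 2 + 0)))) -
     (y - (z * (- t) ^+ 0 + (b * (- t) ^+ 1 + (c * (- t) ^+ 2 + 0)))) -
     (x - y - e * (t + t) ^+ 2)).
Proof. by ring. Qed.

Section parity.
Context {R : realType}.
Local Notation C := (Cplx R).
Context {V : normedModType C}.
Variables (g : V -> C) (z0 : V) (rho M : R).
Hypothesis rho0 : 0 < rho.
Hypothesis gd : forall z, nrm (z - z0) < 4 * rho -> differentiable g z.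
Hypothesis gM : forall z, nrm (z - z0) < 4 * rho -> nrm (g z) <= M.
Variables (v : V) (r : R).
Hypothesis rp : 0 < r.
Hypothesis rv : r * nrm v <= rho / 2.
Implicit Types (z w dl : V) (t : C).
Local Notation lc := (lcoef g r).

Let rv1 : r * nrm v <= rho. Proof. by move: rho0 rv; lra. Qed.

Lemma half_nrm (a : C) (K : R) : nrm (a + a) <= K + K -> nrm a <= K.
Proof.
rewrite -mulr2n -mulr_natl nrmM -toC_nat nrm_toC ger0_norm //.
by lra.
Qed.

Let lt_center : nrm (z0 - z0) <= 2 * rho.
Proof. by rewrite subrr nrm0 mulr_ge0 // ltW. Qed.

Let lt_shift dl : nrm dl <= rho -> nrm (z0 + dl - z0) <= 2 * rho.
Proof. by move=> h; rewrite addrAC subrr add0r; move: rho0; lra. Qed.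

(** Averaging the expansions at t and - t removes the coefficient of t. *)
Lemma even_line z t : nrm (z - z0) <= 2 * rho -> nrm t <= r / 2 ->
  g (z - t *: v) = g (z + t *: v) ->
  nrm (g (z + t *: v) - g z - lc 2 v z * t ^+ 2) <= 4 * M * (nrm t / r) ^+ 3.
Proof.
move=> hz ht ev; have htN : nrm (- t) <= r / 2 by rewrite nrmN.
have T1 := line_taylor rho0 gd gM hz rp rv1 3 ht.
have T2 := line_taylor rho0 gd gM hz rp rv1 3 htN.
rewrite nrmN scaleNr ev in T2.
apply: half_nrm; apply: le_trans (lerD T1 T2).
apply: le_trans (nrmD _ _).
rewrite le_eqVlt; apply/orP; left; apply/eqP; congr nrm.
rewrite !big_ord_recl !big_ord0 /= /bump /= (lcoef0 rho0 gd gM hz rp rv1).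
by rewrite !expr0 !expr1 sqrrN; ring.
Qed.

(** The three error terms are the remainder along v, the variation of the
    second coefficient with the base point, and the remainder along dl. *)
Lemma even_expansion dl t : nrm dl <= rho / 2 -> nrm t <= r / 2 ->
  g (z0 + dl - t *: v) = g (z0 + dl + t *: v) ->
  nrm (g (z0 + dl + t *: v) - g z0 - 'd g z0 dl - lc 2 v z0 * t ^+ 2)
    <= 4 * M * (nrm t / r) ^+ 3 + 8 * M * (nrm dl / rho) / r ^+ 2 * nrm t ^+ 2
       + 4 * M * (nrm dl / rho) ^+ 2.
Proof.
move=> hd ht ev.
have hd' : nrm dl <= rho by move: rho0; lra.
have E := even_line (lt_shift hd') ht ev.
have S := second_order rho0 gd gM lt_center hd.
have L : nrm (lc 2 v (z0 + dl) - lc 2 v z0) <= 8 * M * (nrm dl / rho) / r ^+ 2.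
  have sh : z0 + dl - z0 = dl by rewrite addrAC subrr add0r.
  have h0 : nrm (z0 - z0) <= rho by rewrite subrr nrm0 ltW.
  have h1 : nrm (z0 + dl - z0) <= rho by rewrite sh.
  have h2 : nrm (z0 + dl - z0) <= rho / 2 by rewrite sh.
  by have := lcoef_lip rho0 gd gM 2 rp rv1 h0 h1 h2; rewrite sh.
have L2 : nrm ((lc 2 v (z0 + dl) - lc 2 v z0) * t ^+ 2) <=
    8 * M * (nrm dl / rho) / r ^+ 2 * nrm t ^+ 2.
  by rewrite nrmM nrmX ler_wpM2r // exprn_ge0 // nrm_ge0.
have -> : g (z0 + dl + t *: v) - g z0 - 'd g z0 dl - lc 2 v z0 * t ^+ 2 =
  (g (z0 + dl + t *: v) - g (z0 + dl) - lc 2 v (z0 + dl) * t ^+ 2) +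
  (lc 2 v (z0 + dl) - lc 2 v z0) * t ^+ 2 + (g (z0 + dl) - g z0 - 'd g z0 dl).
  by ring.
by apply: le_trans (nrmD _ _) (lerD (le_trans (nrmD _ _) (lerD E L2)) S).
Qed.

(** The error is t times an error of the same shape as in [even_expansion], so
    that g / t expands as an even function does. *)
Lemma odd_expansion dl t : nrm dl <= rho / 2 -> nrm t <= r / 2 ->
  g (z0 + dl - t *: v) = - g (z0 + dl + t *: v) ->
  nrm (g (z0 + dl + t *: v) -
       (lc 1 v z0 + lcoef1_diff g z0 r v dl + lc 3 v z0 * t ^+ 2) * t)
    <= 4 * M * (nrm t / r) ^+ 4 + 8 * M * (nrm dl / rho) / r ^+ 3 * nrm t ^+ 3
       + 8 * M * (nrm dl / rho) ^+ 2 / r * nrm t.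
Proof.
move=> hd ht ev.
have hd' : nrm dl <= rho by move: rho0; lra.
have htN : nrm (- t) <= r / 2 by rewrite nrmN.
have T1 := line_taylor rho0 gd gM (lt_shift hd') rp rv1 4 ht.
have T2 := line_taylor rho0 gd gM (lt_shift hd') rp rv1 4 htN.
rewrite nrmN scaleNr ev in T2.
have E : nrm (g (z0 + dl + t *: v) - (lc 1 v (z0 + dl) * t + lc 3 v (z0 + dl) * t ^+ 3))
    <= 4 * M * (nrm t / r) ^+ 4.
  apply: half_nrm; apply: le_trans (lerD T1 T2); apply: le_trans (nrmB _ _).
  rewrite le_eqVlt; apply/orP; left; apply/eqP; congr nrm.
  rewrite !big_ord_recl !big_ord0 /= /bump /=; exact: odd_part_eq.
have S := lcoef1_second rho0 gd gM rp rv hd.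
have L : nrm (lc 3 v (z0 + dl) - lc 3 v z0) <= 8 * M * (nrm dl / rho) / r ^+ 3.
  have sh : z0 + dl - z0 = dl by rewrite addrAC subrr add0r.
  have h0 : nrm (z0 - z0) <= rho by rewrite subrr nrm0 ltW.
  have h1 : nrm (z0 + dl - z0) <= rho by rewrite sh.
  have h2 : nrm (z0 + dl - z0) <= rho / 2 by rewrite sh.
  by have := lcoef_lip rho0 gd gM 3 rp rv1 h0 h1 h2; rewrite sh.
have L2 : nrm ((lc 3 v (z0 + dl) - lc 3 v z0) * t ^+ 3) <=
    8 * M * (nrm dl / rho) / r ^+ 3 * nrm t ^+ 3.
  by rewrite nrmM nrmX ler_wpM2r // exprn_ge0 // nrm_ge0.
have S2 : nrm ((lc 1 v (z0 + dl) - lc 1 v z0 - lcoef1_diff g z0 r v dl) * t) <=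
    8 * M * (nrm dl / rho) ^+ 2 / r * nrm t.
  by rewrite nrmM ler_wpM2r // nrm_ge0.
have -> : g (z0 + dl + t *: v) -
       (lc 1 v z0 + lcoef1_diff g z0 r v dl + lc 3 v z0 * t ^+ 2) * t =
  (g (z0 + dl + t *: v) - (lc 1 v (z0 + dl) * t + lc 3 v (z0 + dl) * t ^+ 3)) +
  (lc 3 v (z0 + dl) - lc 3 v z0) * t ^+ 3 +
  (lc 1 v (z0 + dl) - lc 1 v z0 - lcoef1_diff g z0 r v dl) * t.
  exact: odd_telescope_eq.
by apply: le_trans (nrmD _ _) (lerD (le_trans (nrmD _ _) (lerD E L2)) S2).
Qed.

(** The difference g (z0 + 2 t v) - g z0 is computed twice: from the expansion
    at z0 + t v, where the even terms cancel, and from the expansion at z0. *)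
Lemma even_deriv t : t != 0 -> nrm t <= r / 4 ->
  (forall s, nrm s <= r / 2 -> g (z0 - s *: v) = g (z0 + s *: v)) ->
  nrm ((t + t)^-1 * 'd g (z0 + t *: v) v - lc 2 v z0) <= 10 * M * nrm t / r ^+ 3.
Proof.
move=> t0 ht ev.
have nt := nrm_ge0 t.
have ht2 : nrm t <= r / 2 by move: rp; lra.
have htN : nrm (- t) <= r / 2 by rewrite nrmN.
have h2t : nrm (t + t) <= r / 2 by apply: le_trans (nrmD _ _) _; lra.
have tv : nrm (t *: v) <= rho.
  rewrite nrmZ; apply: le_trans rv1; rewrite ler_wpM2r ?nrm_ge0 //.
  by move: rp; lra.
have hz := lt_shift tv.
have T1 := line_taylor rho0 gd gM hz rp rv1 3 ht2.
have T2 := line_taylor rho0 gd gM hz rp rv1 3 htN.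
rewrite nrmN scaleNr addrK in T2.
rewrite -addrA -scalerDl in T1.
have E := even_line lt_center h2t (ev _ h2t).
have C1 := lcoef1 rho0 gd gM hz rp rv1.
have M0 : 0 <= M by apply: bound_ge0 rho0 gM.
have T : nrm ((t + t) * 'd g (z0 + t *: v) v - lc 2 v z0 * (t + t) ^+ 2) <=
   4 * M * (nrm t / r) ^+ 3 + 4 * M * (nrm t / r) ^+ 3 + 4 * M * (nrm (t + t) / r) ^+ 3.
  apply: le_trans (lerD (lerD T1 T2) E).
  apply: le_trans (lerD (nrmB _ _) (lexx _)); apply: le_trans (nrmB _ _).
  rewrite le_eqVlt; apply/orP; left; apply/eqP; rewrite -nrmN; congr nrm.
  rewrite !big_ord_recl !big_ord0 /= /bump /= C1; exact: even_deriv_eq.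
have ntt : nrm (t + t) = 2 * nrm t.
  have -> : t + t = toC 2 * t by rewrite toC_nat mulr_natl mulr2n.
  by rewrite nrmM nrm_toC ger0_norm.
have tt0 : t + t != 0 by rewrite -nrm_eq0 ntt mulf_neq0 ?nrm_eq0.
have tpos : 0 < nrm t by rewrite nrm_gt0.
rewrite -(@ler_pM2r _ (nrm (t + t) ^+ 2)); last by rewrite exprn_gt0 // nrm_gt0.
rewrite -nrmX -nrmM.
have -> : ((t + t)^-1 * 'd g (z0 + t *: v) v - lc 2 v z0) * (t + t) ^+ 2 =
  (t + t) * 'd g (z0 + t *: v) v - lc 2 v z0 * (t + t) ^+ 2.
  by rewrite mulrBl; congr (_ - _); rewrite mulrAC expr2 mulrA mulVf // mul1r.
apply: le_trans T _; rewrite nrmX ntt le_eqVlt; apply/orP; left; apply/eqP.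
by field; rewrite gt_eqF //; move: rp.
Qed.

End parity.

(** * Differentiability by estimates, and descent *)

Section nbhs_nrm.
Context {R : realType}.
Local Notation C := (Cplx R).

Lemma nbhs_nrmP (V : normedModType C) (x : V) (P : set V) :
  nbhs x P <-> exists2 d : R, 0 < d & forall y, nrm (y - x) < d -> P y.
Proof.
split.
  move=> /nbhs_ballP[e /gt0_toC[d d0 ->] h]; exists d => // y hy; apply: h.
  by rewrite -ball_normE /= distrC nrmE toC_lt.
move=> [d d0 h]; apply/nbhs_ballP; exists (toC d); first by rewrite /= -toC0 toC_lt.
move=> y; rewrite -ball_normE /= distrC nrmE toC_lt; exact: h.
Qed.

Lemma continuous_nrmP (V W : normedModType C) (f : V -> W) x :
  {for x, continuous f} <->
  forall e : R, 0 < e -> exists2 d : R, 0 < d &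
    forall y, nrm (y - x) < d -> nrm (f y - f x) < e.
Proof.
split => [cf e e0|h].
  have /cf : nbhs (f x) [set w | nrm (w - f x) < e].
    by apply/nbhs_nrmP; exists e.
  by move=> /nbhs_nrmP[d d0 hd]; exists d.
move=> P /nbhs_nrmP[e e0 hP]; have [d d0 hd] := h e e0.
by apply/nbhs_nrmP; exists d => // y /hd /hP.
Qed.

Lemma bounded_linear_cont (V W : normedModType C) (L : {linear V -> W}) (K : R) :
  (forall w, nrm (L w) <= K * nrm w) -> continuous L.
Proof.
move=> h x; apply/continuous_nrmP => e e0.
have k0 : 0 < `|K| + 1 by rewrite ltr_wpDl.
exists (e / (`|K| + 1)); first by rewrite divr_gt0.
move=> y hy; rewrite -linearB; apply: le_lt_trans (h _) _.
move: hy; rewrite ltr_pdivlMr //; apply: le_lt_trans.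
rewrite mulrC ler_wpM2l ?nrm_ge0 //; have := ler_norm K; lra.
Qed.

Lemma differentiable_nrm (V W : normedModType C) (f : V -> W) x : differentiable f x ->
  forall e : R, 0 < e -> exists2 d : R, 0 < d &
    forall y, nrm (y - x) < d -> nrm (f y - f x - 'd f x (y - x)) <= e * nrm (y - x).
Proof.
move=> /diff_locallyP[_ /eqaddoP h] e e0.
have e0' : 0 < toC e by rewrite -toC0 toC_lt.
have := h _ e0'; rewrite nearE => /nbhs_nrmP[d d0 hd]; exists d => // y hy.
have := hd (y - x); rewrite subr0 => /(_ hy) /=.
by rewrite !fctE /= subrK !nrmE -toCM toC_le opprD addrA.
Qed.

Lemma nrm_differentiable (V W : normedModType C) (f : V -> W) x (L : {linear V -> W})
  (K : R) :
  (forall w, nrm (L w) <= K * nrm w) ->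
  (forall e : R, 0 < e -> exists2 d : R, 0 < d &
    forall y, nrm (y - x) < d -> nrm (f y - f x - L (y - x)) <= e * nrm (y - x)) ->
  differentiable f x /\ 'd f x = L :> (V -> W).
Proof.
move=> LK h; have Lc := bounded_linear_cont LK.
have E : f \o shift x = cst (f x) + L +o_ 0 id.
  apply/eqaddoP => _ /gt0_toC[e e0 ->]; have [d d0 hd] := h e e0.
  rewrite nearE; apply/nbhs_nrmP; exists d => // y; rewrite subr0 => hy.
  have := hd (y + x); rewrite addrK => /(_ hy).
  by rewrite -toC_le toCM -!nrmE !fctE /= opprD addrA.
have dE := diff_unique Lc E.
by split=> //; apply/diff_locallyP; rewrite dE.
Qed.

Lemma nrm_coord m n (x : 'M[C]_(m, n)) i j : nrm (x i j) <= nrm x.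
Proof.
rewrite -toC_le -!nrmE [leRHS]mx_normE -[leLHS]nngE num_le.
exact: (le_bigmax _ _ (i, j)).
Qed.

Lemma nrm_rV_le n (x : 'rV[C]_n) (K : R) : 0 <= K ->
  (forall j, nrm (x ord0 j) <= K) -> nrm x <= K.
Proof.
move=> K0 h; have [->|] := eqVneq x 0; first by rewrite nrm0.
rewrite -normr_eq0 => /mx_norm_neq0[[i j]]; rewrite (ord1 i) /= => E.
by apply: le_trans (h j); rewrite /nrm [`|x|]E.
Qed.

Lemma linear_bounded n (W : normedModType C) (L : {linear 'rV[C]_n -> W}) :
  exists2 K : R, 0 < K & forall w, nrm (L w) <= K * nrm w.
Proof.
exists (\sum_(j < n) nrm (L (delta_mx 0 j)) + 1).
  by rewrite ltr_wpDl // sumr_ge0 // => j _; exact: nrm_ge0.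
move=> w; rewrite {1}(row_sum_delta w) linear_sum mulrDl mul1r mulr_suml.
apply: le_trans (nrm_sum _ _ _) _; apply: le_trans (_ : _ <= \sum_(j < n) nrm (L
  (delta_mx 0 j)) * nrm w) _; last first.
  by rewrite lerDl nrm_ge0.
apply: ler_sum => j _; rewrite linearZ nrmZ mulrC ler_wpM2l ?nrm_ge0 //.
exact: nrm_coord.
Qed.

Lemma cvg_det (T : Type) (F : set_system T) n (A : T -> 'M[C]_n) (B : 'M[C]_n) :
  Filter F -> (forall i j, A t i j @[t --> F] --> B i j) ->
  \det (A t) @[t --> F] --> \det B.
Proof.
move=> FF h; rewrite /determinant.
apply: (@cvg_big C _ +%R 0 xpredT) => //.
  by move=> [x y]; apply: cvgD; [exact: cvg_fst|exact: cvg_snd].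
move=> s _; apply: cvgM; first exact: cvg_cst.
apply: (@cvg_big C _ *%R 1 xpredT) => //.
by move=> [x y]; apply: cvgM; [exact: cvg_fst|exact: cvg_snd].
Qed.

(** The part of b that is proportional to q is absorbed by q. *)
Lemma absorb_small (q a b D K e : R) : q <= a + b -> a <= K * D -> b <= K * (e * q) ->
  e * K <= 1 / 2 -> 0 <= q -> q <= 2 * K * D.
Proof.
move=> h1 h2 h3 h4 h5; have : e * K * q <= 1 / 2 * q by rewrite ler_wpM2r.
by rewrite mulrA (mulrC K) in h3; lra.
Qed.

(** B being invertible, phi z - phi z0 = Q z B + o(Q z) gives Q z = O(phi z -
    phi z0).  Substituted in the expansion of h, along preimages z of v that
    tend to z0 with v, it gives an expansion of f.  At regular points Q z is z
    - z0; at critical points it is quadratic across the critical hyperplane.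
    *)
Lemma descent n (f h : 'rV[C]_n -> C) (phi Q : 'rV[C]_n -> 'rV[C]_n)
    (U : set 'rV[C]_n) (z0 : 'rV[C]_n) (B : 'M[C]_n) (m : {linear 'rV[C]_n -> C}) :
  B \in unitmx -> U z0 ->
  (forall e : R, 0 < e -> exists2 d : R, 0 < d & forall z, U z -> nrm (z - z0) < d ->
     nrm (phi z - phi z0 - Q z *m B) <= e * nrm (Q z)) ->
  (forall e : R, 0 < e -> exists2 d : R, 0 < d & forall z, U z -> nrm (z - z0) < d ->
     nrm (h z - h z0 - m (Q z)) <= e * nrm (Q z)) ->
  (forall z, U z -> f (phi z) = h z) ->
  (forall e : R, 0 < e -> exists2 d : R, 0 < d & forall v, nrm (v - phi z0) < d ->
     exists z, [/\ U z, nrm (z - z0) < e & phi z = v]) ->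
  differentiable f (phi z0).
Proof.
move=> Bu Uz0 H1 H2 fh H4.
have [Km Km0 hKm] := linear_bounded m.
have [Kb Kb0 hKb] := linear_bounded (mulmxr (invmx B)).
pose L := [the {linear 'rV[C]_n -> C} of m \o mulmxr (invmx B)].
apply: (proj1 (@nrm_differentiable _ _ f (phi z0) L (Km * Kb) _ _)).
  by move=> w /=; apply: le_trans (hKm _) _; rewrite -mulrA ler_pM2l //; exact: hKb.
move=> e e0.
pose k := 2 * Kb * (1 + Km * Kb).
have p1 : 0 < 1 + Km * Kb by rewrite addr_gt0 // mulr_gt0.
have k0 : 0 < k by rewrite /k mulr_gt0 // mulr_gt0.
pose e' := Num.min ((2 * Kb)^-1) (e / k).
have e'0 : 0 < e' by rewrite lt_min divr_gt0 // invr_gt0 mulr_gt0.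
have e'1 : e' * Kb <= 1 / 2.
  have -> : 1 / 2 = (2 * Kb)^-1 * Kb by field; rewrite gt_eqF.
  by rewrite ler_pM2r // ge_min lexx.
have e'2 : e' * k <= e by rewrite -ler_pdivlMr // ge_min lexx orbT.
have [d1 d10 h1] := H1 _ e'0; have [d2 d20 h2] := H2 _ e'0.
have d0 : 0 < Num.min d1 d2 by rewrite lt_min d10 d20.
have [d dp hd] := H4 _ d0; exists d => // v /hd[z [Uz + <-]] {v}.
rewrite lt_min => /andP[zd1 zd2].
have A1 := h1 _ Uz zd1; have A2 := h2 _ Uz zd2.
rewrite fh // fh //=.
set D := phi z - phi z0 in A1 *; set q := Q z in A1 A2 *.
have q1 : q = D *m invmx B - (D - q *m B) *m invmx B.
  by rewrite [(D - _) *m _]mulmxBl opprB addrCA subrr addr0 mulmxK.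
have N1 : nrm (D *m invmx B) <= Kb * nrm D by exact: hKb.
have N2 : nrm ((D - q *m B) *m invmx B) <= Kb * (e' * nrm q).
  by apply: le_trans (hKb _) _; rewrite ler_pM2l.
have nq := nrm_ge0 q; have nD := nrm_ge0 D.
have Nq : nrm q <= 2 * Kb * nrm D.
  have := nrmB (D *m invmx B) ((D - q *m B) *m invmx B); rewrite -q1 => N3.
  exact: absorb_small N3 N1 N2 e'1 nq.
have -> : h z - h z0 - m (D *m invmx B) = (h z - h z0 - m q) - m ((D - q *m B) *m
  invmx B).
  by rewrite {1}q1 linearB opprB addrA addrAC [RHS]addrAC subrK.
apply: le_trans (nrmB _ _) _.
have N3 : nrm (m ((D - q *m B) *m invmx B)) <= Km * (Kb * (e' * nrm q)).
  by apply: le_trans (hKm _) _; rewrite ler_pM2l.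
apply: le_trans (lerD A2 N3) _.
have -> : e' * nrm q + Km * (Kb * (e' * nrm q)) = e' * (1 + Km * Kb) * nrm q by ring.
apply: (@le_trans _ _ (e' * (1 + Km * Kb) * (2 * Kb * nrm D))).
  by apply: ler_wpM2l => //; rewrite ltW // mulr_gt0.
have -> : e' * (1 + Km * Kb) * (2 * Kb * nrm D) = e' * k * nrm D by rewrite /k; ring.
by rewrite ler_wpM2r.
Qed.

End nbhs_nrm.

(** * Proper maps and fibres *)

Section proper.
Context {R : realType} {d : nat}.
Local Notation C := (Cplx R).
Local Notation Cd := 'rV[C]_d.
Implicit Types (U V : set Cd) (phi : Cd -> Cd).

(** The compact sets on which properness is used: sequences of values
    converging in V, with their limits. *)
Lemma compact_cvg_seq (v : nat -> Cd) (v0 : Cd) :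
  (forall e : R, 0 < e -> exists N, forall n, (N <= n)%N -> nrm (v n - v0) < e) ->
  compact [set w | w = v0 \/ exists n, w = v n].
Proof.
move=> hv F FF FK; set K := [set w | _] in FK *.
have [cl|ncl] := pselect (cluster F v0).
  by exists v0; split => //; left.
have [A [B [FA nB AB]]] : exists A B, [/\ F A, nbhs v0 B & A `&` B = set0].
  apply: contrapT => h; apply: ncl => A B FA nB; apply: contrapT => /set0P/negP.
  by rewrite negbK => /eqP AB; apply: h; exists A, B.
have [e e0 hB] := (nbhs_nrmP _ _).1 nB; have [N hN] := hv e e0.
have fin : compact [set v n | n in `I_N].
  by apply: finite_compact; apply: finite_image; exact: finite_II.
have : F [set v n | n in `I_N].
  apply: filterS (filterI FA FK) => w [Aw wK].
  have nBw : ~ B w by move=> Bw; have : (A `&` B) w by []; rewrite AB.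
  case: wK => [wv0|[n wn]].
    by case: nBw; rewrite wv0; exact: nbhs_singleton nB.
  exists n => //=; rewrite ltnNge; apply/negP => Nn; apply: nBw; rewrite wn.
  by apply: hB; exact: hN.
move=> /(fin F FF) [w [[n _ <-] clw]]; exists (v n).
by split; [right; exists n|exact: clw].
Qed.

(** Otherwise some z_n stay away from the fibre while phi z_n tends to v0.  By
    properness the z_n have a cluster point in U, and it lies in the fibre. *)
Lemma proper_near U V phi v0 : proper_map U V phi -> holomorphic_on U phi ->
  open V -> V v0 ->
  forall eta : R, 0 < eta -> exists2 dl : R, 0 < dl & forall z, U z ->
    nrm (phi z - v0) < dl -> exists z1, [/\ U z1, phi z1 = v0 & nrm (z - z1) < eta].
Proof.
move=> [UV _ prop] hol oV Vv0 eta eta0; apply: contrapT => H.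
have H' (n : nat) : exists z, [/\ U z, nrm (phi z - v0) < n.+1%:R^-1 &
    forall z1, U z1 -> phi z1 = v0 -> ~ nrm (z - z1) < eta].
  apply: contrapT => Hn; apply: H; exists n.+1%:R^-1; first by rewrite invr_gt0 ltr0n.
  move=> z Uz hz; apply: contrapT => Hz; apply: Hn; exists z; split => // z1 U1 p1 h1.
  by apply: Hz; exists z1.
have [z hz] := choice H'.
pose K := [set w | w = v0 \/ exists n, w = phi (z n)].
have cK : compact K.
  apply: compact_cvg_seq => e e0.
  have [N hN] : exists N : nat, N.+1%:R^-1 < e.
    have [N _ /(_ N (leqnn N)) hN] := near_infty_natSinv_lt (PosNum e0).
    by exists N.
  exists N => n Nn; have [_ h _] := hz n; apply: lt_trans h _.
  apply: le_lt_trans hN; rewrite lef_pV2 ?posrE ?ltr0n // ler_nat ltnS //.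
have KV : K `<=` V by move=> w [->//|[n ->]]; apply: UV; have [] := hz n.
have cp := prop K KV cK.
have : (z @ \oo) (U `&` phi @^-1` K).
  exists 0%N => // n _ /=; split; first by have [] := hz n.
  by right; exists n.
move=> /(cp (z @ \oo) _) [zz [[Uzz _] cl]].
have near_cl (e : R) (N : nat) : 0 < e -> exists2 n, (N <= n)%N & nrm (z n - zz) < e.
  move=> e0; have : nbhs zz [set w | nrm (w - zz) < e] by apply/nbhs_nrmP; exists e.
  have : (z @ \oo) [set z n | n in [set n | (N <= n)%N]].
    by exists N => // n Nn; exists n.
  by move=> h /(cl _ _ h)[_ [[n Nn <-] hn]]; exists n.
have pzz : phi zz = v0.
  apply/eqP; rewrite -subr_eq0; apply/eqP; apply: nrm_small => e e0.
  have e20 : 0 < e / 2 by rewrite divr_gt0.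
  have /continuous_nrmP /(_ _ e20) [dl dl0 hdl] := differentiable_continuous (hol _
    Uzz).
  have [N _ /(_ _ _) hN] := near_infty_natSinv_lt (PosNum e20).
  have [n Nn hn] := near_cl dl N dl0.
  have [_ h _] := hz n; have h1 := hdl _ hn; have h2 := hN n Nn.
  have -> : phi zz - v0 = (phi (z n) - v0) - (phi (z n) - phi zz).
    by rewrite opprB [RHS]addrC subrKA.
  apply: le_trans (nrmB _ _) _; rewrite [e]splitr; apply: lerD; rewrite ltW //.
  exact: lt_trans h h2.
have [n _ hn] := near_cl eta 0%N eta0.
by have [_ _ /(_ zz Uzz pzz)] := hz n.
Qed.

Lemma card_II1_eq (T : Type) (A : set T) x y : (A #= `I_1)%card -> A x -> A y -> x = y.
Proof.
move=> /card_set_bijP[f [hf inj _]] Ax Ay; apply: inj; rewrite ?inE //.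
by have := hf _ Ax; have := hf _ Ay; rewrite /= !ltnS !leqn0 => /eqP -> /eqP ->.
Qed.

Lemma card_II2_pair (T : Type) (A : set T) x y w : (A #= `I_2)%card -> A x -> A y ->
  x <> y ->
  A w -> w = x \/ w = y.
Proof.
move=> /card_set_bijP[f [hf inj _]] Ax Ay xy Aw.
have := hf _ Ax; have := hf _ Ay; have := hf _ Aw => /=.
have fxy : f x != f y by apply/eqP => /inj; rewrite !inE => /(_ Ax Ay).
move=> hw hy hx; have [E|nE] := eqVneq (f w) (f x).
  by left; apply: inj; rewrite ?inE.
right; apply: inj; rewrite ?inE //.
by move: hw hy hx fxy nE; case: (f w) => [|[|]] //; case: (f x) => [|[|]] //; case:
  (f y) => [|[|]].
Qed.

Lemma card_II2_neq0 (T : Type) (A : set T) : (A #= `I_2)%card -> A !=set0.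
Proof.
move=> /card_set_bijP[f [_ _ sur]]; have [x Ax _] : (f @` A) 0%N by exact: sur.
by exists x.
Qed.

Lemma card_II0_empty (T : Type) (A : set T) x : (A #= `I_0)%card -> ~ A x.
Proof. by rewrite II0 card_eq0 => /eqP ->. Qed.

End proper.

(** * The involution and the fibres of the map *)

Section geometry.
Context {R : realType} {d : nat}.
Local Notation C := (Cplx R).
Local Notation Cd := 'rV[C]_d.
Variables (sigma phi : Cd -> Cd) (U V : set Cd) (A : {linear Cd -> Cd}) (B0 : Cd).
Hypothesis sigmaE : forall z, sigma z = A z + B0.
Hypothesis sigmaK : involutive sigma.
Hypothesis oU : open U.
Hypothesis oV : open V.
Hypothesis sigmaU : invariant_set sigma U.
Hypothesis phi_sigma : forall z, U z -> phi (sigma z) = phi z.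
Hypothesis phi_proper : m_proper 2 U V phi.
Hypothesis Jsigma : forall z, Jac sigma z = -1.

Lemma sigma_is_diff z : differentiable sigma z /\ 'd sigma z = A :> (Cd -> Cd).
Proof.
have [K _ hK] := linear_bounded A.
apply: (nrm_differentiable hK) => e e0; exists 1 => // y _.
have -> : sigma y - sigma z - A (y - z) = 0.
  by rewrite !sigmaE (linearB A) opprD addrACA subrr addr0 subrr.
by rewrite nrm0 mulr_ge0 ?nrm_ge0 // ltW.
Qed.

Lemma sigma_diff z : differentiable sigma z.
Proof. exact: (sigma_is_diff z).1. Qed.

Lemma dsigma z : 'd sigma z = A :> (Cd -> Cd).
Proof. exact: (sigma_is_diff z).2. Qed.

Lemma phi_diff z : U z -> differentiable phi z.
Proof. by case: phi_proper => _ h _ _; exact: h. Qed.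

(** A map with linear part the identity has Jacobian 1. *)
Lemma linear_part_neq_id : ~ (forall w, A w = w).
Proof.
move=> h; have := Jsigma 0; rewrite /Jac /jacobian.
have -> : lin1_mx ('d sigma 0) = 1%:M.
  apply/row_matrixP => i; rewrite rowE -[LHS]trmxK.
  by rewrite trmxK mul_rV_lin1 /= dsigma h rowE mulmx1.
rewrite det1 => /eqP; rewrite -subr_eq0 opprK.
by rewrite -(natrD C 1 1) pnatr_eq0.
Qed.

Lemma near_U z : U z -> \forall w \near z, U w.
Proof. by move=> Uz; exact: open_nbhs_nbhs. Qed.

Lemma U_ball z : U z -> exists2 e : R, 0 < e & forall w, nrm (w - z) < e -> U w.
Proof. by move=> /near_U /nbhs_nrmP. Qed.

(** Chain rule for phi o sigma = phi. *)
Lemma Jac_anti z : U z -> Jac phi (sigma z) = - Jac phi z.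
Proof.
move=> Uz; have Usz := sigmaU Uz.
have E : jacobian phi z = jacobian sigma z *m jacobian phi (sigma z).
  have ds := sigma_diff z; have dp := phi_diff Usz.
  apply/row_matrixP => i; rewrite !rowE mulmxA; set w := delta_mx 0 i.
  apply: (etrans (esym (deriveEjacobian w (phi_diff Uz)))).
  have -> : 'D_w phi z = 'D_w (phi \o sigma) z.
    by apply: near_eq_derive; apply: filterS (near_U Uz) => x /phi_sigma.
  apply: (etrans (deriveE _ (differentiable_comp ds dp))).
  apply: (etrans (congr1 (fun f : Cd -> Cd => f w) (diff_comp ds dp))) => /=.
  apply: (etrans (esym (deriveE _ dp))).
  apply: (etrans (deriveEjacobian _ dp)); congr (_ *m _).
  exact: (etrans (esym (deriveE w ds)) (deriveEjacobian w ds)).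
have : Jac phi z = Jac sigma z * Jac phi (sigma z) by rewrite /Jac E det_mulmx.
by rewrite Jsigma mulN1r => ->; rewrite opprK.
Qed.

(** The fibre over a critical value has at most one point, and it contains z
    and sigma z. *)
Lemma crit_fix z : U z -> Jac phi z = 0 ->
  sigma z = z /\ forall w, U w -> phi w = phi z -> w = z.
Proof.
move=> Uz Jz; case: phi_proper => _ _ _ /(_ (phi z)) h.
have [k k2 hk] := h (ex_intro2 _ _ z (conj Uz Jz) (erefl _)).
have zin : (U `&` phi @^-1` [set phi z]) z by [].
suff fib w : U w -> phi w = phi z -> w = z.
  by split => //; apply: fib; [exact: sigmaU|exact: phi_sigma].
move=> Uw pw; have win : (U `&` phi @^-1` [set phi z]) w by [].
move: k2 hk; case: k => [|[|//]] _ hk; first by case: (card_II0_empty hk zin).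
exact: card_II1_eq hk win zin.
Qed.

Lemma reg_value z : U z -> Jac phi z != 0 -> ~ crit_values U phi (phi z).
Proof.
move=> Uz Jz [w [Uw Jw] pw]; have [_ /(_ z Uz (esym pw)) zw] := crit_fix Uw Jw.
by move: Jz; rewrite zw Jw eqxx.
Qed.

Lemma phiV z : U z -> V (phi z).
Proof. by case: phi_proper => -[+ _ _] _ _ _; apply. Qed.

(** The fibre has two points; z and sigma z are distinct, since sigma z = z
    would give J z = 0 by [Jac_anti]. *)
Lemma reg_fibre z w : U z -> Jac phi z != 0 -> U w -> phi w = phi z ->
  w = z \/ w = sigma z.
Proof.
move=> Uz Jz Uw pw; case: phi_proper => _ _ h _.
have c2 := h _ (phiV Uz) (reg_value Uz Jz).
apply: (card_II2_pair c2); [by []| | |by []].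
  by split; [exact: sigmaU|exact: phi_sigma].
move=> zs; have := Jac_anti Uz; rewrite -zs => /eqP; rewrite -addr_eq0 -mulr2n.
by rewrite mulrn_eq0 (negbTE Jz).
Qed.

Lemma phi_surj v : V v -> exists2 z, U z & phi z = v.
Proof.
move=> Vv; have [[z [Uz _] <-]|ncr] := pselect (crit_values U phi v).
  by exists z.
case: phi_proper => _ _ /(_ v Vv ncr) /card_II2_neq0 [z [Uz pz]] _.
by exists z.
Qed.

Section reflection.
Variables (a : Cd) (b : C).
Hypothesis JphiE : forall z, U z -> Jac phi z = \sum_(j < d) a ord0 j * z ord0 j - b.

(** The linear part of the affine function J. *)
Definition lform (w : Cd) : C := \sum_(j < d) a ord0 j * w ord0 j.

Lemma lformD w w' : lform (w + w') = lform w + lform w'.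
Proof. by rewrite /lform -big_split; apply: eq_bigr => j _; rewrite mxE mulrDr. Qed.

Lemma lformZ c w : lform (c *: w) = c * lform w.
Proof. by rewrite /lform mulr_sumr; apply: eq_bigr => j _; rewrite mxE mulrCA. Qed.

Lemma lformB w w' : lform (w - w') = lform w - lform w'.
Proof. by rewrite -scaleN1r lformD lformZ mulN1r. Qed.

Lemma Jac_shift z w : U z -> U (z + w) -> Jac phi (z + w) = Jac phi z + lform w.
Proof.
move=> Uz Uzw; rewrite (JphiE Uz) (JphiE Uzw) -/(lform _) -/(lform _) lformD.
by rewrite addrAC.
Qed.

(** Near z0 the points z0 + w with lform w = 0 are critical, hence fixed by
    sigma, so A is the identity on a hyperplane.  It is an involution other
    than the identity, hence a reflection. *)
Lemma reflection z0 : U z0 -> Jac phi z0 = 0 -> exists v, lform v = 1 /\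
  forall w, A w = w - (2 * lform w) *: v.
Proof.
move=> U0 J0; have [s0 _] := crit_fix U0 J0.
have sA w : sigma (z0 + w) = z0 + A w.
  by rewrite sigmaE linearD addrAC -sigmaE s0.
have AA w : A (A w) = w.
  have := sigmaK (z0 + w); rewrite !sA => /eqP.
  by rewrite (inj_eq (addrI z0)) => /eqP.
have Afix w : lform w = 0 -> A w = w.
  move=> lw; have [e e0 he] := U_ball U0.
  pose s : C := toC (e / (2 * (nrm w + 1))).
  have n1 : 0 < nrm w + 1 by rewrite ltr_wpDl ?nrm_ge0.
  have s0' : s != 0 by rewrite toC_eq0 gt_eqF // divr_gt0 // mulr_gt0.
  have Us : U (z0 + s *: w).
    apply: he; rewrite addrAC subrr add0r nrmZ nrm_toC ger0_norm; last first.
      by rewrite divr_ge0 // ltW // mulr_gt0.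
    rewrite mulrAC ltr_pdivrMr ?mulr_gt0 // ltr_pM2l //.
    by have := nrm_ge0 w; lra.
  have Js : Jac phi (z0 + s *: w) = 0.
    by rewrite Jac_shift // J0 lformZ lw mulr0 addr0.
  have [+ _] := crit_fix Us Js; rewrite sA linearZ => /eqP.
  rewrite (inj_eq (addrI z0)) => /eqP /(congr1 ( *:%R s^-1)).
  by rewrite !scalerA mulVf // !scale1r.
(* If lform vanished identically, A would be the identity. *)
have [w0 lw0] : exists w0, lform w0 = 1.
  have [j aj|a0] := pickP (fun j => a ord0 j != 0).
    exists ((a ord0 j)^-1 *: delta_mx 0 j); rewrite lformZ /lform (bigD1 j) //=.
    rewrite mxE !eqxx mulr1 big1 ?addr0 ?mulVf //.
    by move=> k /negbTE kj; rewrite mxE kj andbF mulr0.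
  case: linear_part_neq_id => w; apply: Afix; rewrite /lform big1 // => j _.
  by move/negbFE: (a0 j) => /eqP ->; rewrite mul0r.
pose v := 2^-1 *: (w0 - A w0).
have two0 : (2 : C) != 0 by rewrite pnatr_eq0.
have Aw0 : A w0 = w0 - 2 *: v.
  by rewrite scalerA mulfV // scale1r opprB addrC subrK.
have AD x y : A (x + y) = A x + A y by exact: raddfD.
have AZ (c : C) x : A (c *: x) = c *: A x by exact: linearZ.
have Aw w : A w = w - (2 * lform w) *: v.
  have {1}-> : w = (w - lform w *: w0) + lform w *: w0 by rewrite subrK.
  rewrite AD (Afix (w - _)); last by rewrite lformB lformZ lw0 mulr1 subrr.
  by rewrite AZ Aw0 scalerBr scalerA addrA subrK (mulrC 2).
have Av : A v = - v.
  have AB x y : A (x - y) = A x - A y by exact: raddfB.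
  by rewrite /v AZ AB AA -scalerN opprB.
have lv : lform v = 1.
  have v0 : v != 0.
    by apply/eqP => v0; apply: linear_part_neq_id => w; rewrite Aw v0 scaler0 subr0.
  have : (2 * (1 - lform v)) *: v = 0.
    have := Aw v; rewrite Av mulrBr mulr1 scalerBl => /(congr1 (+%R v)).
    by rewrite subrr addrA -{1 2}[v]scale1r -scalerDl -(natrD C 1 1).
  move/eqP; rewrite scaler_eq0 (negbTE v0) orbF mulf_eq0 (negbTE two0) /=.
  by rewrite subr_eq0 eq_sym => /eqP.
by exists v; split.
Qed.

Lemma sigma_shift v z0 dl t : U z0 -> Jac phi z0 = 0 -> lform v = 1 ->
  (forall w, A w = w - (2 * lform w) *: v) -> lform dl = 0 ->
  sigma (z0 + dl + t *: v) = z0 + dl - t *: v.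
Proof.
move=> U0 J0 lv hA ldl; have [s0 _] := crit_fix U0 J0.
have -> : sigma (z0 + dl + t *: v) = sigma z0 + A (dl + t *: v).
  by rewrite !sigmaE -addrA (raddfD A) addrAC.
rewrite s0 hA lformD lformZ ldl lv mulr1 add0r -[RHS]addrA.
congr (_ + _); rewrite -addrA; congr (_ + _).
by rewrite mulr_natl mulr2n scalerDl opprD addrA subrr add0r.
Qed.

End reflection.
End geometry.

(** * Expansions at a critical point *)

(** Two triangular factorizations of the same block matrix. *)
Lemma det_rank1 (F : comNzRingType) n (u : 'cV[F]_n) (w : 'rV[F]_n) :
  \det (1%:M + u *m w) = 1 + (w *m u) 0 0.
Proof.
pose X := block_mx 1%:M u (- w) (1%:M : 'M[F]_1).
have E1 : \det X = 1 + (w *m u) 0 0.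
  have -> : X = block_mx 1%:M 0 (- w) 1%:M *m block_mx 1%:M u 0 (1%:M + w *m u).
    rewrite mulmx_block !mul1mx !mulmx1 !mul0mx ?mulmx0 !addr0 mulNmx.
    by rewrite addrCA addNr addr0.
  rewrite det_mulmx det_lblock det_ublock !det1 !mul1r.
  by rewrite [_ + w *m u]mx11_scalar det_scalar expr1 !mxE eqxx.
have E2 : \det X = \det (1%:M + u *m w).
  have -> : X = block_mx 1%:M u 0 1%:M *m block_mx (1%:M + u *m w) 0 (- w) 1%:M.
    rewrite mulmx_block !mul1mx !mulmx1 ?mul0mx ?mulmx0 !add0r mulmxN.
    by rewrite addrK.
  by rewrite det_mulmx det_lblock det_ublock !det1 !mul1r mulr1.
by rewrite -E2 E1.
Qed.

Section critical.
Context {R : realType} {d : nat}.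
Local Notation C := (Cplx R).
Local Notation Cd := 'rV[C]_d.

Lemma cvg_dnbhs0 (f : C -> C) (l : C) :
  (forall e : R, 0 < e -> exists2 dl : R, 0 < dl & forall t : C, t != 0 -> nrm t < dl ->
    nrm (f t - l) <= e) -> f @ 0^' --> l.
Proof.
move=> h; apply/cvgrPdist_le => _ /gt0_toC[e e0 ->]; have [dl dl0 hd] := h e e0.
rewrite near_withinE nearE; apply/nbhs_nrmP; exists dl => // t; rewrite subr0 => ht t0.
by rewrite distrC nrmE toC_le; exact: hd.
Qed.

Lemma coord_diff (phi : Cd -> Cd) z j : differentiable phi z ->
  differentiable (fun w => phi w ord0 j) z /\
  forall w, 'd (fun w => phi w ord0 j) z w = 'd phi z w ord0 j.
Proof.
move=> dphi.
have lin : linear (fun w : Cd => w ord0 j : C) by move=> k x y; rewrite !mxE.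
pose lj := GRing.isLinear.Build C Cd C _ _ lin.
pose pj : {linear Cd -> C} := HB.pack (fun w : Cd => w ord0 j : C) lj.
have [K K0 hK] := linear_bounded ('d phi z).
have [D dE] : differentiable (fun w => phi w ord0 j) z /\
   'd (fun w => phi w ord0 j) z = pj \o 'd phi z :> (Cd -> C).
  apply: (@nrm_differentiable _ _ _ (fun w => phi w ord0 j) z
     [the {linear Cd -> C} of pj \o 'd phi z] K).
    by move=> w /=; apply: le_trans (nrm_coord _ _ _) _; exact: hK.
  move=> e e0; have [dl dl0 hd] := differentiable_nrm dphi e0; exists dl => // y hy /=.
  apply: le_trans (hd y hy); apply: le_trans (nrm_coord _ ord0 j).
  by rewrite !mxE.
by split => // w; rewrite dE.
Qed.

(** Here x is the displacement along the critical hyperplane and y the size of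
    the transverse coordinate t; then x + y^2 is comparable to the size of
    [quad], and x + y is small. *)
Lemma quad_bound (A B D x y : R) : 0 <= A -> 0 <= B -> 0 <= D -> 0 <= x -> 0 <= y ->
  A * y ^+ 3 + B * x * y ^+ 2 + D * x ^+ 2 <= (A + B + D) * ((x + y) * (x + y ^+ 2)).
Proof.
move=> A0 B0 D0 x0 y0; rewrite -subr_ge0.
have -> : (A + B + D) * ((x + y) * (x + y ^+ 2)) - (A * y ^+ 3 + B * x * y ^+ 2 + D *
  x ^+ 2) =
  A * (x ^+ 2 + x * y ^+ 2 + x * y) + B * (x ^+ 2 + x * y + y ^+ 3) +
  D * (x * y ^+ 2 + x * y + y ^+ 3) by ring.
by rewrite !addr_ge0 // mulr_ge0 // !addr_ge0 // ?mulr_ge0 // ?exprn_ge0.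
Qed.

End critical.

Ltac nonneg := repeat first [done | exact: nrm_ge0 | exact: ltW
  | rewrite invr_ge0 | apply: mulr_ge0 | apply: exprn_ge0].

Lemma lin_comb_eq (F : comNzRingType) (k x y c p q : F) :
  k * x + y + c * (k * p + q) = k * (x + c * p) + (y + c * q).
Proof. by ring. Qed.

Section critical_point.
Context {R : realType} {d : nat}.
Local Notation C := (Cplx R).
Local Notation Cd := 'rV[C]_d.
Variables (U : set Cd) (z0 : Cd) (a v : Cd).
Hypothesis oU : open U.
Hypothesis Uz0 : U z0.
Local Notation lam := (lform a).
Hypothesis lv : lam v = 1.

(** In coordinates z = z0 + delta + t v with lform delta = 0, this is delta +
    t^2 v, the variable through which even functions of t factor. *)
Definition quad (z : Cd) : Cd :=
  (z - z0 - lam (z - z0) *: v) + (lam (z - z0)) ^+ 2 *: v.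

Local Notation tt z := (lam (z - z0)).
Local Notation del z := (z - z0 - lam (z - z0) *: v).

Lemma zE z : z0 + del z + tt z *: v = z.
Proof. by rewrite -addrA subrK subrKC. Qed.

Lemma lam_del z : lam (del z) = 0.
Proof. by rewrite (lformB _ (z - z0)) lformZ lv mulr1 subrr. Qed.

Lemma lam_quad z : lam (quad z) = tt z ^+ 2.
Proof. by rewrite /quad lformD lam_del lformZ lv mulr1 add0r. Qed.

Lemma del_quad z : del z = quad z - lam (quad z) *: v.
Proof. by rewrite lam_quad /quad addrK. Qed.

Lemma lam_bounded : exists2 K : R, 0 < K &
  (forall w, nrm (lam w) <= K * nrm w) /\
  (forall w, nrm (w - lam w *: v) <= K * nrm w).
Proof.
pose Ka := \sum_(j < d) nrm (a ord0 j).
have Ka0 : 0 <= Ka by apply: sumr_ge0 => j _; exact: nrm_ge0.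
have h w : nrm (lam w) <= Ka * nrm w.
  rewrite /lform mulr_suml; apply: le_trans (nrm_sum _ _ _) _; apply: ler_sum => j _.
  by rewrite nrmM ler_wpM2l ?nrm_ge0 // nrm_coord.
have nv := nrm_ge0 v.
have P : 0 <= Ka * nrm v by rewrite mulr_ge0.
exists (1 + Ka + Ka * nrm v); first by rewrite -addrA ltr_pwDl // addr_ge0.
split => w; have nw := nrm_ge0 w.
  apply: le_trans (h w) _; rewrite ler_wpM2r //; lra.
apply: le_trans (nrmB _ _) _; rewrite nrmZ.
have := ler_wpM2r nv (h w); have : 0 <= Ka * nrm w by rewrite mulr_ge0.
rewrite !mulrDl mul1r [Ka * nrm v * nrm w]mulrAC; lra.
Qed.

(** Both delta and t^2 depend linearly on [quad z], hence are O(quad z), while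
    delta and t tend to 0 with z - z0. *)
Lemma critical_small (S rho r e : R) : 0 <= S -> 0 < rho -> 0 < r -> 0 < e ->
  exists2 eta : R, 0 < eta & forall z, nrm (z - z0) < eta ->
    [/\ nrm (del z) <= rho / 2, nrm (tt z) <= r / 2 &
      S * ((nrm (del z) + nrm (tt z)) * (nrm (del z) + nrm (tt z) ^+ 2))
       <= e * nrm (quad z)].
Proof.
move=> S0 rho0 r0 e0; have [K K0 [h1 h2]] := lam_bounded.
pose k := S * 4 * K ^+ 2 + 1.
have k0 : 0 < k by rewrite /k ltr_wpDl // mulr_ge0 ?sqr_ge0 // mulr_ge0.
pose eta := Num.min (Num.min (rho / 2 / K) (r / 2 / K)) (e / k).
exists eta; first by rewrite !lt_min !divr_gt0.
move=> z; rewrite !lt_min => /andP[/andP[z1 z2] z3].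
have d1 : nrm (del z) <= K * nrm (z - z0) by exact: h2.
have t1 : nrm (tt z) <= K * nrm (z - z0) by exact: h1.
rewrite ltr_pdivlMr // mulrC in z1; rewrite ltr_pdivlMr // mulrC in z2.
rewrite ltr_pdivlMr // mulrC in z3.
split.
- exact: le_trans d1 (ltW z1).
- exact: le_trans t1 (ltW z2).
have d2 : nrm (del z) <= K * nrm (quad z) by rewrite del_quad; exact: h2.
have t2 : nrm (tt z) ^+ 2 <= K * nrm (quad z).
  by rewrite -nrmX -lam_quad; exact: h1.
set x := nrm (del z) in d1 d2 *; set y := nrm (tt z) in t1 t2 *.
set q := nrm (quad z) in d2 t2 *; set w := nrm (z - z0) in d1 t1 z1 z2 z3 *.
have x0 : 0 <= x by exact: nrm_ge0.
have y0 : 0 <= y by exact: nrm_ge0.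
have q0 : 0 <= q by exact: nrm_ge0.
have w0 : 0 <= w by exact: nrm_ge0.
have P : (x + y) * (x + y ^+ 2) <= (2 * (K * w)) * (2 * (K * q)).
  by apply: ler_pM; rewrite ?addr_ge0 ?exprn_ge0 //; rewrite mulr_natl mulr2n; apply:
    lerD.
apply: le_trans (ler_wpM2l S0 P) _.
have -> : S * (2 * (K * w) * (2 * (K * q))) = S * 4 * K ^+ 2 * w * q by ring.
by rewrite ler_wpM2r // ltW //; apply: le_lt_trans z3; rewrite /k mulrDl mul1r lerDl.
Qed.

Lemma local_bound (W : normedModType C) (f : Cd -> W) :
  (forall z, U z -> differentiable f z) ->
  exists rho M : R, [/\ 0 < rho, (forall z, nrm (z - z0) < 4 * rho -> U z) &
    forall z, nrm (z - z0) < 4 * rho -> nrm (f z) <= M].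
Proof.
move=> fd; have [e e0 he] := U_ball oU Uz0.
have /continuous_nrmP /(_ 1 ltr01) [d1 d10 hd] := differentiable_continuous (fd _ Uz0).
pose rho := Num.min e d1 / 4.
have r4 : 4 * rho = Num.min e d1 by rewrite /rho mulrC divfK.
exists rho, (nrm (f z0) + 1); split; rewrite ?r4.
- by rewrite divr_gt0 // lt_min e0.
- by move=> z; rewrite lt_min => /andP[/he].
move=> z; rewrite lt_min => /andP[_ /hd h].
have -> : f z = f z0 + (f z - f z0) by rewrite subrKC.
by apply: le_trans (nrmD _ _) _; rewrite lerD2l ltW.
Qed.

Lemma radius_ex (rho : R) : 0 < rho -> exists2 r : R, 0 < r & r * nrm v <= rho / 2.
Proof.
move=> rho0; have n1 : 0 < nrm v + 1 by rewrite ltr_wpDl ?nrm_ge0.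
exists (rho / 2 / (nrm v + 1)); first by rewrite !divr_gt0.
by rewrite mulrAC ler_pdivrMr // ler_pM2l ?divr_gt0 // lerDl.
Qed.

Section odd.
Variable g : Cd -> C.
Hypothesis gd : forall z, U z -> differentiable g z.
Hypothesis g_odd : forall dl t, lam dl = 0 -> U (z0 + dl + t *: v) ->
  g (z0 + dl - t *: v) = - g (z0 + dl + t *: v).

(** By [odd_expansion] the quotient g / t is an affine function of [quad z] up
    to o(quad z).  On the hyperplane t = 0 its value is the derivative of g
    along v. *)
Lemma odd_quotient : exists m : {linear Cd -> C}, forall e : R, 0 < e ->
  exists2 eta : R, 0 < eta & forall z, U z -> nrm (z - z0) < eta ->
    nrm ((if tt z == 0 then 'd g z v else g z / tt z) - 'd g z0 v - m (quad z))
      <= e * nrm (quad z).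
Proof.
have [rho [M [rho0 inU gM]]] := local_bound gd.
have gd' z : nrm (z - z0) < 4 * rho -> differentiable g z by move=> /inU; exact: gd.
have [r r0 rv] := radius_ex rho0.
have rv1 : r * nrm v <= rho by apply: le_trans rv _; lra.
pose L := lcoef1_diff g z0 r v.
pose c3 := lcoef g r 3 v z0.
have M0 : 0 <= M by apply: bound_ge0 rho0 gM.
have lin : linear (fun w : Cd => L (w - lam w *: v) + c3 * lam w : C).
  move=> k x y.
  rewrite lformD lformZ scalerDl -scalerA opprD addrACA -scalerBr.
  rewrite /L (lcoef1_diffD rho0 gd' gM) // (lcoef1_diffZ rho0 gd' gM) //.
  exact: lin_comb_eq.
pose lm := GRing.isLinear.Build C Cd C _ _ lin.
pose m : {linear Cd -> C} := HB.pack (fun w : Cd => L (w - lam w *: v) + c3 * lam w :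
  C) lm.
exists m => e e0.
have mE z : m (quad z) = L (del z) + c3 * tt z ^+ 2.
  by rewrite [X in L X]del_quad -lam_quad.
pose A := 4 * M / r ^+ 4; pose B := 8 * M / rho / r ^+ 3.
pose D := 8 * M / rho ^+ 2 / r.
have A0 : 0 <= A by rewrite /A; nonneg.
have B0 : 0 <= B by rewrite /B; nonneg.
have D0 : 0 <= D by rewrite /D; nonneg.
have ABD0 : 0 <= A + B + D by rewrite !addr_ge0.
have [eta eta0 heta] := critical_small ABD0 rho0 r0 e0.
exists eta => // z Uz /heta[hd ht hq]; apply: le_trans hq.
apply: le_trans (quad_bound A0 B0 D0 (nrm_ge0 _) (nrm_ge0 _)).
have center : nrm (z0 - z0) <= 2 * rho by rewrite subrr nrm0 mulr_ge0 // ltW.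
have c1 : lcoef g r 1 v z0 = 'd g z0 v by exact: (lcoef1 rho0 gd' gM).
rewrite mE; case: eqP => [t0|/eqP t0].
  have zd : z = z0 + del z by rewrite -[LHS]zE t0 scale0r addr0.
  have in2 : nrm (z0 + del z - z0) <= 2 * rho.
    by rewrite addrAC subrr add0r; apply: le_trans hd _; lra.
  have c1z : lcoef g r 1 v (z0 + del z) = 'd g (z0 + del z) v.
    exact: (lcoef1 rho0 gd' gM).
  have := lcoef1_second rho0 gd' gM r0 rv hd.
  rewrite c1z c1 -zd t0 expr0n mulr0 addr0 nrm0 !expr0n !mulr0 !add0r => h.
  apply: le_trans h _; rewrite le_eqVlt; apply/orP; left; apply/eqP.
  by rewrite /D expr_div_n; ring.
have Uz' : U (z0 + del z + tt z *: v) by rewrite zE.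
have := odd_expansion rho0 gd' gM r0 rv hd ht (g_odd (lam_del z) Uz').
rewrite zE c1 -/(L _) -/c3.
move: (L (del z)) ('d g z0 v) (g z) => Ld g0 gz; move: t0 {Uz' mE}.
move: (tt z) (nrm (del z)) => t x t0 h.
have tp : 0 < nrm t by rewrite nrm_gt0.
rewrite -(@ler_pM2r _ (nrm t)) // -nrmM.
have -> : (gz / t - g0 - (Ld + c3 * t ^+ 2)) * t = gz - (g0 + Ld + c3 * t ^+ 2) * t.
  by field.
apply: le_trans h _; rewrite le_eqVlt; apply/orP; left; apply/eqP.
by rewrite /A /B /D; field; rewrite !gt_eqF.
Qed.

End odd.

Section even.
Variable phi : Cd -> Cd.
Hypothesis phid : forall z, U z -> differentiable phi z.
Hypothesis phi_even : forall dl t, lam dl = 0 -> U (z0 + dl + t *: v) ->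
  phi (z0 + dl - t *: v) = phi (z0 + dl + t *: v).
Hypothesis phi_jac : forall t, U (z0 + t *: v) -> Jac phi (z0 + t *: v) = t.

Let pc j z := phi z ord0 j.

(** The matrix B is the limit as t tends to 0 of the matrices Bt t, which act
    as the Jacobian matrix at z0 + t v on the hyperplane and as that matrix
    divided by 2t on v.  The Jacobian at z0 + t v is t, so Bt t has
    determinant 1/2, and so has B. *)
Lemma even_quotient : exists2 B : 'M[C]_d, B \in unitmx & forall e : R, 0 < e ->
  exists2 eta : R, 0 < eta & forall z, U z -> nrm (z - z0) < eta ->
    nrm (phi z - phi z0 - quad z *m B) <= e * nrm (quad z).
Proof.
have [rho [M [rho0 inU gM]]] := local_bound phid.
have pd j z : nrm (z - z0) < 4 * rho -> differentiable (pc j) z.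
  by move=> /inU Uz; exact: (coord_diff j (phid Uz)).1.
have pdE j z w : nrm (z - z0) < 4 * rho -> 'd (pc j) z w = 'd phi z w ord0 j.
  by move=> /inU Uz; exact: (coord_diff j (phid Uz)).2.
have pM j z : nrm (z - z0) < 4 * rho -> nrm (pc j z) <= M.
  by move=> /gM; apply: le_trans; exact: nrm_coord.
have [r r0 rv] := radius_ex rho0.
have center4 : nrm (z0 - z0) < 4 * rho by rewrite subrr nrm0 mulr_gt0.
have M0 : 0 <= M by apply: le_trans (nrm_ge0 _) (gM _ center4).
pose c2 : Cd := \row_j lcoef (pc j) r 2 v z0.
have [J JD] : {J : Cd -> 'M[C]_d | J = jacobian phi} by exists (jacobian phi).
have JE z w : U z -> w *m J z = 'd phi z w.
  by move=> Uz; rewrite JD -(deriveEjacobian w (phid Uz)) (deriveE w (phid Uz)).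
pose B := J z0 + a^T *m (c2 - v *m J z0).
have waT (w : Cd) : w *m a^T = (lam w)%:M.
  rewrite [LHS]mx11_scalar; congr _%:M; rewrite mxE; apply: eq_bigr => j _.
  by rewrite mxE mulrC.
have waT2 (w x : Cd) : w *m (a^T *m x) = lam w *: x.
  by rewrite mulmxA waT mul_scalar_mx.
have QB z : quad z *m B = 'd phi z0 (del z) + tt z ^+ 2 *: c2.
  rewrite /B mulmxDr waT2 lam_quad scalerBr -(JE z0) // del_quad lam_quad.
  by rewrite mulmxBl -scalemxAl addrA addrAC.
have Bunit : B \in unitmx.
  pose Bt (t : C) := J (z0 + t *: v) + a^T *m ((t + t)^-1 *: (v *m J (z0 + t *: v)) -
    v *m J (z0 + t *: v)).
  have vsmall (e : R) : 0 < e -> exists2 eta : R, 0 < eta & forall t : C, nrm t < eta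
    -> nrm (t *: v) < e.
    move=> e0; have n1 : 0 < nrm v + 1 by rewrite ltr_wpDl ?nrm_ge0.
    exists (e / (nrm v + 1)); first by rewrite divr_gt0.
    move=> t; rewrite ltr_pdivlMr // nrmZ; apply: le_lt_trans.
    by rewrite ler_wpM2l ?nrm_ge0 // lerDl.
  have [e1 e10 he1] := U_ball oU Uz0.
  have [n1 n10 hn1] := vsmall _ e10.
  have Ut t : nrm t < n1 -> U (z0 + t *: v).
    by move=> /hn1 h; apply: he1; rewrite addrAC subrr add0r.
  have detBt t : t != 0 -> nrm t < n1 -> \det (Bt t) = 2^-1.
    move=> t0 ht; have -> : Bt t = (1%:M + a^T *m (((t + t)^-1 - 1) *: v)) *m J (z0 +
      t *: v).
      rewrite /Bt mulmxDl mul1mx; congr (_ + _).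
      by rewrite -mulmxA -scalemxAl scalerBl scale1r.
    have -> : \det ((1%:M + a^T *m (((t + t)^-1 - 1) *: v)) *m J (z0 + t *: v)) =
      \det (1%:M + a^T *m (((t + t)^-1 - 1) *: v)) * t.
      by rewrite det_mulmx JD; congr (_ * _); exact: (phi_jac (Ut _ ht)).
    rewrite det_rank1 -scalemxAl waT lv !mxE eqxx mulr1n mulr1 subrKC.
    have -> : t + t = 2 * t by rewrite mulr_natl mulr2n.
    by rewrite invfM mulfVK.
  have c1 i j : (fun t : C => J (z0 + t *: v) i j) @ 0^' --> J z0 i j.
    apply: cvg_dnbhs0 => e e0.
    pose k := 8 * M / rho * (nrm (delta_mx 0 i : Cd) / rho) + 1.
    have k0 : 0 < k.
      by rewrite /k ltr_wpDl //; nonneg.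
    have m0 : 0 < Num.min (rho / 2) (e / k) by rewrite lt_min !divr_gt0.
    have [n2 n20 hn2] := vsmall _ m0.
    exists n2 => // t _ /hn2; rewrite lt_min => /andP[h1 h2].
    have sh : z0 + t *: v - z0 = t *: v by rewrite addrAC subrr add0r.
    have in1 : nrm (z0 + t *: v - z0) < 4 * rho by rewrite sh; apply: lt_trans h1 _;
      lra.
    have Jij z : nrm (z - z0) < 4 * rho -> J z i j = 'd (pc j) z (delta_mx 0 i).
      by move=> hz; rewrite pdE // -JE; [rewrite -rowE [RHS]mxE|exact: inU].
    rewrite (Jij _ in1) (Jij _ center4).
    have a1 : nrm (z0 - z0) <= rho by rewrite subrr nrm0 ltW.
    have a2 : nrm (z0 + t *: v - z0) <= rho by rewrite sh; apply: le_trans (ltW h1)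
      _; lra.
    have a3 : nrm (z0 + t *: v - z0) <= rho / 2 by rewrite sh ltW.
    apply: le_trans (deriv_lip rho0 (pd j) (pM j) (delta_mx 0 i) a1 a2 a3) _.
    rewrite sh; rewrite ltr_pdivlMr // in h2; apply: le_trans (ltW h2).
    rewrite /k mulrDr mulr1; apply: le_trans (_ : nrm (t *: v) * (8 * M / rho * (nrm
      (delta_mx 0 i : Cd) / rho)) <= _).
      by rewrite le_eqVlt; apply/orP; left; apply/eqP; ring.
    by rewrite lerDl nrm_ge0.
  have c1v j : (fun t : C => (v *m J (z0 + t *: v)) ord0 j) @ 0^' --> (v *m J z0)
    ord0 j.
    under eq_cvg do rewrite mxE.
    rewrite mxE; apply: (@cvg_big C _ +%R 0 xpredT) => //.
      by move=> [x y]; apply: cvgD; [exact: cvg_fst|exact: cvg_snd].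
    by move=> i _; apply: cvgM; [exact: cvg_cst|exact: c1].
  have c2v j : (fun t : C => (t + t)^-1 * (v *m J (z0 + t *: v)) ord0 j) @ 0^' --> c2
    ord0 j.
    apply: cvg_dnbhs0 => e e0.
    pose k := 10 * M / r ^+ 3 + 1.
    have k0 : 0 < k by rewrite /k ltr_wpDl //; nonneg.
    have [n2 n20 hn2] := vsmall _ rho0.
    have [n3 n30 hn3] := vsmall _ e10.
    exists (Num.min (Num.min (r / 4) (e / k)) n2); first by rewrite !lt_min !divr_gt0.
    move=> t t0; rewrite !lt_min => /andP[/andP[t1 t2] t3].
    have sh s : z0 + s *: v - z0 = s *: v by rewrite addrAC subrr add0r.
    have in1 : nrm (z0 + t *: v - z0) < 4 * rho.
      by rewrite sh; apply: lt_trans (hn2 _ t3) _; lra.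
    rewrite JE; last exact: inU.
    rewrite -pdE // mxE.
    have ev s : nrm s <= r / 2 -> pc j (z0 - s *: v) = pc j (z0 + s *: v).
      move=> hs; rewrite /pc; have := @phi_even 0 s; rewrite addr0 => -> //.
        by rewrite -[0](scale0r 0) lformZ mul0r.
      apply: inU; rewrite sh nrmZ; apply: le_lt_trans (ler_wpM2r (nrm_ge0 v) hs) _.
      rewrite mulrAC; move: rv; lra.
    apply: le_trans (even_deriv rho0 (pd j) (pM j) r0 rv t0 (ltW t1) ev) _.
    rewrite ltr_pdivlMr // in t2; apply: le_trans (ltW t2).
    rewrite /k mulrDr mulr1; apply: le_trans (_ : nrm t * (10 * M / r ^+ 3) <= _).
      by rewrite le_eqVlt; apply/orP; left; apply/eqP; ring.
    by rewrite lerDl nrm_ge0.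
  have cB i j : (fun t => Bt t i j) @ 0^' --> B i j.
    have E t : Bt t i j = J (z0 + t *: v) i j +
      a ord0 i * ((t + t)^-1 * (v *m J (z0 + t *: v)) ord0 j - (v *m J (z0 + t *: v))
        ord0 j).
      by rewrite /Bt !mxE big_ord1 !mxE.
    under eq_cvg do rewrite E.
    have -> : B i j = J z0 i j + a ord0 i * (c2 ord0 j - (v *m J z0) ord0 j).
      by rewrite /B !mxE big_ord1 !mxE.
    apply: cvgD; first exact: c1.
    by apply: cvgM; [exact: cvg_cst|apply: cvgB; [exact: c2v|exact: c1v]].
  have cdet : \det (Bt t) @[t --> 0^'] --> \det B by exact: cvg_det.
  have cdet' : \det (Bt t) @[t --> (0 : C)^'] --> (2^-1 : C).
    apply: cvg_dnbhs0 => e e0; exists n1 => // t t0 ht.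
    by rewrite detBt // subrr nrm0 ltW.
  have -> : B \in unitmx = (\det B != 0) by rewrite unitmxE unitfE.
  have -> : \det B = 2^-1 by exact: cvg_unique cdet cdet'.
  by rewrite invr_eq0 pnatr_eq0.
exists B => // e e0.
pose A := 4 * M / r ^+ 3; pose K2 := 8 * M / rho / r ^+ 2.
pose D := 4 * M / rho ^+ 2.
have A0 : 0 <= A by rewrite /A; nonneg.
have B0 : 0 <= K2 by rewrite /K2; nonneg.
have D0 : 0 <= D by rewrite /D; nonneg.
have ABD0 : 0 <= A + K2 + D by rewrite !addr_ge0.
have [eta eta0 heta] := critical_small ABD0 rho0 r0 e0.
exists eta => // z Uz /heta[hd ht hq]; apply: le_trans hq.
apply: le_trans (quad_bound A0 B0 D0 (nrm_ge0 _) (nrm_ge0 _)).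
apply: nrm_rV_le => [|j].
  by rewrite !addr_ge0 //; nonneg.
have Uz' : U (z0 + del z + tt z *: v) by rewrite zE.
have ev : pc j (z0 + del z - tt z *: v) = pc j (z0 + del z + tt z *: v).
  by rewrite /pc phi_even // lam_del.
have := even_expansion rho0 (pd j) (pM j) r0 rv hd ht ev.
rewrite zE pdE // => h; rewrite QB !mxE.
have -> : phi z ord0 j - phi z0 ord0 j - ('d phi z0 (del z) ord0 j + tt z ^+ 2 *
  lcoef (pc j) r 2 v z0) =
  pc j z - pc j z0 - 'd phi z0 (del z) ord0 j - lcoef (pc j) r 2 v z0 * tt z ^+ 2.
  by rewrite opprD addrA [lcoef _ _ _ _ _ * _]mulrC.
apply: le_trans h _; rewrite le_eqVlt; apply/orP; left; apply/eqP.
by rewrite /A /K2 /D !expr_div_n; ring.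
Qed.

End even.
End critical_point.

(** * Descent of anti-invariant functions *)

Section descent_of_odd_functions.
Context {R : realType} {d : nat}.
Local Notation C := (Cplx R).
Local Notation Cd := 'rV[C]_d.
Variables (sigma phi : Cd -> Cd) (U V : set Cd) (A : {linear Cd -> Cd}) (B0 : Cd).
Hypothesis sigmaE : forall z, sigma z = A z + B0.
Hypothesis sigmaK : involutive sigma.
Hypothesis oU : open U.
Hypothesis oV : open V.
Hypothesis sigmaU : invariant_set sigma U.
Hypothesis phi_sigma : forall z, U z -> phi (sigma z) = phi z.
Hypothesis phi_proper : m_proper 2 U V phi.
Hypothesis Jsigma : forall z, Jac sigma z = -1.
Variables (a : Cd) (b : C).
Hypothesis JphiE : forall z, U z -> Jac phi z = \sum_(j < d) a ord0 j * z ord0 j - b.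

Let phid z : U z -> differentiable phi z.
Proof. exact: (phi_diff phi_proper). Qed.

Lemma fibre_pair z w : U z -> U w -> phi w = phi z -> w = z \/ w = sigma z.
Proof.
move=> Uz Uw pw; have [J0|J0] := eqVneq (Jac phi z) 0.
  by left; have [_ h] := crit_fix sigmaU phi_sigma phi_proper Uz J0; exact: h.
exact: (reg_fibre sigmaE oU sigmaU phi_sigma phi_proper Jsigma).
Qed.

(** By [proper_near] a preimage of v is near z0 or near sigma z0; in the
    second case its image by sigma is a preimage near z0. *)
Lemma preimages_near z0 : U z0 -> forall e : R, 0 < e -> exists2 dl : R, 0 < dl &
  forall v, nrm (v - phi z0) < dl -> exists z, [/\ U z, nrm (z - z0) < e & phi z = v].
Proof.
move=> Uz0 e e0.
have V0 : V (phi z0) by exact: (phiV phi_proper).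
have /continuous_nrmP /(_ _ e0) [d1 d10 hd1] := differentiable_continuous (sigma_diff
  sigmaE (sigma z0)).
rewrite sigmaK in hd1.
have m0 : 0 < Num.min e d1 by rewrite lt_min e0.
have [pp hol _ _] := phi_proper.
have [dl dl0 hdl] := proper_near pp hol oV V0 m0.
have [d2 d20 hd2] := U_ball oV V0.
exists (Num.min dl d2); first by rewrite lt_min dl0.
move=> x; rewrite lt_min => /andP[x1 x2].
have [z Uz zx] := phi_surj phi_proper (hd2 _ x2).
have [z1 [Uz1 pz1]] : exists z1, [/\ U z1, phi z1 = phi z0 & nrm (z - z1) < Num.min e
  d1].
  by apply: hdl => //; rewrite zx.
rewrite lt_min => /andP[h1 h2]; have [E|E] := fibre_pair Uz0 Uz1 pz1.
  by exists z; split => //; rewrite -E.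
exists (sigma z); split; first exact: sigmaU.
- by apply: hd1; rewrite -E.
- by rewrite phi_sigma.
Qed.

(** The function f is g / J read on the fibres, with the derivative of g along
    v in place of the quotient where J vanishes. *)
Lemma odd_descends (g : Cd -> C) : holomorphic_on U g ->
  (forall z, U z -> g (sigma z) = - g z) ->
  exists2 f, Hol V f & forall z, U z -> Jac phi z * f (phi z) = g z.
Proof.
move=> gd g_odd.
(* The vector of the reflection is determined by A, so the same v serves at
    all critical points. *)
have [v hv] : exists v, forall z0, U z0 -> Jac phi z0 = 0 ->
    lform a v = 1 /\ forall w, A w = w - (2 * lform a w) *: v.
  have [[z1 [U1 J1]]|no] := pselect (exists z1, U z1 /\ Jac phi z1 = 0).
    have [v [lv hA]] := reflection sigmaE sigmaK oU sigmaU phi_sigma phi_proper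
      Jsigma JphiE U1 J1.
    by exists v.
  by exists 0 => z0 Uz0 J0; case: no; exists z0.
have anti z := Jac_anti sigmaE oU sigmaU phi_sigma phi_proper Jsigma (z := z).
pose h z := if Jac phi z == 0 then 'd g z v else g z / Jac phi z.
have hJ z : U z -> Jac phi z * h z = g z.
  move=> Uz; rewrite /h; case: eqP => [J0|/eqP J0]; last by rewrite mulrCA mulfV //
    mulr1.
  have [sz _] := crit_fix sigmaU phi_sigma phi_proper Uz J0.
  have := g_odd _ Uz; rewrite sz J0 mul0r => /eqP; rewrite -addr_eq0 -mulr2n
    mulrn_eq0 /=.
  by move=> /eqP ->.
have h_sigma z : U z -> h (sigma z) = h z.
  move=> Uz; have [J0|J0] := eqVneq (Jac phi z) 0.
    by have [-> _] := crit_fix sigmaU phi_sigma phi_proper Uz J0.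
  rewrite /h anti // oppr_eq0 (negbTE J0) g_odd // invrN mulrNN //.
have : forall x, exists z, V x -> U z /\ phi z = x.
  move=> x; have [Vx|nVx] := pselect (V x); last by exists 0.
  by have [z Uz zx] := phi_surj phi_proper Vx; exists z.
move=> /choice [s hs].
pose f x := if pselect (V x) then h (s x) else 0.
have fh z : U z -> f (phi z) = h z.
  move=> Uz; have Vz := phiV phi_proper Uz; rewrite /f; case: pselect => [Vz'|nVz];
    last by case: (nVz Vz).
  have [Us ps] := hs _ Vz; have [->|->] := fibre_pair Uz Us ps; first by [].
  exact: h_sigma.
exists f; last by move=> z Uz; rewrite fh // hJ.
split; first by move=> x nVx; rewrite /f; case: pselect.
move=> x Vx; have [z0 Uz0 <-] := phi_surj phi_proper Vx.
have Jsh z w : U z -> U w -> Jac phi w = Jac phi z + lform a (w - z).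
  move=> Uz Uw; have E : w = z + (w - z) by rewrite subrKC.
  by rewrite {1}E (Jac_shift JphiE) // -E.
have [J0|J0] := eqVneq (Jac phi z0) 0.
  have [lv hA] := hv _ Uz0 J0.
  have shift dl t : lform a dl = 0 -> sigma (z0 + dl + t *: v) = z0 + dl - t *: v.
    exact: (sigma_shift sigmaE sigmaU phi_sigma phi_proper t Uz0 J0 lv hA).
  have g_o dl t : lform a dl = 0 -> U (z0 + dl + t *: v) ->
      g (z0 + dl - t *: v) = - g (z0 + dl + t *: v).
    by move=> ldl Ut; rewrite -shift // g_odd.
  have p_e dl t : lform a dl = 0 -> U (z0 + dl + t *: v) ->
      phi (z0 + dl - t *: v) = phi (z0 + dl + t *: v).
    by move=> ldl Ut; rewrite -shift // phi_sigma.
  have p_j t : U (z0 + t *: v) -> Jac phi (z0 + t *: v) = t.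
    by move=> Ut; rewrite (Jsh _ _ Uz0 Ut) J0 add0r addrAC subrr add0r lformZ lv mulr1.
  have [B Bu hB] := even_quotient oU Uz0 lv phid p_e p_j.
  have [m hm] := odd_quotient oU Uz0 lv gd g_o.
  apply: (descent Bu Uz0 hB (m := m) (h := h) _ fh (preimages_near Uz0)).
  move=> e e0; have [eta eta0 heta] := hm e e0; exists eta => // z Uz zn.
  have := heta z Uz zn; rewrite /h J0 eqxx.
  by rewrite (Jsh _ _ Uz0 Uz) J0 add0r.
have Bu : jacobian phi z0 \in unitmx by rewrite unitmxE unitfE.
have [K K0 [hK _]] := lam_bounded a 0.
have lin : linear (lform a : Cd -> C) by move=> k w w'; rewrite lformD lformZ.
pose lm := GRing.isLinear.Build C Cd C _ _ lin.
pose l : {linear Cd -> C} := HB.pack (lform a : Cd -> C) lm.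
have dl : differentiable (fun z => lform a z - b) z0.
  apply: (proj1 (@nrm_differentiable _ _ _ (fun z => lform a z - b) z0 l K hK _)).
  move=> e e0; exists 1 => // y _ /=.
  have -> : lform a y - b - (lform a z0 - b) - lform a (y - z0) = 0.
    by rewrite lformB; ring.
  by rewrite nrm0 mulr_ge0 ?nrm_ge0 // ltW.
pose h' z := g z * (lform a z - b)^-1.
have J0' : lform a z0 - b != 0 by move: J0; rewrite JphiE.
have dh' : differentiable h' z0.
  apply: differentiableM; first exact: gd.
  exact: differentiableV.
apply: (@descent _ _ f h phi (fun z => z - z0) U z0 _ ('d h' z0) Bu Uz0 _ _ fh
  (preimages_near Uz0)).
  move=> e e0; have [eta eta0 heta] := differentiable_nrm (phid Uz0) e0.
  exists eta => // z _ zn.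
  rewrite -(deriveEjacobian (z - z0) (phid Uz0)) (deriveE _ (phid Uz0)).
  exact: heta.
move=> e e0; have [eta eta0 heta] := differentiable_nrm dh' e0.
have k0 : 0 < nrm (Jac phi z0) / K by rewrite divr_gt0 // nrm_gt0.
exists (Num.min eta (nrm (Jac phi z0) / K)); first by rewrite lt_min eta0.
move=> z Uz; rewrite lt_min => /andP[z1 z2].
have hh' w : U w -> Jac phi w != 0 -> h w = h' w.
  by move=> Uw Jw; rewrite /h (negbTE Jw) /h' (JphiE Uw).
have Jz : Jac phi z != 0.
  apply/eqP => Jz; move: z2; rewrite ltr_pdivlMr // mulrC ltNge => /negP; apply.
  have E : lform a (z - z0) = - Jac phi z0.
    by apply/eqP; rewrite -addr_eq0 addrC -(Jsh _ _ Uz0 Uz) Jz.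
  by have := hK (z - z0); rewrite E nrmN.
by rewrite (hh' _ Uz Jz) (hh' _ Uz0 J0); exact: heta.
Qed.

End descent_of_odd_functions.

(** * Uniform boundedness and weak limits in Hilbert spaces *)

Section hilbert.
Context {R : realType}.
Local Notation C := (Cplx R).
Variables (E : lmodType C) (H : set E) (ip : E -> E -> C).
Hypothesis hs : hilbert_space H ip.
Local Notation N := (ip_norm ip).
Implicit Types (f g h x y : E) (r s : R).

Lemma hilbert_add f g : H f -> H g -> H (f + g).
Proof. by move=> Hf Hg; have := hilbert_lin hs 1 Hf Hg; rewrite scale1r. Qed.

Lemma hilbert_scale (a : C) f : H f -> H (a *: f).
Proof. by move=> Hf; have := hilbert_lin hs a Hf (hilbert_0 hs); rewrite addr0. Qed.

Lemma hilbert_opp f : H f -> H (- f).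
Proof. by move=> Hf; rewrite -scaleN1r; exact: hilbert_scale. Qed.

Lemma hilbert_sub f g : H f -> H g -> H (f - g).
Proof. by move=> Hf Hg; apply: hilbert_add => //; exact: hilbert_opp. Qed.

Lemma ipDl f g h : H f -> H g -> H h -> ip (f + g) h = ip f h + ip g h.
Proof.
by move=> Hf Hg Hh; have := hilbert_ip_lin hs 1 Hf Hg Hh; rewrite scale1r mul1r.
Qed.

Lemma ip0l h : H h -> ip 0 h = 0.
Proof.
move=> Hh; have H0 := hilbert_0 hs; have := ipDl H0 H0 Hh.
by rewrite addr0 -{1}[ip 0 h]addr0 => /addrI.
Qed.

Lemma ipZl (a : C) f h : H f -> H h -> ip (a *: f) h = a * ip f h.
Proof.
move=> Hf Hh; have H0 := hilbert_0 hs; have := hilbert_ip_lin hs a Hf H0 Hh.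
by rewrite addr0 ip0l // addr0.
Qed.

Lemma ipC f g : H f -> H g -> ip g f = (ip f g)^*.
Proof. by move=> Hf Hg; exact: (hilbert_ip_conj hs). Qed.

Lemma ipDr f g h : H f -> H g -> H h -> ip h (f + g) = ip h f + ip h g.
Proof.
move=> Hf Hg Hh; rewrite (ipC (hilbert_add Hf Hg) Hh) ipDl // rmorphD /=.
by rewrite -(ipC Hf Hh) -(ipC Hg Hh).
Qed.

Lemma ipZr (a : C) f h : H f -> H h -> ip h (a *: f) = a^* * ip h f.
Proof.
by move=> Hf Hh; rewrite (ipC (hilbert_scale a Hf) Hh) ipZl // rmorphM /= -(ipC Hf Hh).
Qed.

Lemma ipBl f g h : H f -> H g -> H h -> ip (f - g) h = ip f h - ip g h.
Proof.
move=> Hf Hg Hh; rewrite ipDl //; last exact: hilbert_opp.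
by rewrite -[- g]scaleN1r ipZl // mulN1r.
Qed.

Lemma ipBr f g h : H f -> H g -> H h -> ip h (f - g) = ip h f - ip h g.
Proof.
move=> Hf Hg Hh; rewrite ipDr //; last exact: hilbert_opp.
by rewrite -[- g]scaleN1r ipZr // rmorphN rmorph1 mulN1r.
Qed.

Lemma conjRe (z : C) : complex.Re (z^*) = complex.Re z.
Proof. by case: z. Qed.

Definition sqnorm f : R := complex.Re (ip f f).

Lemma sqnormE f : H f -> ip f f = toC (sqnorm f).
Proof. by move=> Hf; apply: ge0_toC; exact: (hilbert_ip_ge0 hs). Qed.

Lemma sqnorm_ge0 f : H f -> 0 <= sqnorm f.
Proof. by move=> Hf; rewrite -toC_le -sqnormE // toC0; exact: (hilbert_ip_ge0 hs). Qed.

Lemma ip_norm_ge0 f : 0 <= N f. Proof. exact: sqrtr_ge0. Qed.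

Lemma sqr_ip_norm f : H f -> N f ^+ 2 = sqnorm f.
Proof. by move=> Hf; rewrite sqr_sqrtr // sqnorm_ge0. Qed.

Lemma sqnormD f g : H f -> H g -> sqnorm (f + g) = sqnorm f + sqnorm g + 2 *
  complex.Re (ip f g).
Proof.
move=> Hf Hg; have Hfg := hilbert_add Hf Hg.
rewrite /sqnorm ipDl // !ipDr // !ReD (ipC Hf Hg) conjRe; ring.
Qed.

Lemma sqnormZ (a : C) f : H f -> sqnorm (a *: f) = nrm a ^+ 2 * sqnorm f.
Proof.
move=> Hf; rewrite /sqnorm ipZl ?ipZr //; last exact: hilbert_scale.
by rewrite mulrA -normCK nrmE -toCX ReZ.
Qed.

Lemma sqnormB f g : H f -> H g -> sqnorm (f - g) = sqnorm f + sqnorm g - 2 *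
  complex.Re (ip f g).
Proof.
move=> Hf Hg; rewrite sqnormD //; last exact: hilbert_opp.
rewrite -scaleN1r sqnormZ // ipZr // rmorphN rmorph1 mulN1r ReN nrmN nrm1; ring.
Qed.

Lemma ip_norm_eq0 f : H f -> N f = 0 -> f = 0.
Proof.
move=> Hf f0; apply: (hilbert_ip_eq0 hs) => //.
by rewrite sqnormE // -sqr_ip_norm // f0 expr0n.
Qed.

Lemma ip_normZ (a : C) f : H f -> N (a *: f) = nrm a * N f.
Proof.
move=> Hf; apply/eqP; rewrite -(@eqrXn2 _ 2) ?mulr_ge0 ?nrm_ge0 ?ip_norm_ge0 //.
by rewrite exprMn !sqr_ip_norm ?sqnormZ //; exact: hilbert_scale.
Qed.

Lemma ip_normN f : H f -> N (- f) = N f.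
Proof. by move=> Hf; rewrite -scaleN1r ip_normZ // nrmN nrm1 mul1r. Qed.

Lemma ip_norm_distC f g : H f -> H g -> N (f - g) = N (g - f).
Proof. by move=> Hf Hg; rewrite -opprB ip_normN //; exact: hilbert_sub. Qed.

Lemma cauchy_schwarz f g : H f -> H g -> nrm (ip f g) <= N f * N g.
Proof.
move=> Hf Hg; have [g0|g0] := eqVneq (N g) 0.
  rewrite (ip_norm_eq0 Hg g0) (ipC (hilbert_0 hs) Hf) ip0l // rmorph0 nrm0.
  by rewrite mulr_ge0 ?ip_norm_ge0.
have gp : 0 < sqnorm g by rewrite -sqr_ip_norm // exprn_gt0 // lt_def g0 ip_norm_ge0.
pose c := ip f g / toC (sqnorm g).
have Hc : H (c *: g) by exact: hilbert_scale.
have P := sqnorm_ge0 (hilbert_sub Hf Hc).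
rewrite sqnormB // sqnormZ // ipZr // in P.
have E1 : c^* * ip f g = toC (nrm (ip f g) ^+ 2 / sqnorm g).
  rewrite /c rmorphM /= fmorphV /= toCM toCX toCV -nrmE normCK mulrAC mulrC.
  have -> : (toC (sqnorm g))^* = toC (sqnorm g) :> C by exact: conjc_real.
  by rewrite mulrC (mulrC (ip f g)).
have E2 : nrm c ^+ 2 * sqnorm g = nrm (ip f g) ^+ 2 / sqnorm g.
  rewrite /c nrmM nrmV nrm_toC gtr0_norm //; field; exact: lt0r_neq0.
rewrite E1 E2 /= in P.
rewrite -(@ler_pXn2r _ 2) ?nnegrE ?nrm_ge0 ?mulr_ge0 ?ip_norm_ge0 //.
rewrite exprMn !sqr_ip_norm // -ler_pdivrMr //.
by move: P; rewrite mulr_natl mulr2n; lra.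
Qed.

Lemma ler_ip_normD f g : H f -> H g -> N (f + g) <= N f + N g.
Proof.
move=> Hf Hg; have Hfg := hilbert_add Hf Hg.
rewrite -(@ler_pXn2r _ 2) ?nnegrE ?addr_ge0 ?ip_norm_ge0 // sqr_ip_norm // sqnormD //.
have h : complex.Re (ip f g) <= N f * N g.
  apply: le_trans (cauchy_schwarz Hf Hg); apply: le_trans (Re_nrm _); exact: ler_norm.
rewrite sqrrD !sqr_ip_norm // -[N f * N g *+ 2]mulr_natl; lra.
Qed.

Lemma ip_norm_triangle f g h : H f -> H g -> H h -> N (f - h) <= N (f - g) + N (g - h).
Proof.
move=> Hf Hg Hh; have -> : f - h = (f - g) + (g - h) by rewrite addrA subrK.
by apply: ler_ip_normD; exact: hilbert_sub.
Qed.

Section ubp.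
Variable k : nat -> E.
Hypothesis Hk : forall n, H (k n).
Hypothesis pointwise : forall g, H g -> exists M : R, forall n, nrm (ip g (k n)) <= M.

(** The values of the n-th functional at x + u and x - u differ by 2 r N (k
    n), so one of them has modulus at least r N (k n). *)
Lemma gliding_hump x n r : H x -> 0 < r -> exists y, [/\ H y, N (y - x) <= r &
  r * N (k n) <= nrm (ip y (k n))].
Proof.
move=> Hx r0; have Hkn := Hk n; have [k0|k0] := eqVneq (N (k n)) 0.
  exists x; split => //; last by rewrite k0 mulr0 nrm_ge0.
  by rewrite subrr -(scale0r x) ip_normZ // nrm0 mul0r ltW.
have kp : 0 < N (k n) by rewrite lt_def k0 ip_norm_ge0.
pose u := toC (r / N (k n)) *: k n.
have Hu : H u by exact: hilbert_scale.
have Nu : N u = r by rewrite ip_normZ // nrm_toC gtr0_norm ?divr_gt0 // divfK.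
have iu : ip u (k n) = toC (r * N (k n)).
  rewrite ipZl // sqnormE // -sqr_ip_norm // -toCM; congr toC; rewrite expr2 mulrA
    divfK //.
have tot : 2 * (r * N (k n)) <= nrm (ip (x + u) (k n)) + nrm (ip (x - u) (k n)).
  have -> : 2 * (r * N (k n)) = nrm (ip (x + u) (k n) - ip (x - u) (k n)).
    rewrite ipDl // ipBl // opprD opprK addrACA subrr add0r iu -toCD.
    rewrite nrm_toC ger0_norm; first by rewrite mulr_natl mulr2n.
    by rewrite addr_ge0 // mulr_ge0 // ltW.
  exact: nrmB.
have [h|h] := leP (r * N (k n)) (nrm (ip (x + u) (k n))).
  by exists (x + u); split => //; [exact: hilbert_add|rewrite addrAC subrr add0r Nu].
exists (x - u); split; [exact: hilbert_sub| |lra].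
by rewrite addrAC subrr add0r ip_normN // Nu.
Qed.

(** If the norms were unbounded, pick n_j with norm above 2 j 3^j and move x_j
    by at most 3^-j so that the n_j-th functional is at least 3^-j N (k n_j)
    at x_(j+1).  The later moves add up to at most 3^-j / 2, so at the limit
    point that functional is at least j. *)
Lemma uniform_boundedness : exists B : R, forall n, N (k n) <= B.
Proof.
apply: contrapT => unb.
have big (B : R) : exists n, B < N (k n).
  apply: contrapT => h; apply: unb; exists B => n; rewrite leNgt; apply/negP => hn.
  by apply: h; exists n.
have [nj hnj] := choice (fun j : nat => big (2 * 3 ^+ j * j%:R)).
pose r j : R := (3 ^+ j)^-1.
have r0 j : 0 < r j by rewrite invr_gt0 exprn_gt0.
have rS j : r j = 3 * r j.+1 by rewrite /r exprS; field; rewrite expf_neq0.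
have step (p : nat * E) : exists y, H p.2 -> [/\ H y, N (y - p.2) <= r p.1 &
    r p.1 * N (k (nj p.1)) <= nrm (ip y (k (nj p.1)))].
  have [Hx|nHx] := pselect (H p.2); last by exists 0.
  by have [y hy] := gliding_hump (nj p.1) Hx (r0 p.1); exists y.
have [F hF] := choice step.
pose x := fix x n := if n is m.+1 then F (m, x m) else 0.
have Hx n : H (x n).
  by elim: n => [|n IH]; [exact: hilbert_0 hs|have [] := hF (n, x n) IH].
have x1 n : N (x n.+1 - x n) <= r n by have [] := hF (n, x n) (Hx n).
have x2 n : r n * N (k (nj n)) <= nrm (ip (x n.+1) (k (nj n))).
  by have [] := hF (n, x n) (Hx n).
have tail j p : N (x (j + p)%N - x j) <= 3 / 2 * (r j - r (j + p)%N).
  elim: p => [|p IH].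
    by rewrite addn0 !subrr mulr0 -(scale0r (0 : E)) ip_normZ ?nrm0 ?mul0r //; exact:
      hilbert_0 hs.
  rewrite addnS; apply: le_trans (ip_norm_triangle (Hx _) (Hx (j + p)%N) (Hx _)) _.
  by have := x1 (j + p)%N; have := rS (j + p)%N; lra.
have tail2 j m : (j <= m)%N -> N (x m - x j) <= 3 / 2 * r j.
  move=> jm; rewrite -(subnKC jm); apply: le_trans (tail _ _) _.
  by have := r0 (j + (m - j))%N; lra.
have rsmall (e : R) : 0 < e -> exists j, r j < e.
  move=> e0; have : (fun n => (3^-1 : R) ^+ n) @ \oo --> (0 : R).
    by apply: cvg_expr; rewrite ger0_norm ?invr_ge0 // invf_lt1 // ltr1n.
  move=> /cvgrPdist_lt /(_ e e0) [j _ /(_ j (leqnn j))].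
  rewrite sub0r normrN exprVn => h; exists j; apply: le_lt_trans h; exact: ler_norm.
have [lim Hl hl] : exists2 f, H f & forall e : R, 0 < e -> exists M : nat, forall n :
  nat,
    (M <= n)%N -> N (x n - f) < e.
  apply: (hilbert_complete hs) => // e e0.
  have e3 : 0 < e / 3 by rewrite divr_gt0.
  have [j hj] := rsmall _ e3; exists j => m n jm jn.
  apply: le_lt_trans (ip_norm_triangle (Hx m) (Hx j) (Hx n)) _.
  have := tail2 _ _ jm; have := tail2 _ _ jn; rewrite (ip_norm_distC (Hx n)) //; lra.
have tail3 j : N (lim - x j) <= 3 / 2 * r j.
  apply/ler_addgt0Pr => e e0; have [M hM] := hl e e0.
  have h1 := hM (maxn M j) (leq_maxl _ _); have h2 := tail2 _ _ (leq_maxr M j).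
  apply: le_trans (ip_norm_triangle Hl (Hx (maxn M j)) (Hx j)) _.
  by rewrite (ip_norm_distC Hl) //; lra.
have [M hM] := pointwise Hl.
have [j hj] : exists j : nat, M < j%:R.
  exists (Num.bound `|M|); exact: le_lt_trans (ler_norm _) (archi_boundP (normr_ge0 M)).
have A1 := hM (nj j); have A2 := x2 j; have A3 := hnj j.
have A4 := cauchy_schwarz (hilbert_sub Hl (Hx j.+1)) (Hk (nj j)).
have A5 := tail3 j.+1.
have A6 : nrm (ip (x j.+1) (k (nj j))) <= nrm (ip lim (k (nj j))) + nrm (ip (lim - x
  j.+1) (k (nj j))).
  have -> : ip (x j.+1) (k (nj j)) = ip lim (k (nj j)) - ip (lim - x j.+1) (k (nj j)).
    by rewrite (ipBl Hl) // opprB addrCA subrr addr0.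
  exact: nrmB.
have nk := ip_norm_ge0 (k (nj j)).
have A7 : N (lim - x j.+1) * N (k (nj j)) <= 3 / 2 * r j.+1 * N (k (nj j)).
  by rewrite ler_wpM2r.
have A8 : r j * (2 * 3 ^+ j * j%:R) <= r j * N (k (nj j)) by rewrite ler_pM2l // ltW.
have A9 : r j * (2 * 3 ^+ j * j%:R) = 2 * j%:R.
  by rewrite /r; field; rewrite expf_neq0.
have A10 : r j * N (k (nj j)) = 3 * (r j.+1 * N (k (nj j))) by rewrite {1}rS mulrA.
move: hj; rewrite ltNge => /negP; apply.
rewrite -mulrA in A7; lra.
Qed.

End ubp.

Section weak_limit.
Variables (k : nat -> E) (L : E -> C).
Hypothesis Hk : forall n, H (k n).
Hypothesis cvL : forall g, H g -> forall e : R, 0 < e -> exists M : nat, forall n : nat,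
  (M <= n)%N -> nrm (ip g (k n) - L g) <= e.

Lemma near_constant_bounded (u : nat -> C) (l : C) (m : nat) :
  (forall n, (m <= n)%N -> nrm (u n - l) <= 1) -> exists M : R, forall n, nrm (u n)
    <= M.
Proof.
move=> h; exists (nrm l + 1 + \sum_(i < m) nrm (u i)) => n.
have s0 (P : pred 'I_m) : 0 <= \sum_(i < m | P i) nrm (u i).
  by apply: sumr_ge0 => i _; exact: nrm_ge0.
have l0 := nrm_ge0 l.
have [mn|nm] := leqP m n.
  apply: (@le_trans _ _ (nrm l + 1)); last by rewrite lerDl.
  have -> : u n = l + (u n - l) by rewrite subrKC.
  by apply: le_trans (nrmD _ _) _; rewrite lerD2l h.
rewrite (bigD1 (Ordinal nm)) //=; have := s0 (fun i => i != Ordinal nm); lra.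
Qed.

Lemma weak_limit_linear (a : C) f g : H f -> H g -> L (a *: f + g) = a * L f + L g.
Proof.
move=> Hf Hg; apply/eqP; rewrite -subr_eq0; apply/eqP; apply: nrm_small => e e0.
have Ha := hilbert_lin hs a Hf Hg.
pose c := nrm a + 2.
have c0 : 0 < c by rewrite /c ltr_wpDl ?nrm_ge0.
have ec : 0 < e / c by rewrite divr_gt0.
have [M1 h1] := cvL Hf ec; have [M2 h2] := cvL Hg ec; have [M3 h3] := cvL Ha ec.
pose n := maxn M1 (maxn M2 M3).
have g1 := h1 n (leq_maxl _ _).
have g2 := h2 n (leq_trans (leq_maxl _ _) (leq_maxr _ _)).
have g3 := h3 n (leq_trans (leq_maxr _ _) (leq_maxr _ _)).
rewrite (hilbert_ip_lin hs) // in g3.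
have -> : L (a *: f + g) - (a * L f + L g) =
  a * (ip f (k n) - L f) + (ip g (k n) - L g) - (a * ip f (k n) + ip g (k n) - L (a
    *: f + g)).
  by move: (L _) (L f) (L g) (ip f _) (ip g _) => *; ring.
apply: le_trans (nrmB _ _) _.
have := nrmD (a * (ip f (k n) - L f)) (ip g (k n) - L g); rewrite nrmM.
have := ler_wpM2l (nrm_ge0 a) g1.
have : e = nrm a * (e / c) + e / c + e / c by rewrite /c; field; exact: lt0r_neq0.
lra.
Qed.

Lemma weak_limit_bounded : exists2 B : R, 0 <= B & forall g, H g -> nrm (L g) <= B *
  N g.
Proof.
have [B Bk] : exists B : R, forall n, N (k n) <= B.
  apply: uniform_boundedness => // g Hg; have [m hm] := cvL Hg ltr01.
  exact: near_constant_bounded hm.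
exists B; first exact: le_trans (ip_norm_ge0 _) (Bk 0%N).
move=> g Hg; apply/ler_addgt0Pr => e e0; have [m hm] := cvL Hg e0.
have := hm m (leqnn m); have := cauchy_schwarz Hg (Hk m).
have := nrmB (ip g (k m)) (ip g (k m) - L g); rewrite subKr.
have := ler_wpM2l (ip_norm_ge0 g) (Bk m); rewrite (mulrC B); lra.
Qed.

(** The limit functional L is bounded by [uniform_boundedness].  A minimizing
    sequence of |g|^2 - 2 Re (L g) is Cauchy by the parallelogram law, and its
    limit represents L. *)
Lemma weak_limit : exists2 k0, H k0 & forall g, H g -> ip g k0 = L g.
Proof.
have [B B0 hB'] := weak_limit_bounded.
pose Phi g := sqnorm g - 2 * complex.Re (L g).
have LZ (a : C) f : H f -> L (a *: f) = a * L f.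
  move=> Hf; have L0 : L 0 = 0.
    apply/eqP; rewrite -nrm_eq0 eq_le nrm_ge0 andbT.
    apply: le_trans (hB' _ (hilbert_0 hs)) _.
    by rewrite -(scale0r (0 : E)) ip_normZ ?nrm0 ?mul0r ?mulr0 //; exact: hilbert_0 hs.
  by have := weak_limit_linear a Hf (hilbert_0 hs); rewrite !addr0 L0 addr0.
have LD f g : H f -> H g -> L (f + g) = L f + L g.
  by move=> Hf Hg; have := weak_limit_linear 1 Hf Hg; rewrite scale1r mul1r.
have Phi_lb g : H g -> - B ^+ 2 <= Phi g.
  move=> Hg; have := hB' g Hg; have := le_trans (ler_norm _) (Re_nrm (L g)).
  rewrite /Phi -sqr_ip_norm // => h1 h2; have := sqr_ge0 (N g - B); rewrite sqrrB.
  by rewrite -[_ *+ 2]mulr_natl (mulrC B) in h2 *; lra.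
pose S := [set Phi g | g in H].
have S0 : S !=set0 by exists (Phi 0); exists 0 => //; exact: hilbert_0 hs.
have Slb : has_lbound S by exists (- B ^+ 2) => _ [g Hg <-]; exact: Phi_lb.
pose I := inf S.
have I_le g : H g -> I <= Phi g by move=> Hg; apply: ge_inf => //; exists g.
have ex (n : nat) : exists g, H g /\ Phi g < I + n.+1%:R^-1.
  have n0 : (0 : R) < n.+1%:R^-1 by rewrite invr_gt0 ltr0n.
  have [_ [g Hg <-] hg] := inf_adherent n0 (conj S0 Slb).
  by exists g.
have [u hu] := choice ex.
have Hu n : H (u n) by have [] := hu n.
have par f g : H f -> H g -> sqnorm (f - g) <= 2 * (Phi f + Phi g - 2 * I).
  move=> Hf Hg; have Hm : H (toC 2^-1 *: (f + g)) by apply: hilbert_scale; exact: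
    hilbert_add.
  have := I_le _ Hm; rewrite /Phi sqnormZ; last exact: hilbert_add.
  rewrite sqnormD // LZ; last exact: hilbert_add.
  rewrite LD // ReZ ReD nrm_toC ger0_norm ?invr_ge0 // sqnormB //.
  rewrite (_ : 2^-1 ^+ 2 = 4^-1); last by rewrite exprVn -natrX.
  lra.
have inv_small (e : R) : 0 < e -> exists M : nat, forall n, (M <= n)%N -> n.+1%:R^-1
  < e.
  by move=> e0; have [M _ hM] := near_infty_natSinv_lt (PosNum e0); exists M.
have [k0 Hk0 hk0] : exists2 f, H f & forall e : R, 0 < e -> exists M : nat, forall n
  : nat,
    (M <= n)%N -> N (u n - f) < e.
  apply: (hilbert_complete hs) => // e e0.
  have e4 : 0 < e ^+ 2 / 4 by rewrite divr_gt0 ?exprn_gt0.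
  have [M hM] := inv_small _ e4; exists M => m n Mm Mn.
  rewrite -(@ltr_pXn2r _ 2) ?nnegrE ?ip_norm_ge0 ?ltW // sqr_ip_norm; last exact:
    hilbert_sub.
  apply: le_lt_trans (par _ _ (Hu m) (Hu n)) _.
  have [_ h1] := hu m; have [_ h2] := hu n.
  have := hM m Mm; have := hM n Mn; move: h1 h2.
  move: (m.+1%:R^-1) (n.+1%:R^-1) => p q; lra.
(* Moving u n by t h with |t| = s lowers Phi by at most 1 / (n + 1); with s of
    order e this bounds the first variation of Phi at u n by e. *)
have real_part h : H h -> complex.Re (ip h k0) = complex.Re (L h).
  move=> Hh; apply/eqP; rewrite -subr_eq0 -normr_eq0 eq_le normr_ge0 andbT.
  apply/ler_addgt0Pr => e e0; rewrite add0r.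
  pose s := e / 2 / (sqnorm h + 1).
  have nh0 := sqnorm_ge0 Hh.
  have s0 : 0 < s by rewrite !divr_gt0 // ltr_wpDl.
  have snh : s * sqnorm h <= e / 2.
    have : s * (sqnorm h + 1) = e / 2 by rewrite divfK // gt_eqF // ltr_wpDl.
    by rewrite mulrDr mulr1; lra.
  have se : 0 < s * (e / 2) by rewrite mulr_gt0 // divr_gt0.
  have [M1 hM1] := inv_small _ se.
  have Nh1 : 0 < N h + 1 by rewrite ltr_wpDl ?ip_norm_ge0.
  have eN : 0 < e / 2 / (N h + 1) by rewrite !divr_gt0.
  have [M2 hM2] := hk0 _ eN.
  pose n := maxn M1 M2.
  have hn1 := hM1 n (leq_maxl _ _); have hn2 := hM2 n (leq_maxr _ _).
  have [_ Pn] := hu n.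
  have var (t : R) : `|t| = s -> - (2 * t * complex.Re (ip (u n) h - L h)) <= s ^+ 2
    * sqnorm h + n.+1%:R^-1.
    move=> ts; have Hth : H (toC t *: h) by exact: hilbert_scale.
    have := I_le _ (hilbert_add (Hu n) Hth); rewrite /Phi sqnormD // sqnormZ // LD //
      LZ //.
    rewrite ipZr // (_ : (toC t)^* = toC t :> C); last exact: conjc_real.
    rewrite ReD !ReZ nrm_toC ts ReD ReN.
    have := I_le _ (Hu n); move: Pn; rewrite /Phi.
    move: (complex.Re (ip _ _)) (complex.Re (L h)) (complex.Re (L (u n))) (sqnorm (u
      n)) (s ^+ 2 * sqnorm h) (n.+1%:R^-1) => x1 x2 x3 x4 x5 x6 h1 h2 h3.
    lra.
  have v1 := var s (gtr0_norm s0); have := var (- s); rewrite normrN gtr0_norm // =>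
    /(_ erefl) v2.
  set c := complex.Re (ip (u n) h - L h) in v1 v2.
  have B1 : `|c| <= e / 2.
    have : 2 * s * `|c| <= s ^+ 2 * sqnorm h + n.+1%:R^-1.
      by case: (ger0P c) => _; [move: v2|move: v1]; rewrite ?mulrN ?mulNr ?opprK.
    have : s ^+ 2 * sqnorm h <= s * (e / 2) by rewrite expr2 -mulrA ler_pM2l.
    have h2 : 2 * s * `|c| = s * (2 * `|c|) by ring.
    rewrite h2 => P1 P2; have : s * (2 * `|c|) <= s * e.
      by move: P1 P2 hn1; move: (n.+1%:R^-1) => q P1 P2 hn1; lra.
    by rewrite ler_pM2l //; lra.
  have Hd : H (u n - k0) by exact: hilbert_sub.
  have B2 : nrm (ip (u n - k0) h) <= e / 2.
    apply: le_trans (cauchy_schwarz Hd Hh) _.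
    apply: (@le_trans _ _ (e / 2 / (N h + 1) * (N h + 1))); last by rewrite divfK //
      gt_eqF.
    by apply: ler_pM; rewrite ?ip_norm_ge0 // ?ltW // ltrDl.
  have -> : complex.Re (ip h k0) - complex.Re (L h) = c - complex.Re (ip (u n - k0) h).
    rewrite /c ipBl // !ReD !ReN (ipC Hk0 Hh) conjRe; ring.
  apply: le_trans (ler_normB _ _) _; rewrite [e]splitr lerD //.
  exact: le_trans (Re_nrm _) B2.
exists k0 => // g Hg; apply: eq_complexP; first exact: real_part.
have := real_part _ (hilbert_scale 'i%C Hg); rewrite ipZl // LZ // ![ 'i%C * _]mulrC.
rewrite !(ReiNIm (_ : R[i])) => /eqP; rewrite eqr_opp => /eqP //.
Qed.

End weak_limit.
End hilbert.

(** * Transport of structure through Gamma *)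

Section transfer.
Context {R : realType} {d : nat}.
Local Notation C := (Cplx R).
Local Notation Cd := 'rV[C]_d.
Local Notation Fun := (Cd -> C).
Variables (sigma phi : Cd -> Cd) (U V : set Cd) (A : {linear Cd -> Cd}) (B0 : Cd).
Hypothesis sigmaE : forall z, sigma z = A z + B0.
Hypothesis sigmaK : involutive sigma.
Hypothesis oU : open U.
Hypothesis oV : open V.
Hypothesis sigmaU : invariant_set sigma U.
Hypothesis phi_sigma : forall z, U z -> phi (sigma z) = phi z.
Hypothesis phi_proper : m_proper 2 U V phi.
Hypothesis Jsigma : forall z, Jac sigma z = -1.
Variables (a : Cd) (b : C).
Hypothesis JphiE : forall z, U z -> Jac phi z = \sum_(j < d) a ord0 j * z ord0 j - b.
Variables (H : set Fun) (ip : Fun -> Fun -> C) (kappa : Cd -> Cd -> C).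
Hypothesis hs : hilbert_space H ip.
Hypothesis H_on : forall f, H f -> fun_on U f.
Hypothesis H_ker : forall w, U w -> H (kappa^~ w) /\ forall f, H f -> ip f (kappa^~
  w) = f w.
Hypothesis H_hol : H `<=` Hol U.
Hypothesis H_sigma : forall f, H f -> H (f \o sigma).
Hypothesis ip_sigma : forall f g, H f -> H g -> ip (f \o sigma) (g \o sigma) = ip f g.

Local Notation G := (Gamma U phi).
Local Notation Hp := (H_phi U V H phi).
Local Notation Hm := (anti_invariant sigma H).
Implicit Types (f g k : Fun) (z w v : Cd).

Definition ip_phi f g : C := ip (G f) (G g).

Let sigma_notU z : ~ U z -> ~ U (sigma z).
Proof. by move=> nU /sigmaU; rewrite sigmaK. Qed.

Lemma GammaE f z : U z -> G f z = Jac phi z * f (phi z).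
Proof. by move=> Uz; rewrite /Gamma patchE mem_set. Qed.

Lemma Gamma_out f z : ~ U z -> G f z = 0.
Proof. by move=> nUz; rewrite /Gamma patchE memNset. Qed.

Lemma Gamma_lin (c : C) f g : G (c *: f + g) = c *: G f + G g.
Proof.
apply/funext => z; change (G (c *: f + g) z = c * G f z + G g z).
have [Uz|nUz] := pselect (U z).
  rewrite !GammaE //; change ((c *: f + g) (phi z)) with (c * f (phi z) + g (phi z)).
  by rewrite mulrDr mulrCA.
by rewrite !Gamma_out // addr0 mulr0.
Qed.

Lemma GammaD f g : G (f + g) = G f + G g.
Proof. by have := Gamma_lin 1 f g; rewrite !scale1r. Qed.

Lemma Gamma0 : G 0 = 0.
Proof. by have := GammaD 0 0; rewrite addr0 -[X in X = _]addr0 => /addrI. Qed.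

Lemma GammaN f : G (- f) = - G f.
Proof. by have := Gamma_lin (-1) f 0; rewrite !scaleN1r !addr0 Gamma0 addr0. Qed.

Lemma Hol_lin (c : C) f g : Hol V f -> Hol V g -> Hol V (c *: f + g).
Proof.
move=> [f0 fd] [g0 gd]; split.
  by move=> z nVz; rewrite !fctE f0 // g0 // addr0; exact: mulr0.
move=> z Vz; apply: differentiableD; last exact: gd.
by apply: differentiableZ; exact: fd.
Qed.

Lemma Gamma_anti f z : G f (sigma z) = - G f z.
Proof.
have [Uz|nUz] := pselect (U z); last first.
  by rewrite !Gamma_out ?oppr0 //; exact: sigma_notU.
rewrite !GammaE //; last exact: sigmaU.
by rewrite phi_sigma // (Jac_anti sigmaE oU sigmaU phi_sigma phi_proper Jsigma Uz)
  mulNr.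
Qed.

Lemma anti_invariantP g : Hm g <-> H g /\ forall z, g (sigma z) = - g z.
Proof.
split=> [[Hg gE]|[Hg gE]]; split => //.
  by move=> z; rewrite {2}gE !fctE opprK.
by apply/funext => z; rewrite !fctE gE opprK.
Qed.

Lemma anti_invariant_lin (c : C) f g : Hm f -> Hm g -> Hm (c *: f + g).
Proof.
move=> /anti_invariantP[Hf fs] /anti_invariantP[Hg gs]; apply/anti_invariantP; split;
  first exact: (hilbert_lin hs).
by move=> z; rewrite !fctE fs gs opprD; congr (_ - _); exact: mulrN.
Qed.

Lemma Gamma_anti_invariant f : Hp f -> Hm (G f).
Proof. by move=> [_ HG]; apply/anti_invariantP; split => // z; exact: Gamma_anti. Qed.

Lemma Gamma_surj g : Hm g -> exists2 f, Hp f & G f = g.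
Proof.
move=> /anti_invariantP[Hg gs]; have [_ gd] := H_hol Hg.
have [f Vf fE] := odd_descends sigmaE sigmaK oU oV sigmaU phi_sigma phi_proper Jsigma
  JphiE gd (fun z _ => gs z).
have E : G f = g.
  apply/funext => z; have [Uz|nUz] := pselect (U z); first by rewrite GammaE // fE.
  by rewrite Gamma_out // (H_on Hg).
by exists f => //; split; rewrite // E.
Qed.

(** From a critical point, J along v is the displacement itself. *)
Lemma regular_dense z0 : U z0 -> forall e : R, 0 < e ->
  exists z, [/\ U z, nrm (z - z0) < e & Jac phi z != 0].
Proof.
move=> Uz0 e e0; have [J0|/eqP J0] := pselect (Jac phi z0 = 0); last first.
  by exists z0; split; [exact: Uz0|rewrite subrr nrm0|exact: J0].
have [v [lv _]] := reflection sigmaE sigmaK oU sigmaU phi_sigma phi_proper Jsigma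
  JphiE Uz0 J0.
have [e1 e10 he1] := U_ball oU Uz0.
have n1 : 0 < nrm v + 1 by rewrite ltr_wpDl ?nrm_ge0.
pose m := Num.min e e1.
have m0 : 0 < m by rewrite lt_min e0.
pose t : C := toC (m / (nrm v + 1)).
have tv : nrm (t *: v) < m.
  rewrite nrmZ nrm_toC ger0_norm; last by rewrite divr_ge0 // ltW.
  by rewrite mulrAC ltr_pdivrMr // ltr_pM2l // ltrDl.
have sh : z0 + t *: v - z0 = t *: v by rewrite addrAC subrr add0r.
have Uz : U (z0 + t *: v).
  by apply: he1; rewrite sh; apply: lt_le_trans tv _; rewrite ge_min lexx orbT.
exists (z0 + t *: v); split; first exact: Uz.
  by rewrite sh; apply: lt_le_trans tv _; rewrite ge_min lexx.
rewrite (Jac_shift JphiE Uz0 Uz) J0 add0r lformZ lv mulr1 toC_eq0.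
by rewrite gt_eqF // divr_gt0.
Qed.

Lemma comp_phi_continuous f z0 : Hol V f -> U z0 -> forall e : R, 0 < e ->
  exists2 dl : R, 0 < dl & forall z, nrm (z - z0) < dl -> nrm (f (phi z) - f (phi
    z0)) < e.
Proof.
move=> [_ fd] Uz0 e e0.
have df := fd _ (phiV phi_proper Uz0).
have dp := phi_diff phi_proper Uz0.
have /continuous_nrmP := differentiable_continuous (differentiable_comp dp df).
by move=> /(_ e e0).
Qed.

(** f vanishes at the images of the regular points, which are dense in U. *)
Lemma Gamma_inj f : Hol V f -> G f = 0 -> f = 0.
Proof.
move=> Vf Gf; apply/funext => x; change (f x = 0).
have [Vx|nVx] := pselect (V x); last by case: Vf => + _; apply.
have [z0 Uz0 <-] := phi_surj phi_proper Vx.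
apply: nrm_small => e e0; have [dl dl0 hdl] := comp_phi_continuous Vf Uz0 e0.
have [z [Uz zn Jz]] := regular_dense Uz0 dl0.
have fz : f (phi z) = 0.
  have := GammaE f Uz; rewrite Gf => /eqP; rewrite eq_sym mulf_eq0 (negbTE Jz) /=.
  by move=> /eqP.
by have := hdl z zn; rewrite fz sub0r nrmN => /ltW.
Qed.

Lemma ip_norm_phi f : ip_norm ip_phi f = ip_norm ip (G f).
Proof. by []. Qed.

(** With e = u n - g one has g + g o sigma = - (e + e o sigma), and
    composition with sigma preserves the norm. *)
Lemma anti_invariant_closed (u : nat -> Fun) g : (forall n, Hm (u n)) -> H g ->
  (forall e : R, 0 < e -> exists M : nat, forall n : nat, (M <= n)%N -> ip_norm ip (u
    n - g) < e) ->
  Hm g.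
Proof.
move=> Hu Hg cv; apply/anti_invariantP; split => // z.
have Hgs := H_sigma Hg.
suff E : g + (g \o sigma) = 0.
  by apply/eqP; rewrite -addr_eq0 addrC; apply/eqP; exact: (congr1 (fun f : Fun => f
    z) E).
apply: (ip_norm_eq0 hs); first exact: (hilbert_add hs).
apply/eqP; rewrite eq_le ip_norm_ge0 andbT; apply/ler_addgt0Pr => e e0; rewrite add0r.
have e2 : 0 < e / 2 by rewrite divr_gt0.
have [n hn] := cv _ e2; have {hn} := hn n (leqnn n).
have /anti_invariantP[Hun us] := Hu n.
have He : H (u n - g) by exact: (hilbert_sub hs).
have Hes := H_sigma He.
have -> : g + (g \o sigma) = - ((u n - g) + ((u n - g) \o sigma)).
  apply/funext => w; rewrite !fctE us; move: (u n w) (g w) (g (sigma w)) => x y t.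
  ring.
rewrite (ip_normN hs) => [h|]; last exact: (hilbert_add hs).
apply: le_trans (ler_ip_normD hs He Hes) _.
have -> : ip_norm ip ((u n - g) \o sigma) = ip_norm ip (u n - g).
  by rewrite /ip_norm ip_sigma.
lra.
Qed.

Lemma H_phi_hilbert : hilbert_space Hp ip_phi.
Proof.
split.
- split; last by rewrite Gamma0; exact: (hilbert_0 hs).
  split; first by [].
  by move=> z _; exact: differentiable_cst.
- move=> c f g [Vf Hf] [Vg Hg]; split; first exact: Hol_lin.
  by rewrite Gamma_lin; exact: (hilbert_lin hs).
- move=> c f g k [_ Hf] [_ Hg] [_ Hk]; rewrite /ip_phi Gamma_lin.
  exact: (hilbert_ip_lin hs).
- by move=> f g [_ Hf] [_ Hg]; exact: (hilbert_ip_conj hs).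
- by move=> f [_ Hf]; exact: (hilbert_ip_ge0 hs).
- move=> f [Vf Hf] f0; apply: Gamma_inj => //.
  exact: (hilbert_ip_eq0 hs).
move=> u Hu cu.
have GB f g : G (f - g) = G f - G g by rewrite GammaD GammaN.
have [g Hg hg] : exists2 g, H g & forall e : R, 0 < e -> exists M : nat, forall n : nat,
    (M <= n)%N -> ip_norm ip (G (u n) - g) < e.
  apply: (hilbert_complete hs); first by move=> n; have [] := Hu n.
  move=> e e0; have [M hM] := cu e e0; exists M => m n mM nM.
  by have := hM m n mM nM; rewrite ip_norm_phi GB.
have [f Hf fg] := Gamma_surj (anti_invariant_closed (fun n => Gamma_anti_invariant
  (Hu n)) Hg hg).
exists f => // e e0; have [M hM] := hg e e0; exists M => n nM.
by rewrite ip_norm_phi GB fg; exact: hM.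
Qed.

Lemma Gamma_unitary : unitary Hp ip_phi Hm ip G.
Proof.
split => //; first by move=> c f g _ _; exact: Gamma_lin.
split.
- by move=> f Hf; exact: Gamma_anti_invariant.
- move=> f g /set_mem [Vf _] /set_mem[Vg _] E; apply/eqP; rewrite -subr_eq0; apply/eqP.
  apply: Gamma_inj; last by rewrite GammaD GammaN E subrr.
  by rewrite addrC -scaleN1r; exact: Hol_lin.
- by move=> g /Gamma_surj[f Hf fg]; exists f.
Qed.

(** The orthogonal projection of the kernel function at w onto the
    anti-invariant functions. *)
Definition ker_anti w : Fun := 2^-1 *: (kappa^~ w - ((kappa^~ w) \o sigma)).

Lemma ker_anti_in w : U w -> Hm (ker_anti w).
Proof.
move=> Uw; have [Hk _] := H_ker Uw; apply/anti_invariantP; split.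
  by apply: (hilbert_scale hs); apply: (hilbert_sub hs) => //; exact: H_sigma.
move=> z; rewrite /ker_anti !fctE sigmaK -[in RHS]opprB.
by rewrite [X in _ = - X]mulrN opprK.
Qed.

Lemma ker_anti_reproduces g w : U w -> Hm g -> ip g (ker_anti w) = g w.
Proof.
move=> Uw /anti_invariantP[Hg gs]; have [Hk kE] := H_ker Uw; have Hks := H_sigma Hk.
rewrite /ker_anti (ipZr hs) //; last exact: (hilbert_sub hs).
rewrite (ipBr hs) // kE //.
have -> : ip g (kappa^~ w \o sigma) = - g w.
  have {1}-> : g = (g \o sigma) \o sigma by apply/funext => z; rewrite !fctE sigmaK.
  rewrite ip_sigma //; last exact: H_sigma.
  by rewrite kE ?fctE ?gs //; exact: H_sigma.
have -> : (2^-1 : C)^* = 2^-1 by rewrite fmorphV rmorph_nat.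
have -> : g w - - g w = 2 * g w by rewrite opprK mulr_natl mulr2n.
by rewrite mulrA mulVf ?mul1r // pnatr_eq0.
Qed.

(** Gamma is isometric, so the representer is the preimage of [ker_anti z],
    rescaled because Gamma f z = J z f (phi z). *)
Lemma regular_kernel z : U z -> Jac phi z != 0 ->
  exists2 k, Hp k & forall f, Hp f -> ip_phi f k = f (phi z).
Proof.
move=> Uz Jz; have [q Hq qE] := Gamma_surj (ker_anti_in Uz).
exists (((Jac phi z)^*)^-1 *: q); first exact: (hilbert_scale H_phi_hilbert).
move=> f Hf; rewrite (ipZr H_phi_hilbert) // /ip_phi qE ker_anti_reproduces //.
  by rewrite fmorphV /= conjCK GammaE // mulrA mulVf // mul1r.
exact: Gamma_anti_invariant.
Qed.

(** Evaluation at v is the pointwise limit of evaluations at regular values,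
    which [regular_kernel] represents. *)
Lemma point_kernel v : V v -> exists2 k, Hp k & forall f, Hp f -> ip_phi f k = f v.
Proof.
move=> Vv; have [z0 Uz0 <-] := phi_surj phi_proper Vv.
have ex (n : nat) : exists k, Hp k /\ exists z, nrm (z - z0) < n.+1%:R^-1 /\
    forall f, Hp f -> ip_phi f k = f (phi z).
  have n0 : (0 : R) < n.+1%:R^-1 by rewrite invr_gt0 ltr0n.
  have [z [Uz zn Jz]] := regular_dense Uz0 n0.
  by have [k Hk kE] := regular_kernel Uz Jz; exists k; split => //; exists z.
have [k hk] := choice ex.
apply: (weak_limit H_phi_hilbert (k := k)); first by move=> n; have [] := hk n.
move=> f Hf e e0; have [dl dl0 hdl] := comp_phi_continuous Hf.1 Uz0 e0.
have [M _ hM] := near_infty_natSinv_lt (PosNum dl0).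
exists M => n Mn; have [_ [z [zn ->//]]] := hk n.
by apply: ltW; apply: hdl; apply: lt_trans zn _; exact: hM.
Qed.

(** As functions of z both sides of the formula are anti-invariant elements of
    H representing the same functional, hence are equal. *)
Lemma H_phi_kernel : exists2 kappa_phi : Cd -> Cd -> C, rkhs V Hp ip_phi kappa_phi &
  forall z w, U z -> U w ->
    Jac phi z * kappa_phi (phi z) (phi w) * (Jac phi w)^* =
    2^-1 * (kappa z w - kappa (sigma z) w).
Proof.
have ex v : exists k, V v -> Hp k /\ forall f, Hp f -> ip_phi f k = f v.
  have [Vv|nVv] := pselect (V v); last by exists 0.
  by have [k Hk kE] := point_kernel Vv; exists k.
have [k hk] := choice ex.
exists (fun x v => k v x).
  split; [exact: H_phi_hilbert|by move=> f [[]]|].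
  by move=> w Vw; have [Hkw kE] := hk w Vw; split.
move=> z w Uz Uw; have Vw := phiV phi_proper Uw.
have [Hk kE] := hk _ Vw.
pose D : Fun := (Jac phi w)^* *: G (k (phi w)) - ker_anti w.
have HmK := ker_anti_in Uw; have HmG := Gamma_anti_invariant Hk.
have HK : H (ker_anti w) by case: HmK.
have HG : H (G (k (phi w))) by case: HmG.
have Hm0 : Hm 0.
  by apply/anti_invariantP; split=> [|?]; [exact: (hilbert_0 hs)|rewrite oppr0].
have HmN : Hm (- ker_anti w).
  by rewrite -scaleN1r -[_ *: _]addr0; exact: anti_invariant_lin.
have HmD : Hm D by exact: anti_invariant_lin.
have HD : H D by case: HmD.
have D0 : D = 0.
  apply: (hilbert_ip_eq0 hs) => //; have [f Hf fE] := Gamma_surj HmD.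
  rewrite {2}/D (ipBr hs) //; last exact: (hilbert_scale hs).
  rewrite (ipZr hs) // ker_anti_reproduces // conjCK -fE.
  have -> : ip (G f) (G (k (phi w))) = f (phi w) by exact: kE.
  by rewrite GammaE // subrr.
have : (Jac phi w)^* * G (k (phi w)) z = ker_anti w z.
  by apply/eqP; rewrite -subr_eq0; apply/eqP; exact: (congr1 (fun f : Fun => f z) D0).
by rewrite GammaE // mulrC => ->.
Qed.

End transfer.

Theorem theorem1p3 (R : realType) (d : nat)
    (sigma phi : 'rV[Cplx R]_d -> 'rV[Cplx R]_d) (U V : set 'rV[Cplx R]_d)
    (H : set ('rV[Cplx R]_d -> Cplx R))
    (ip : ('rV[Cplx R]_d -> Cplx R) -> ('rV[Cplx R]_d -> Cplx R) -> Cplx R)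
    (kappa : 'rV[Cplx R]_d -> 'rV[Cplx R]_d -> Cplx R) :
  (0 < d)%N ->
  affine_linear_map sigma -> involution sigma ->
  domain U -> domain V ->
  invariant_map sigma U phi -> m_proper 2 U V phi ->
  functional_hilbert_space U H ip kappa ->
  invariant_hilbert_space sigma U H ip ->
  (forall z, Jac sigma z = -1) ->
  affine_linear_fun U (Jac phi) ->
  exists ip_phi :
      ('rV[Cplx R]_d -> Cplx R) -> ('rV[Cplx R]_d -> Cplx R) -> Cplx R,
    [/\ hilbert_space (H_phi U V H phi) ip_phi,
        (forall f, H_phi U V H phi f -> ip_norm ip_phi f = norm_phi U ip phi f),
        unitary (H_phi U V H phi) ip_phi (anti_invariant sigma H) ip
          (Gamma U phi) &
        exists2 kappa_phi : 'rV[Cplx R]_d -> 'rV[Cplx R]_d -> Cplx R,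
          rkhs V (H_phi U V H phi) ip_phi kappa_phi &
          forall z w, U z -> U w ->
            Jac phi z * kappa_phi (phi z) (phi w) * (Jac phi w)^* =
            2^-1 * (kappa z w - kappa (sigma z) w)].
Proof.
move=> _ [A [B0 sE]] [_ sK] [_ oU _] [_ oV _] [sU ps] mp [[hs Hon Hker] Hhol].
move=> [_ Hsig ipsig] Js [a [b Ja]].
exists (ip_phi phi U ip); split.
- exact: (H_phi_hilbert sE sK oU oV sU ps mp Js Ja hs Hon Hhol Hsig ipsig).
- by [].
- exact: (Gamma_unitary sE sK oU oV sU ps mp Js Ja ip Hon Hhol).
- exact: (H_phi_kernel sE sK oU oV sU ps mp Js Ja hs Hon Hker Hhol Hsig ipsig).
Qed.
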